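(* The following dualities hold: (i) $M^+(\mathbb{B})^\dagger=O^+(\mathbb{B})$; (ii) $O^+(\mathbb{B})^\dagger=M^+(\mathbb{B})$; (iii) $S^+(\mathbb{B})^\dagger\subseteq S^+(\mathbb{B})$.
   Context: $\mathbb{B}$ is the open unit ball of $\mathbb{C}^n$, $\langle z,w\rangle=\sum_i z_i\overline{w_i}$, and $O(\mathbb{B})$ is the space of holomorphic functions on $\mathbb{B}$; $f_\alpha$ denotes the coefficient of $z^\alpha$ in the Taylor expansion of $f$ at $0$. $O^+(\mathbb{B})=\{f\in O(\mathbb{B}):\operatorname{Re}f\ge0\}$. $S^+(\mathbb{B})$ is the set of $f\in O(\mathbb{B})$ such that $\frac{f(z)+\overline{f(w)}}{1-\langle z,w\rangle}$ is a positive semidefinite kernel on $\mathbb{B}$. $M^+(\mathbb{B})$ is the set of functions $f(z)=\int_{\partial\mathbb{B}}\left[\frac{2}{1-\langle z,u\rangle}-1\right]d\mu(u)+it$ with $\mu$ a (finite) positive Borel measure on $\partial\mathbb{B}$ and $t\in\mathbb{R}$. The Drury space $\mathcal{H}$ is the Hilbert space of analytic functions on $\mathbb{B}$ with reproducing kernel $1/(1-\langle z,w\rangle)$, so $\langle f,g\rangle_{\mathcal{H}}=\sum_\alpha f_\alpha\overline{g_\alpha}\frac{\alpha!}{|\alpha|!}$. Define $$Q(f,g)=\langle f+\overline{f(0)},g\rangle_{\mathcal{H}}=\sum_\alpha f_\alpha\overline{g_\alpha}\frac{\alpha!}{|\alpha|!}+\overline{f(0)}\,\overline{g(0)}.$$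 For $f,g\in O(\mathbb{B})$ not both in $\mathcal{H}$, $Q(f,g)$ denotes this sum whenever it converges absolutely, and is otherwise undefined. For a set $\mathcal{C}\subset O(\mathbb{B})$, $$\mathcal{C}^\dagger=\{g\in O(\mathbb{B}):\operatorname{Re}Q(f,g)\ge0\text{ for every }f\in\mathcal{C}\text{ for which }Q(f,g)\text{ is defined}\}.$$ *)

(* Defs.v *)
From HB Require Import structures.
From mathcomp Require Import all_boot all_order all_algebra complex.
From mathcomp Require Import all_classical all_reals all_analysis.

Set Implicit Arguments.
Unset Strict Implicit.
Unset Printing Implicit Defensive.

Import Order.TTheory GRing.Theory Num.Theory numFieldNormedType.Exports.

Local Open Scope classical_set_scope.
Local Open Scope ring_scope.
Local Open Scope complex_scope.

(* R[i] as a normed space over itself, hence 'rV[R[i]]_n as one over R[i].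
   The norm on 'rV[R[i]]_n is the max norm: it has the usual topology and the
   usual complex differentiable functions, but its unit ball is the polydisc.
   On R[i], x <= y means that y - x is a nonnegative real. *)
#[non_forgetful_inheritance]
HB.instance Definition _ (R : realType) := NormedModule.copy R[i] R[i]^o.

Section Ball.
Variables (R : realType) (n : nat).
Local Notation C := R[i].
Local Notation Cn := 'rV[R[i]]_n.

Definition hdot (z w : Cn) : C := \sum_i z ord0 i * (w ord0 i)^*.

Definition unit_ball : set Cn := [set z | \sum_i `|z ord0 i| ^+ 2 < 1].

Definition unit_sphere : set Cn := [set z | \sum_i `|z ord0 i| ^+ 2 = 1].

(* Functions on the ball are total functions on C^n whose values outside the
   ball are irrelevant; [differentiable] is Frechet differentiability over the
   complex scalars. *)
Definition O_ball : set (Cn -> C) :=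
  [set f | forall z, unit_ball z -> differentiable f z].

Definition O_plus : set (Cn -> C) :=
  [set f | O_ball f /\ forall z, unit_ball z -> 0 <= complex.Re (f z)].

(* The inequality in R[i] also says that the double sum is real. *)
Definition psd_kernel (D : set Cn) (K : Cn -> Cn -> C) : Prop :=
  forall (m : nat) (z : 'I_m -> Cn) (c : 'I_m -> C), (forall i, D (z i)) ->
    0 <= \sum_i \sum_j c i * (c j)^* * K (z i) (z j).

Definition S_plus : set (Cn -> C) :=
  [set f | O_ball f /\
    psd_kernel unit_ball (fun z w => (f z + (f w)^*) / (1 - hdot z w))].

Definition borel_Cn := g_sigma_algebraType (@open Cn).

Definition cintegral (mu : {measure set borel_Cn -> \bar R}) (D : set borel_Cn)
    (h : borel_Cn -> C) : C :=
  (\int[mu]_(u in D) complex.Re (h u)) +i* (\int[mu]_(u in D) complex.Im (h u)).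

(* A finite positive Borel measure on the sphere is given as a finite Borel
   measure on C^n that is carried by the sphere. *)
Definition M_plus : set (Cn -> C) :=
  [set f | exists (mu : {finite_measure set borel_Cn -> \bar R}) (t : R),
    mu (~` unit_sphere) = 0%E /\
    forall z, unit_ball z ->
      f z = cintegral mu unit_sphere (fun u => 2 / (1 - hdot z u) - 1)
            + 'i * t%:C].

Definition multi_index := {ffun 'I_n -> nat}.

Definition mi_abs (a : multi_index) : nat := (\sum_i a i)%N.

Definition mi_fact (a : multi_index) : nat := (\prod_i (a i)`!)%N.

Definition mi_derive (a : multi_index) (f : Cn -> C) : Cn -> C :=
  foldr (fun i g => iter (a i) (fun h : Cn -> C => 'D_(delta_mx ord0 i) h) g)
    f (enum 'I_n).

Definition taylor_coef (f : Cn -> C) (a : multi_index) : C :=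
  mi_derive a f 0 / (mi_fact a)%:R.

Definition drury_weight (a : multi_index) : R :=
  (mi_fact a)%:R / ((mi_abs a)`!)%:R.

(* The absolute value of a complex number, as an element of R. *)
Definition cabs (x : C) : R := complex.Re `|x|.

Definition drury_space : set (Cn -> C) :=
  [set f | O_ball f /\
    summable setT (fun a => (cabs (taylor_coef f a) ^+ 2 * drury_weight a)%:E)].

(* The sum of an absolutely convergent family (a junk value otherwise). *)
Definition rsum (u : multi_index -> R) : R :=
  fine (\esum_(a in setT) (Num.max (u a) 0)%:E) -
  fine (\esum_(a in setT) (Num.max (- u a) 0)%:E).

Definition csum (u : multi_index -> C) : C :=
  rsum (fun a => complex.Re (u a)) +i* rsum (fun a => complex.Im (u a)).

Definition Q_term (f g : Cn -> C) (a : multi_index) : C :=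
  taylor_coef f a * (taylor_coef g a)^* * (drury_weight a)%:C.

(* On drury_space the series converges absolutely by Cauchy-Schwarz, so csum is
   its sum in both cases. *)
Definition Q_defined (f g : Cn -> C) : Prop :=
  (drury_space f /\ drury_space g) \/
  summable setT (fun a => (cabs (Q_term f g a))%:E).

Definition Q (f g : Cn -> C) : C :=
  csum (Q_term f g) + (f 0)^* * (g 0)^*.

Definition dagger (A : set (Cn -> C)) : set (Cn -> C) :=
  [set g | O_ball g /\
    forall f, A f -> Q_defined f g -> 0 <= complex.Re (Q f g)].

End Ball.

Arguments O_ball : clear implicits.
Arguments O_plus : clear implicits.
Arguments S_plus : clear implicits.
Arguments M_plus : clear implicits.

(* Main.v *)
(* Everything is computed on Taylor coefficients.  A function of M^+ given by
   [mu] and [t] has coefficients 2 (|a|!/a!) conj (int u^a dmu) for a != 0, so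
   that Q(f, g) = 2 conj (sum_a g_a int u^a dmu) as soon as it is defined.

   (i) On the one hand this is 2 conj (lim_(r -> 1) int g(r u) dmu(u)), by Abel
   summation.  On the other hand, for every w in the ball there is a measure
   with moments int u^a dmu = w^a, and then Q(f, g) = 2 conj (g w).

   (ii) Re Q is symmetric.  If g is in the dual of O^+, the functional sending
   the polynomial sum_a p_a u^a to Q(p, g), corrected in degree 0, has
   nonnegative real part wherever Re p >= 0 on the sphere, hence is given by
   the moments of a positive measure; this measure represents g.

   Both measures come from one moment theorem.  Following Riesz, the functional
   is extended positively to all bounded functions on the sphere; its values on
   the indicators of nested cells shrinking to points are the lengths of nested
   intervals, which define a map from an interval to the sphere, and the measure
   is the image of Lebesgue measure.

   (iii) For points z_s of the ball and scalars c_s, put k_w = 1/(1 - <., w>),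
   H = sum_t conj(c_t) k_(z_t), F = sum_s conj(c_s H(z_s)) k_(z_s) and
   f = F - F(0)/2.  Then 2 Re Q(f, g) is the quadratic form of the kernel of g,
   and f is in S^+ because, writing a = <z,x>, b = <y,w>, c = <z,w>, d = <y,x>,
   the kernel (1/(1-a) + 1/(1-b) - 1) / ((1-c)(1-d)) on pairs (z,y), (w,x) is
   the sum over m of the Gram kernels of sum_(s <= m) z^(tensor s) (x)
   y^(tensor (m-s)).

   That Frechet differentiability on the ball gives an absolutely convergent
   power series is proved from Goursat's theorem on rectangles, pulled back by
   the exponential to compute circle means, and from means over roots of unity
   in several variables. *)

From HB Require Import structures.
Require Import Defs.
From mathcomp Require Import all_boot all_order all_algebra complex.
From mathcomp Require Import all_classical all_reals all_analysis.
From mathcomp Require Import cyclic separable cyclotomic.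
From mathcomp Require Import ring lra.

Set Implicit Arguments.
Unset Strict Implicit.
Unset Printing Implicit Defensive.

Import Order.TTheory GRing.Theory Num.Theory numFieldNormedType.Exports.

Local Open Scope classical_set_scope.
Local Open Scope ring_scope.
Local Open Scope complex_scope.

(** Each dual is tested against functions f for which Q(f, g) is defined whatever the holomorphic g
    is: functions of M^+ with moments w^a, polynomials, and finite combinations of the kernels k_w.
    For these the series Q is finite or is made of expansions of g at points of the ball. The
    opposite inclusions start from the absolute convergence of Q alone, with no control of g near
    the sphere; this forces the passage through radii r < 1.

    A measure with moments w^a exists because evaluation at w is positive: by the maximum principle
    a polynomial with Re >= 0 on the sphere has Re >= 0 inside.

    The positive functional is extended to all bounded functions, and not only to continuous ones,
    so that it has values on indicators of cells. It is finitely additive only; countable additivity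
    is supplied by Lebesgue measure, and the functional agrees with the integral on uniformly
    continuous functions.

    Integrals are estimated through real and imaginary parts, at the cost of a factor 2. It is
    harmless in limits, and the maximum principle removes it by passing to powers. *)

Section ComplexModulus.
Variable R : realType.
Local Notation C := R[i].
Local Notation Re := complex.Re.
Local Notation Im := complex.Im.
Implicit Types (x y z : C) (a b : R).

Lemma ReD x y : Re (x + y) = Re x + Re y. Proof. by case: x y => ? ? [? ?]. Qed.
Lemma ImD x y : Im (x + y) = Im x + Im y. Proof. by case: x y => ? ? [? ?]. Qed.
Lemma ReN x : Re (- x) = - Re x. Proof. by case: x. Qed.
Lemma ImN x : Im (- x) = - Im x. Proof. by case: x. Qed.
Lemma ReB x y : Re (x - y) = Re x - Re y. Proof. by rewrite ReD ReN. Qed.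
Lemma ImB x y : Im (x - y) = Im x - Im y. Proof. by rewrite ImD ImN. Qed.
Lemma ReM x y : Re (x * y) = Re x * Re y - Im x * Im y.
Proof. by case: x y => ? ? [? ?]. Qed.
Lemma ImM x y : Im (x * y) = Re x * Im y + Im x * Re y.
Proof. by case: x y => ? ? [? ?]. Qed.
Lemma ReJ x : Re x^* = Re x. Proof. by case: x. Qed.
Lemma ImJ x : Im x^* = - Im x. Proof. by case: x. Qed.
Lemma ReMr a x : Re (a%:C * x) = a * Re x.
Proof. by rewrite ReM /= mul0r subr0. Qed.
Lemma ImMr a x : Im (a%:C * x) = a * Im x.
Proof. by rewrite ImM /= mul0r addr0. Qed.

Lemma complex_ext x y : Re x = Re y -> Im x = Im y -> x = y.
Proof. by case: x y => ? ? [? ?] /= -> ->. Qed.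

Lemma Re_sum (I : Type) (r : seq I) (P : pred I) (F : I -> C) :
  Re (\sum_(i <- r | P i) F i) = \sum_(i <- r | P i) Re (F i).
Proof. exact: (big_morph _ ReD (erefl _)). Qed.

Lemma Im_sum (I : Type) (r : seq I) (P : pred I) (F : I -> C) :
  Im (\sum_(i <- r | P i) F i) = \sum_(i <- r | P i) Im (F i).
Proof. exact: (big_morph _ ImD (erefl _)). Qed.

Lemma realc_sum (I : Type) (r : seq I) (P : pred I) (F : I -> R) :
  (\sum_(i <- r | P i) F i)%:C = \sum_(i <- r | P i) (F i)%:C.
Proof. exact: rmorph_sum. Qed.

Lemma cabsE x : cabs x = Num.sqrt (Re x ^+ 2 + Im x ^+ 2).
Proof. by rewrite /cabs normc_def. Qed.

Lemma normC_cabs x : `|x| = (cabs x)%:C. Proof. by rewrite cabsE normc_def. Qed.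

Lemma cabs_ge0 x : 0 <= cabs x. Proof. by rewrite cabsE sqrtr_ge0. Qed.

Lemma cabsM x y : cabs (x * y) = cabs x * cabs y.
Proof. by rewrite /cabs normrM !normC_cabs -rmorphM. Qed.

Lemma cabs0 : cabs (0 : C) = 0. Proof. by rewrite /cabs normr0. Qed.
Lemma cabs1 : cabs (1 : C) = 1. Proof. by rewrite /cabs normr1. Qed.
Lemma cabsN x : cabs (- x) = cabs x. Proof. by rewrite /cabs normrN. Qed.
Lemma cabsBC x y : cabs (x - y) = cabs (y - x). Proof. by rewrite -cabsN opprB. Qed.
Lemma cabsD x y : cabs (x + y) <= cabs x + cabs y.
Proof. by have := ler_normD x y; rewrite !normC_cabs -rmorphD lecR. Qed.
Lemma cabsB x y : cabs (x - y) <= cabs x + cabs y.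
Proof. by rewrite -(cabsN y) cabsD. Qed.
Lemma cabs_le_dist x y : cabs x <= cabs y + cabs (x - y).
Proof. by rewrite -{1}(subrK y x) addrC cabsD. Qed.
Lemma cabsX x k : cabs (x ^+ k) = cabs x ^+ k.
Proof. by elim: k => [|k IH]; rewrite ?expr0 ?cabs1 // !exprS cabsM IH. Qed.
Lemma cabsV x : cabs x^-1 = (cabs x)^-1.
Proof. by rewrite /cabs normfV normC_cabs -(fmorphV (real_complex R)). Qed.
Lemma cabs_eq0 x : (cabs x == 0) = (x == 0).
Proof. by rewrite -(normr_eq0 x) normC_cabs -(inj_eq (@complexI R)). Qed.
Lemma cabs_gt0 x : (0 < cabs x) = (x != 0).
Proof. by rewrite lt_def cabs_eq0 cabs_ge0 andbT. Qed.
Lemma cabsJ x : cabs x^* = cabs x. Proof. by rewrite /cabs normcJ. Qed.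
Lemma cabsR a : cabs a%:C = `|a|.
Proof. by rewrite cabsE /= expr0n addr0 sqrtr_sqr. Qed.
Lemma cabs_ge0R a : 0 <= a -> cabs a%:C = a.
Proof. by move=> a0; rewrite cabsR ger0_norm. Qed.
Lemma cabs_nat k : cabs (k%:R : C) = k%:R.
Proof. by rewrite -(rmorph_nat (real_complex R)) cabs_ge0R. Qed.
Lemma cabsi : cabs ('i : C) = 1.
Proof. by rewrite cabsE /= expr0n add0r expr1n sqrtr1. Qed.

Lemma sqr_cabs x : cabs x ^+ 2 = Re x ^+ 2 + Im x ^+ 2.
Proof. by rewrite cabsE sqr_sqrtr // addr_ge0 // sqr_ge0. Qed.
Lemma mulcJ x : x * x^* = (cabs x ^+ 2)%:C.
Proof. by rewrite -sqr_normc normC_cabs rmorphXn. Qed.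

Lemma Re_le_cabs x : `|Re x| <= cabs x.
Proof. by rewrite cabsE -sqrtr_sqr ler_wsqrtr // lerDl sqr_ge0. Qed.
Lemma Im_le_cabs x : `|Im x| <= cabs x.
Proof. by rewrite cabsE -sqrtr_sqr ler_wsqrtr // lerDr sqr_ge0. Qed.
Lemma Re_ge_cabs x : - cabs x <= Re x.
Proof. by have := Re_le_cabs x; rewrite ler_norml => /andP[]. Qed.
Lemma cabs_le_ReIm x : cabs x <= `|Re x| + `|Im x|.
Proof.
rewrite {1}(complexE x); apply: (le_trans (cabsD _ _)).
by rewrite cabsM cabsi mul1r !cabsR.
Qed.

Lemma cabs_sum (I : Type) (r : seq I) (P : pred I) (F : I -> C) :
  cabs (\sum_(i <- r | P i) F i) <= \sum_(i <- r | P i) cabs (F i).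
Proof.
elim/big_rec2: _ => [|i y1 y2 _ H]; first by rewrite cabs0.
by apply: (le_trans (cabsD _ _)); rewrite lerD2l.
Qed.

Lemma cabs_prod (I : Type) (r : seq I) (P : pred I) (F : I -> C) :
  cabs (\prod_(i <- r | P i) F i) = \prod_(i <- r | P i) cabs (F i).
Proof. exact: (big_morph _ cabsM cabs1). Qed.

Lemma gt0_realc (e : C) : 0 < e -> exists2 d : R, 0 < d & e = d%:C.
Proof. by case: e => a b; rewrite ltcE /= => /andP[/eqP-> H]; exists a. Qed.

Lemma eps_eq0 (a : R) : 0 <= a -> (forall e, 0 < e -> a <= e) -> a = 0.
Proof.
move=> a0 H; apply/eqP; rewrite eq_le a0 andbT.
by apply/ler_addgt0Pr => e /H; rewrite add0r.
Qed.

Lemma cabs_eps_eq x y : (forall e, 0 < e -> cabs (x - y) <= e) -> x = y.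
Proof.
move=> H; apply/eqP; rewrite -subr_eq0 -cabs_eq0; apply/eqP.
exact: eps_eq0 (cabs_ge0 _) H.
Qed.

Lemma cabs_lt_eps_eq x y : (forall e, 0 < e -> cabs (x - y) < e) -> x = y.
Proof. by move=> H; apply: cabs_eps_eq => e /H /ltW. Qed.

Lemma geo_small (q A : R) : 0 <= q -> q < 1 ->
  forall e, 0 < e -> exists K, forall k, (K <= k)%N -> A * q ^+ k < e.
Proof.
move=> q0 q1 e e0.
have /cvgrPdist_lt H : (fun k => A * q ^+ k) @ \oo --> A * 0.
  by apply: cvgMr; apply: cvg_expr; rewrite ger0_norm.
have [K _ HK] := H _ e0; exists K => k /HK /=.
by rewrite mulr0 sub0r normrN => /(le_lt_trans (ler_norm _)).
Qed.

End ComplexModulus.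

(** * Integration of complex-valued functions *)

Section ComplexIntegral.
Variable R : realType.
Local Notation C := R[i].
Local Notation Re := complex.Re.
Local Notation Im := complex.Im.

Section Measure.
Context d (T : measurableType d) (mu : {measure set T -> \bar R}).
Variable D : set T.
Hypothesis mD : measurable D.

Definition cintegrable (h : T -> C) : Prop :=
  mu.-integrable D (EFin \o (fun u => Re (h u))) /\
  mu.-integrable D (EFin \o (fun u => Im (h u))).

(** This is [cintegral] over an arbitrary measurable space, so that the same rules serve Lebesgue
    integrals over intervals and integrals over the sphere. *)
Definition cint (h : T -> C) : C :=
  (\int[mu]_(u in D) Re (h u)) +i* (\int[mu]_(u in D) Im (h u)).

Lemma integrable_eqR (f g : T -> R) : f =1 g ->
  mu.-integrable D (EFin \o f) -> mu.-integrable D (EFin \o g).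
Proof. by move=> /funext ->. Qed.

Lemma integrableDR (f g : T -> R) : mu.-integrable D (EFin \o f) ->
  mu.-integrable D (EFin \o g) -> mu.-integrable D (EFin \o (fun x => f x + g x)).
Proof. by move=> fi gi; have := integrableD mD fi gi; rewrite /comp/=. Qed.

Lemma integrableZR (f : T -> R) (k : R) : mu.-integrable D (EFin \o f) ->
  mu.-integrable D (EFin \o (fun x => k * f x)).
Proof. by move=> fi; have := integrableZl mD k fi; rewrite /comp/=. Qed.

Lemma cintegrableD h1 h2 : cintegrable h1 -> cintegrable h2 ->
  cintegrable (fun u => h1 u + h2 u).
Proof.
move=> [a1 b1] [a2 b2]; split.
- by apply: (@integrable_eqR _ _ _ (integrableDR a1 a2)) => u; rewrite /= ReD.
- by apply: (@integrable_eqR _ _ _ (integrableDR b1 b2)) => u; rewrite /= ImD.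
Qed.

Lemma cintegrableZ c h : cintegrable h -> cintegrable (fun u => c * h u).
Proof.
move=> [a b]; split.
- apply: (@integrable_eqR _ _ _
    (integrableDR (integrableZR (Re c) a) (integrableZR (- Im c) b))) => u.
  by rewrite /= ReM; ring.
- apply: (@integrable_eqR _ _ _
    (integrableDR (integrableZR (Re c) b) (integrableZR (Im c) a))) => u.
  by rewrite /= ImM; ring.
Qed.

Lemma cintD h1 h2 : cintegrable h1 -> cintegrable h2 ->
  cint (fun u => h1 u + h2 u) = cint h1 + cint h2.
Proof.
move=> [a1 b1] [a2 b2]; apply: complex_ext; rewrite ?ReD ?ImD /= -RintegralD //.
- by apply: eq_Rintegral => u _; rewrite ReD.
- by apply: eq_Rintegral => u _; rewrite ImD.
Qed.

Lemma cintZ c h : cintegrable h -> cint (fun u => c * h u) = c * cint h.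
Proof.
move=> [a b]; apply: complex_ext; rewrite ?ReM ?ImM /= -!RintegralZl //.
- rewrite -RintegralB //; try exact: integrableZR.
  by apply: eq_Rintegral => u _; rewrite ReM.
- rewrite -RintegralD //; try exact: integrableZR.
  by apply: eq_Rintegral => u _; rewrite ImM.
Qed.

Lemma cintegrableN h : cintegrable h -> cintegrable (fun u => - h u).
Proof.
by move=> /(cintegrableZ (-1)); rewrite (_ : (fun _ => _) = fun u => - h u) //;
  apply/funext => u; rewrite mulN1r.
Qed.

Lemma cintB h1 h2 : cintegrable h1 -> cintegrable h2 ->
  cint (fun u => h1 u - h2 u) = cint h1 - cint h2.
Proof.
move=> i1 i2; rewrite cintD //; last exact: cintegrableN.
by rewrite -mulN1r -cintZ //; congr (_ + cint _); apply/funext => u; rewrite mulN1r.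
Qed.

Lemma cintegrable0 : cintegrable (fun=> 0).
Proof. by split; exact: integrable0. Qed.

Lemma cint0 : cint (fun=> 0) = 0.
Proof. by apply: complex_ext; rewrite /= Rintegral_cst // mul0r. Qed.

Lemma cintegrable_sum (I : Type) (r : seq I) (F : I -> T -> C) :
  (forall i, cintegrable (F i)) -> cintegrable (fun u => \sum_(i <- r) F i u).
Proof.
move=> H; elim: r => [|i r IH].
  by rewrite (_ : (fun _ => _) = fun=> 0); [exact: cintegrable0|apply/funext => u; rewrite big_nil].
rewrite (_ : (fun _ => _) = fun u => F i u + \sum_(j <- r) F j u).
  exact: cintegrableD.
by apply/funext => u; rewrite big_cons.
Qed.

Lemma cint_sum (I : Type) (r : seq I) (F : I -> T -> C) :
  (forall i, cintegrable (F i)) ->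
  cint (fun u => \sum_(i <- r) F i u) = \sum_(i <- r) cint (F i).
Proof.
move=> H; elim: r => [|i r IH].
  by rewrite big_nil -[RHS]cint0; congr (cint _); apply/funext => u; rewrite big_nil.
rewrite big_cons -IH -cintD //; last exact: cintegrable_sum.
by congr (cint _); apply/funext => u; rewrite big_cons.
Qed.

Lemma cintJ h : cintegrable h -> cint (fun u => (h u)^*) = (cint h)^*.
Proof.
move=> [_ b]; apply: complex_ext; rewrite ?ReJ ?ImJ /=.
  by apply: eq_Rintegral => u _; rewrite ReJ.
by rewrite -mulN1r -RintegralZl //; apply: eq_Rintegral => u _; rewrite ImJ mulN1r.
Qed.

Lemma cintegrableJ h : cintegrable h -> cintegrable (fun u => (h u)^*).
Proof.
move=> [a b]; split.
  by apply: (@integrable_eqR _ _ _ a) => u; rewrite ReJ.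
by apply: (@integrable_eqR _ _ _ (integrableZR (-1) b)) => u; rewrite ImJ mulN1r.
Qed.

Hypothesis fD : (mu D < +oo)%E.

Lemma integrable_cstR (k : R) : mu.-integrable D (EFin \o (fun=> k)).
Proof.
apply: measurable_bounded_integrable => //.
by exists `|k|; split; rewrite ?num_real // => x kx u _; exact: ltW.
Qed.

Lemma cintegrable_cst c : cintegrable (fun=> c).
Proof. by split; exact: integrable_cstR. Qed.

Lemma cint_cst c : cint (fun=> c) = c * (fine (mu D))%:C.
Proof. by apply: complex_ext; rewrite ?ReM ?ImM /= Rintegral_cst // ; ring. Qed.

Lemma Rint_bound (f : T -> R) M : mu.-integrable D (EFin \o f) ->
  (forall u, D u -> `|f u| <= M) -> `|\int[mu]_(u in D) f u| <= M * fine (mu D).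
Proof.
move=> fi H; apply: (le_trans (le_normr_Rintegral _ fi)) => //.
rewrite -Rintegral_cst //; apply: le_Rintegral => //; last exact: integrable_cstR.
by move/integrable_norm : fi.
Qed.

(** The factor 2 comes from estimating real and imaginary parts separately. It disappears in limits,
    and [disc_max] gets rid of it where the sharp constant matters. *)
Lemma cint_bound h M : cintegrable h -> (forall u, D u -> cabs (h u) <= M) ->
  cabs (cint h) <= 2 * M * fine (mu D).
Proof.
move=> [a b] H; apply: (le_trans (cabs_le_ReIm _)); rewrite -mulrA mulrDl !mul1r.
apply: lerD; apply: Rint_bound => // u Du; apply: le_trans (H _ Du).
- exact: Re_le_cabs.
- exact: Im_le_cabs.
Qed.

End Measure.

Section Interval.
Local Notation mu := (@lebesgue_measure R).
Implicit Types (a b : R).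

(** The bounds are real numbers: the norm of [R[i]] takes its values in [R[i]] itself, while all
    estimates below are made with [cabs]. *)
Definition rccont (h : R -> C) (x : R) : Prop :=
  forall e : R, 0 < e -> exists2 dl : R, 0 < dl &
    forall y, `|y - x| < dl -> cabs (h y - h x) < e.

Definition citv a b (h : R -> C) : C := cint mu `[a, b] h.

Lemma rccont_Re h x : rccont h x -> {for x, continuous (fun y => Re (h y) : R^o)}.
Proof.
move=> H; apply/cvgrPdist_lt => e /H [dl dl0 Hd]; near=> y.
rewrite -ReB -opprB ReN normrN; apply: le_lt_trans (Re_le_cabs _) _.
apply: Hd; rewrite distrC; near: y.
by exists dl.
Unshelve. all: by end_near. Qed.

Lemma rccont_Im h x : rccont h x -> {for x, continuous (fun y => Im (h y) : R^o)}.
Proof.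
move=> H; apply/cvgrPdist_lt => e /H [dl dl0 Hd]; near=> y.
rewrite -ImB -opprB ImN normrN; apply: le_lt_trans (Im_le_cabs _) _.
apply: Hd; rewrite distrC; near: y.
by exists dl.
Unshelve. all: by end_near. Qed.

Lemma citv_integrable a b h : (forall x, a <= x <= b -> rccont h x) ->
  cintegrable mu `[a, b] h.
Proof.
move=> H; split.
- apply: continuous_compact_integrable; first exact: segment_compact.
  apply: continuous_in_subspaceT => x /set_mem /=; rewrite in_itv /= => xab.
  exact: rccont_Re (H _ xab).
- apply: continuous_compact_integrable; first exact: segment_compact.
  apply: continuous_in_subspaceT => x /set_mem /=; rewrite in_itv /= => xab.
  exact: rccont_Im (H _ xab).
Qed.

Lemma itv_measE a b : a <= b -> fine (mu `[a, b]) = b - a.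
Proof.
rewrite le_eqVlt => /predU1P[->|ab].
  by rewrite lebesgue_measure_itv /= lte_fin ltxx /= subrr.
by rewrite lebesgue_measure_itv /= lte_fin ab /=.
Qed.

Lemma itv_fin a b : (mu `[a, b] < +oo)%E.
Proof. by rewrite lebesgue_measure_itv /=; case: ifP => _ /=; rewrite ltry. Qed.

Lemma citv_bound a b h M : a <= b -> (forall x, a <= x <= b -> rccont h x) ->
  (forall x, a <= x <= b -> cabs (h x) <= M) -> cabs (citv a b h) <= 2 * M * (b - a).
Proof.
move=> ab H HM; rewrite -itv_measE //.
apply: (cint_bound _ (itv_fin a b) (citv_integrable H)) => //.
Qed.

Lemma citv_split a c b h : a <= c -> c <= b ->
  (forall x, a <= x <= b -> rccont h x) -> citv a b h = citv a c h + citv c b h.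
Proof.
move=> ac cb H; have [i1 i2] := citv_integrable H.
have spl (f : R -> R) : mu.-integrable `[a, b] (EFin \o f) ->
  \int[mu]_(u in `[a, b]) f u =
  \int[mu]_(u in `[a, c]) f u + \int[mu]_(u in `[c, b]) f u.
  move=> fi.
  have := @Rintegral_itvB R f (BLeft a) (BRight b) c fi; rewrite !bnd_simp.
  move=> /(_ ac cb)/(canRL (subrK _)) ->; rewrite addrC; congr (_ + _).
  apply: Rintegral_itv_obnd_cbnd; apply: integrableS fi => //.
  by move=> x /=; rewrite !in_itv /= => /andP[cx ->]; rewrite (le_trans ac) // ltW.
by apply: complex_ext; rewrite ?ReD ?ImD /=; apply: spl.
Qed.

End Interval.
End ComplexIntegral.

(** * Holomorphic functions of one variable *)

Section Goursat.
Variable R : realType.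
Local Notation C := R[i].
Local Notation Re := complex.Re.
Local Notation Im := complex.Im.
Implicit Types (G : C -> C) (w z : C) (x y a b eta : R).

Definition ccont G z : Prop := forall e : R, 0 < e ->
  exists2 dl : R, 0 < dl & forall w, cabs (w - z) < dl -> cabs (G w - G z) < e.

Definition is_cdiff G z (d : C) : Prop := forall e : R, 0 < e ->
  exists2 dl : R, 0 < dl & forall h, cabs h < dl ->
    cabs (G (z + h) - G z - d * h) <= e * cabs h.

Definition cdiff G z : Prop := exists d, is_cdiff G z d.

Lemma cdiff_ccont G z : cdiff G z -> ccont G z.
Proof.
move=> [d Hd] e e0; have [dl dl0 H] := Hd 1 ltr01.
have K0 : 0 < 1 + cabs d by rewrite ltr_pwDl // cabs_ge0.
exists (Num.min dl (e / (1 + cabs d))).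
  by rewrite lt_min dl0 divr_gt0.
move=> w; rewrite lt_min => /andP[/H]; rewrite addrCA subrr addr0 mul1r => Hw wlt.
have -> : G w - G z = (G w - G z - d * (w - z)) + d * (w - z) by ring.
apply: le_lt_trans (cabsD _ _) _; rewrite cabsM.
apply: (@le_lt_trans _ _ ((1 + cabs d) * cabs (w - z))).
  by rewrite mulrDl mul1r lerD2r.
by rewrite mulrC -ltr_pdivlMr.
Qed.

(** The counterclockwise boundary integral, with opposite sides grouped so that each pair is one
    integral over a common interval. *)
Definition crect G (x1 x2 y1 y2 : R) : C :=
  citv x1 x2 (fun s => G (s +i* y1) - G (s +i* y2)) +
  'i * citv y1 y2 (fun t => G (x2 +i* t) - G (x1 +i* t)).

Definition on_rect (P : C -> Prop) (x1 x2 y1 y2 : R) :=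
  forall w, x1 <= Re w <= x2 -> y1 <= Im w <= y2 -> P w.

Lemma rccont_line G (f : R -> C) x : ccont G (f x) ->
  (forall y, cabs (f y - f x) = `|y - x|) -> rccont (fun t => G (f t)) x.
Proof.
move=> H Hf e /H [dl dl0 Hd]; exists dl => // y; rewrite -Hf; exact: Hd.
Qed.

Lemma cabs_horiz (s s' y : R) : cabs ((s +i* y) - (s' +i* y)) = `|s - s'|.
Proof. by rewrite cabsE /= subrr expr0n addr0 sqrtr_sqr. Qed.

Lemma cabs_vert (t t' x : R) : cabs ((x +i* t) - (x +i* t')) = `|t - t'|.
Proof. by rewrite cabsE /= subrr expr0n add0r sqrtr_sqr. Qed.

Lemma rccontB (f g : R -> C) x : rccont f x -> rccont g x -> rccont (fun y => f y - g y) x.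
Proof.
move=> Hf Hg e e0; have e20 : 0 < e / 2 by rewrite divr_gt0.
have [d1 d10 H1] := Hf _ e20; have [d2 d20 H2] := Hg _ e20.
exists (Num.min d1 d2); first by rewrite lt_min d10.
move=> y; rewrite lt_min => /andP[/H1 h1 /H2 h2].
have -> : f y - g y - (f x - g x) = (f y - f x) - (g y - g x) by ring.
by apply: le_lt_trans (cabsB _ _) _; rewrite (splitr e) ltrD.
Qed.

Lemma rccont_cst c x : rccont (fun=> c) x.
Proof. by move=> e e0; exists 1 => // y _; rewrite subrr cabs0. Qed.

Section Fixed.
Variable G : C -> C.

Lemma rect_contH x1 x2 y1 y2 : x1 <= x2 -> y1 <= y2 ->
  on_rect (ccont G) x1 x2 y1 y2 -> forall y, y1 <= y <= y2 ->
  forall s, x1 <= s <= x2 -> rccont (fun s => G (s +i* y)) s.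
Proof.
move=> x12 y12 H y yb s sb; apply: (@rccont_line G (fun s => s +i* y)).
  exact: H.
by move=> t; rewrite cabs_horiz.
Qed.

Lemma rect_contV x1 x2 y1 y2 : x1 <= x2 -> y1 <= y2 ->
  on_rect (ccont G) x1 x2 y1 y2 -> forall x, x1 <= x <= x2 ->
  forall t, y1 <= t <= y2 -> rccont (fun t => G (x +i* t)) t.
Proof.
move=> x12 y12 H y yb s sb; apply: (@rccont_line G (fun s => y +i* s)).
  exact: H.
by move=> t; rewrite cabs_vert.
Qed.

Lemma crect_splitx x1 x x2 y1 y2 : x1 <= x -> x <= x2 -> y1 <= y2 ->
  on_rect (ccont G) x1 x2 y1 y2 ->
  crect G x1 x2 y1 y2 = crect G x1 x y1 y2 + crect G x x2 y1 y2.
Proof.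
move=> l1 l2 ly H; have lx := le_trans l1 l2.
rewrite /crect (citv_split l1 l2); last first.
  by move=> s sb; apply: rccontB; apply: (rect_contH lx ly H) => //; rewrite lexx ly.
have iV u : x1 <= u <= x2 -> forall t, y1 <= t <= y2 -> rccont (fun t => G (u +i* t)) t.
  exact: (rect_contV lx ly H).
have -> : citv y1 y2 (fun t => G (x2 +i* t) - G (x1 +i* t)) =
  citv y1 y2 (fun t => G (x2 +i* t) - G (x +i* t)) +
  citv y1 y2 (fun t => G (x +i* t) - G (x1 +i* t)).
  rewrite /citv -cintD //.
  - by congr (cint _ _ _); apply/funext => t; ring.
  - by apply: citv_integrable => t tb; apply: rccontB; apply: iV => //;
      rewrite ?lx ?l1 ?l2 ?lexx.
  - by apply: citv_integrable => t tb; apply: rccontB; apply: iV => //;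
      rewrite ?lx ?l1 ?l2 ?lexx.
by ring.
Qed.

Lemma crect_splity x1 x2 y1 y y2 : x1 <= x2 -> y1 <= y -> y <= y2 ->
  on_rect (ccont G) x1 x2 y1 y2 ->
  crect G x1 x2 y1 y2 = crect G x1 x2 y1 y + crect G x1 x2 y y2.
Proof.
move=> lx l1 l2 H; have ly := le_trans l1 l2.
rewrite /crect [citv y1 y2 _](citv_split l1 l2); last first.
  by move=> s sb; apply: rccontB; apply: (rect_contV lx ly H) => //; rewrite lexx lx.
have iV u : y1 <= u <= y2 -> forall t, x1 <= t <= x2 -> rccont (fun t => G (t +i* u)) t.
  exact: (rect_contH lx ly H).
have -> : citv x1 x2 (fun t => G (t +i* y1) - G (t +i* y2)) =
  citv x1 x2 (fun t => G (t +i* y1) - G (t +i* y)) +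
  citv x1 x2 (fun t => G (t +i* y) - G (t +i* y2)).
  rewrite /citv -cintD //.
  - by congr (cint _ _ _); apply/funext => t; ring.
  - by apply: citv_integrable => t tb; apply: rccontB; apply: iV => //;
      rewrite ?ly ?l1 ?l2 ?lexx.
  - by apply: citv_integrable => t tb; apply: rccontB; apply: iV => //;
      rewrite ?ly ?l1 ?l2 ?lexx.
by ring.
Qed.

Lemma citv_near_cst a b (f : R -> C) (c : C) (eta : R) : a <= b ->
  (forall x, a <= x <= b -> rccont f x) ->
  (forall x, a <= x <= b -> cabs (f x - c) <= eta) ->
  cabs (citv a b f - c * (b - a)%:C) <= 2 * eta * (b - a).
Proof.
move=> ab Hf He; have -> : c * (b - a)%:C = citv a b (fun=> c).
  by rewrite /citv cint_cst // ?itv_measE // itv_fin.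
rewrite /citv -cintB //; last 2 first.
- exact: citv_integrable.
- by apply: citv_integrable => x _; exact: rccont_cst.
apply: citv_bound => // x xab; apply: rccontB; [exact: Hf|exact: rccont_cst].
Qed.

(* The boundary integral of the affine part vanishes. *)
Lemma crect_affine x1 x2 y1 y2 (c d w0 : C) (eta : R) : x1 <= x2 -> y1 <= y2 ->
  on_rect (ccont G) x1 x2 y1 y2 ->
  on_rect (fun w => cabs (G w - (c + d * (w - w0))) <= eta) x1 x2 y1 y2 ->
  cabs (crect G x1 x2 y1 y2) <= 4 * eta * ((x2 - x1) + (y2 - y1)).
Proof.
move=> lx ly Hc He.
have H1 : cabs (citv x1 x2 (fun s => G (s +i* y1) - G (s +i* y2))
   - (d * (0 +i* (y1 - y2))) * (x2 - x1)%:C) <= 2 * (2 * eta) * (x2 - x1).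
  apply: citv_near_cst => // s sb.
    by apply: rccontB; apply: (rect_contH lx ly Hc) => //; rewrite lexx ly.
  have -> : G (s +i* y1) - G (s +i* y2) - d * (0 +i* (y1 - y2)) =
    (G (s +i* y1) - (c + d * ((s +i* y1) - w0))) -
    (G (s +i* y2) - (c + d * ((s +i* y2) - w0))).
    have -> : (0 +i* (y1 - y2)) = (s +i* y1) - (s +i* y2).
      by apply: complex_ext => /=; rewrite ?subrr.
    by ring.
  apply: le_trans (cabsB _ _) _; rewrite mulrDl !mul1r.
  by apply: lerD; apply: He => //=; rewrite lexx ly.
have H2 : cabs (citv y1 y2 (fun t => G (x2 +i* t) - G (x1 +i* t))
   - (d * (x2 - x1)%:C) * (y2 - y1)%:C) <= 2 * (2 * eta) * (y2 - y1).
  apply: citv_near_cst => // s sb.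
    by apply: rccontB; apply: (rect_contV lx ly Hc) => //; rewrite lexx lx.
  have -> : G (x2 +i* s) - G (x1 +i* s) - d * (x2 - x1)%:C =
    (G (x2 +i* s) - (c + d * ((x2 +i* s) - w0))) -
    (G (x1 +i* s) - (c + d * ((x1 +i* s) - w0))).
    have -> : (x2 - x1)%:C = (x2 +i* s) - (x1 +i* s).
      by apply: complex_ext => /=; rewrite ?subrr.
    by ring.
  apply: le_trans (cabsB _ _) _; rewrite mulrDl !mul1r.
  by apply: lerD; apply: He => //=; rewrite lexx lx.
rewrite /crect.
set A := citv _ _ _ in H1 *; set B := citv _ _ _ in H2 *.
(* The constants compared with [A] and with ['i * B] are opposite to each other: this is Cauchy's
   theorem for an affine function. *)
have -> : A + 'i * B = (A - (d * (0 +i* (y1 - y2))) * (x2 - x1)%:C) +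
   'i * (B - (d * (x2 - x1)%:C) * (y2 - y1)%:C).
  have -> : (0 +i* (y1 - y2)) = - 'i * (y2 - y1)%:C.
    by apply: complex_ext; rewrite ?ReM ?ImM ?ReN ?ImN /=; ring.
  by ring.
apply: le_trans (cabsD _ _) _; rewrite cabsM cabsi mul1r.
apply: le_trans (lerD H1 H2) _; rewrite mulrDr; lra.
Qed.

Lemma quarter (a b c d z : C) : z = a + b + (c + d) ->
  [\/ cabs z <= 4 * cabs a, cabs z <= 4 * cabs b,
      cabs z <= 4 * cabs c | cabs z <= 4 * cabs d].
Proof.
move=> ->.
have H : cabs (a + b + (c + d)) <= cabs a + cabs b + (cabs c + cabs d).
  by apply: le_trans (cabsD _ _) _; apply: lerD; exact: cabsD.
have [?|h1] := leP (cabs (a + b + (c + d))) (4 * cabs a); first exact: Or41.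
have [?|h2] := leP (cabs (a + b + (c + d))) (4 * cabs b); first exact: Or42.
have [?|h3] := leP (cabs (a + b + (c + d))) (4 * cabs c); first exact: Or43.
have [?|h4] := leP (cabs (a + b + (c + d))) (4 * cabs d); first exact: Or44.
exfalso; lra.
Qed.

Variables (x1 x2 y1 y2 : R).
Hypotheses (lx : x1 <= x2) (ly : y1 <= y2).
Hypothesis dG : on_rect (cdiff G) x1 x2 y1 y2.

Let a k : R := (x2 - x1) * 2^-1 ^+ k.
Let b k : R := (y2 - y1) * 2^-1 ^+ k.

Let a_ge0 k : 0 <= a k. Proof. by rewrite mulr_ge0 ?subr_ge0 // exprn_ge0. Qed.
Let b_ge0 k : 0 <= b k. Proof. by rewrite mulr_ge0 ?subr_ge0 // exprn_ge0. Qed.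
Let aS k : a k = a k.+1 + a k.+1. Proof. by rewrite /a exprS; field. Qed.
Let bS k : b k = b k.+1 + b k.+1. Proof. by rewrite /b exprS; field. Qed.

(** A rectangle of the k-th subdivision is coded by its lower left corner [p], its sides being [a k]
    and [b k]. *)
Let inside k (p : R * R) := [&& x1 <= p.1, p.1 + a k <= x2, y1 <= p.2 & p.2 + b k <= y2].
Let J k (p : R * R) := crect G p.1 (p.1 + a k) p.2 (p.2 + b k).

Let step k p : inside k p -> exists q,
  [/\ inside k.+1 q, cabs (J k p) <= 4 * cabs (J k.+1 q),
      p.1 <= q.1 /\ q.1 + a k.+1 <= p.1 + a k &
      p.2 <= q.2 /\ q.2 + b k.+1 <= p.2 + b k].
Proof.
move=> /and4P[h1 h2 h3 h4]; have := a_ge0 k.+1; have := b_ge0 k.+1 => b0 a0.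
have Ea := aS k; have Eb := bS k.
have cG : on_rect (ccont G) p.1 (p.1 + a k) p.2 (p.2 + b k).
  by move=> w w1 w2; apply/cdiff_ccont/dG; lra.
have E : J k p = J k.+1 p + J k.+1 (p.1, p.2 + b k.+1) +
   (J k.+1 (p.1 + a k.+1, p.2) + J k.+1 (p.1 + a k.+1, p.2 + b k.+1)).
  have sub u1 u2 : p.1 <= u1 -> u2 <= p.1 + a k ->
      on_rect (ccont G) u1 u2 p.2 (p.2 + b k).
    by move=> l1 l2 w w1 w2; apply: cG => //; lra.
  rewrite /J (@crect_splitx p.1 (p.1 + a k.+1) (p.1 + a k) p.2 (p.2 + b k)) ?cG //; [|lra|lra|lra].
  have -> : crect G p.1 (p.1 + a k.+1) p.2 (p.2 + b k) =
      crect G p.1 (p.1 + a k.+1) p.2 (p.2 + b k.+1) +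
      crect G p.1 (p.1 + a k.+1) (p.2 + b k.+1) (p.2 + b k).
    by apply: crect_splity; [lra|lra|lra|apply: sub; lra].
  have -> : crect G (p.1 + a k.+1) (p.1 + a k) p.2 (p.2 + b k) =
      crect G (p.1 + a k.+1) (p.1 + a k) p.2 (p.2 + b k.+1) +
      crect G (p.1 + a k.+1) (p.1 + a k) (p.2 + b k.+1) (p.2 + b k).
    by apply: crect_splity; [lra|lra|lra|apply: sub; lra].
  by rewrite /= -!(addrA _ (a k.+1)) -!(addrA _ (b k.+1)) -aS -bS.
case: (quarter E) => H.
- by exists p; split => //; [apply/and4P; split; lra|split; lra|split; lra].
- by exists (p.1, p.2 + b k.+1); split => //=; [apply/and4P; split => /=; lra|split; lra|split; lra].
- by exists (p.1 + a k.+1, p.2); split => //=; [apply/and4P; split => /=; lra|split; lra|split; lra].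
- by exists (p.1 + a k.+1, p.2 + b k.+1); split => //=; [apply/and4P; split => /=; lra|split; lra|split; lra].
Qed.

Lemma nested_limit (u : nat -> R) (l : nat -> R) :
  (forall k, u k <= u k.+1 /\ u k.+1 + l k.+1 <= u k + l k) ->
  (forall k, 0 <= l k) -> exists x, forall k, u k <= x <= u k + l k.
Proof.
move=> H l0.
have nd : nondecreasing_seq u.
  by apply/nondecreasing_seqP => k; have [] := H k.
have ub k m : (k <= m)%N -> u m + l m <= u k + l k.
  elim: m => [|m IH]; first by rewrite leqn0 => /eqP->.
  rewrite leq_eqVlt => /predU1P[->//|]; rewrite ltnS => /IH; apply: le_trans.
  by have [] := H m.
have ub' k m : u m <= u k + l k.
  have [km|mk] := leqP k m.
    by apply: le_trans (ub _ _ km); rewrite lerDl.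
  by apply: le_trans (nd _ _ (ltnW mk)) _; rewrite lerDl.
have cu : cvgn u.
  apply: nondecreasing_is_cvgn => //; exists (u 0 + l 0) => _ [m _ <-]; exact: ub'.
exists (limn u) => k; apply/andP; split.
  exact: nondecreasing_cvgn_le.
by apply: limr_le => //; apply: nearW => m; exact: ub'.
Qed.

Lemma goursat : crect G x1 x2 y1 y2 = 0.
Proof.
pose T k := {p : R * R | inside k p}.
have [f Hf] : {f : nat -> R * R | f 0 = (x1, y1) /\ forall k, inside k (f k) /\
  [/\ cabs (J k (f k)) <= 4 * cabs (J k.+1 (f k.+1)),
      (f k).1 <= (f k.+1).1 /\ (f k.+1).1 + a k.+1 <= (f k).1 + a k &
      (f k).2 <= (f k.+1).2 /\ (f k.+1).2 + b k.+1 <= (f k).2 + b k]}.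
  (* A successor is chosen for every level and corner, an arbitrary one when the corner is not
     [inside], so that [f] is a plain recursion. *)
  have /choice [g Hg] : forall kp : nat * (R * R), exists q, inside kp.1 kp.2 ->
   [/\ inside kp.1.+1 q, cabs (J kp.1 kp.2) <= 4 * cabs (J kp.1.+1 q),
      kp.2.1 <= q.1 /\ q.1 + a kp.1.+1 <= kp.2.1 + a kp.1 &
      kp.2.2 <= q.2 /\ q.2 + b kp.1.+1 <= kp.2.2 + b kp.1].
    move=> [k p] /=; have [ip|nip] := pselect (inside k p); last by exists p => /nip.
    by have [q Hq] := step ip; exists q.
  pose f := fix f k := if k is k'.+1 then g (k', f k') else (x1, y1).
  exists f; split => // k.
  have ik : inside k (f k).
    elim: k => [|k IH]; last by have /= [] := Hg (k, f k) IH.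
    by rewrite /inside /= /a /b expr0 !mulr1; apply/and4P; split; lra.
  by split=> //; have /= [] := Hg (k, f k) ik.
have [f0 Hf1] := Hf.
have [x Hx] : exists x, forall k, (f k).1 <= x <= (f k).1 + a k.
  by apply: nested_limit => [k|]; [have [_ [_ ? _]] := Hf1 k|].
have [y Hy] : exists y, forall k, (f k).2 <= y <= (f k).2 + b k.
  by apply: nested_limit => [k|]; [have [_ [_ _ ?]] := Hf1 k|].
have JE : crect G x1 x2 y1 y2 = J 0 (f 0).
  by rewrite f0 /J /a /b /= expr0 !mulr1 ![_ + (_ - _)]addrC !subrK.
have Jk k : cabs (J 0 (f 0)) <= 4 ^+ k * cabs (J k (f k)).
  elim: k => [|k IH]; first by rewrite expr0 mul1r.
  apply: (le_trans IH); rewrite exprSr -mulrA ler_wpM2l ?exprn_ge0 //.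
  by have [_ []] := Hf1 k.
have dxy : cdiff G (x +i* y).
  have /and4P[] := (Hf1 0).1 => i1 i2 i3 i4; have := Hx 0; have := Hy 0.
  by move=> ? ?; apply: dG => /=; lra.
have [d Hd] := dxy.
pose D := (x2 - x1) + (y2 - y1); have D0 : 0 <= D by rewrite addr_ge0 ?subr_ge0.
rewrite JE; apply: cabs_eps_eq => e e0; rewrite subr0.
(* At level k the half-perimeter is [D * 2^-1 ^+ k], and the affine error is that times the slope of
   the error. The factor [4 ^+ k] of the subdivision cancels the two powers of 1/2, leaving 4 D^2
   times this constant; [D + 1] replaces [D] because the rectangle may be degenerate. *)
have e1 : 0 < e / (4 * (D + 1) * (D + 1)) by rewrite divr_gt0 // !mulr_gt0 // ltr_pwDr.
have [dl dl0 Hdl] := Hd _ e1.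
have [k kP] : exists k, D * 2^-1 ^+ k < dl.
  have [//||k kP] := @geo_small R 2^-1 D _ _ dl dl0; first by rewrite invf_lt1 // ltr1n.
  by exists k; exact: kP.
apply: (le_trans (Jk k)).
set eta := e / (4 * (D + 1) * (D + 1)) * (D * 2^-1 ^+ k).
have /and4P[i1 i2 i3 i4] := (Hf1 k).1.
have := Hx k; have := Hy k; have := a_ge0 k; have := b_ge0 k => b0 a0 ybd xbd.
have Dk : D * 2^-1 ^+ k = a k + b k by rewrite /D mulrDl.
have : cabs (J k (f k)) <= 4 * eta * (((f k).1 + a k - (f k).1) + ((f k).2 + b k - (f k).2)).
  apply: (@crect_affine _ _ _ _ (G (x +i* y)) d (x +i* y) eta); [lra|lra| |].
    by move=> w w1 w2; apply/cdiff_ccont/dG; lra.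
  move=> w w1 w2.
  have cw : cabs (w - (x +i* y)) <= a k + b k.
    apply: le_trans (cabs_le_ReIm _) _; rewrite ReB ImB /=.
    by apply: lerD; rewrite ler_norml; lra.
  have := Hdl (w - (x +i* y)); rewrite [_ + (w - _)]addrC subrK opprD addrA.
  move=> /(_ _)/le_trans -> //; first by apply: le_lt_trans cw _; rewrite -Dk.
  by rewrite /eta Dk ler_wpM2l // ltW.
have -> : ((f k).1 + a k - (f k).1) + ((f k).2 + b k - (f k).2) = D * 2^-1 ^+ k.
  by rewrite Dk; ring.
move=> HJ; apply: (@le_trans _ _ (4 ^+ k * (4 * eta * (D * 2^-1 ^+ k)))).
  by rewrite ler_wpM2l // exprn_ge0.
have -> : 4 ^+ k * (4 * eta * (D * 2^-1 ^+ k)) = e * (D / (D + 1)) ^+ 2.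
  have E4 : (4 : R) ^+ k * (2^-1 ^+ k * 2^-1 ^+ k) = 1.
    by rewrite -!exprMn (_ : 4 * _ = 1) ?expr1n //; field.
  transitivity (4 ^+ k * (2^-1 ^+ k * 2^-1 ^+ k) * (e * (D / (D + 1)) ^+ 2)); last first.
    by rewrite E4 mul1r.
  rewrite /eta; move: (4 ^+ k) (2^-1 ^+ k) => P Q.
  by field; rewrite gt_eqF // ltr_pwDr.
have D1 : 0 < D + 1 by rewrite ltr_pwDr.
have q0 : 0 <= D / (D + 1) by rewrite divr_ge0 // ltW.
have q1 : D / (D + 1) <= 1 by rewrite ler_pdivrMr // mul1r lerDl.
by rewrite ler_piMr ?(ltW e0) // exprn_ile1.
Qed.

End Fixed.
End Goursat.

(** * Complex differentiability and the exponential *)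

Section CDiff.
Variable R : realType.
Local Notation C := R[i].
Local Notation Re := complex.Re.
Local Notation Im := complex.Im.
Implicit Types (f g h : C -> C) (w z : C).

Lemma ccont_bound f z : ccont f z ->
  exists2 dl : R, 0 < dl & forall w, cabs (w - z) < dl -> cabs (f w) <= cabs (f z) + 1.
Proof.
move=> /(_ 1 ltr01) [dl dl0 H]; exists dl => // w /H Hw.
apply: le_trans (cabs_le_dist (f w) (f z)) _; rewrite lerD2l; exact: ltW.
Qed.

Lemma cdiff_local f g z (dl : R) : 0 < dl ->
  (forall w, cabs (w - z) < dl -> f w = g w) -> cdiff f z -> cdiff g z.
Proof.
move=> dl0 E [d Hd]; exists d => e /Hd [dl' dl'0 H].
exists (Num.min dl dl'); first by rewrite lt_min dl0.
move=> h; rewrite lt_min => /andP[h1 h2].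
rewrite -!E ?subrr ?cabs0 //; first exact: H.
by rewrite addrAC subrr add0r.
Qed.

Lemma is_cdiff_cst c z : is_cdiff (fun=> c) z 0.
Proof.
move=> e e0; exists 1 => // h _.
by rewrite mul0r subr0 subrr cabs0 mulr_ge0 ?cabs_ge0 // ltW.
Qed.

Lemma cdiff_cst c z : cdiff (fun=> c) z.
Proof. by exists 0; exact: is_cdiff_cst. Qed.

Lemma is_cdiff_id z : is_cdiff id z 1.
Proof.
move=> e e0; exists 1 => // h _.
have -> : id (z + h) - id z - 1 * h = 0 by rewrite /=; ring.
by rewrite cabs0 mulr_ge0 ?cabs_ge0 // ltW.
Qed.

Lemma cdiff_id z : cdiff id z.
Proof. by exists 1; exact: is_cdiff_id. Qed.

Lemma cdiffD f g z : cdiff f z -> cdiff g z -> cdiff (fun w => f w + g w) z.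
Proof.
move=> [d1 H1] [d2 H2]; exists (d1 + d2) => e e0.
have e2 : 0 < e / 2 by rewrite divr_gt0.
have [a a0 Ha] := H1 _ e2; have [b b0 Hb] := H2 _ e2.
exists (Num.min a b); first by rewrite lt_min a0.
move=> h; rewrite lt_min => /andP[/Ha h1 /Hb h2].
have -> : f (z + h) + g (z + h) - (f z + g z) - (d1 + d2) * h =
  (f (z + h) - f z - d1 * h) + (g (z + h) - g z - d2 * h) by ring.
apply: le_trans (cabsD _ _) _; apply: le_trans (lerD h1 h2) _.
by rewrite -mulrDl -splitr.
Qed.

Lemma is_cdiffM f g z d1 d2 : is_cdiff f z d1 -> is_cdiff g z d2 ->
  is_cdiff (fun w => f w * g w) z (d1 * g z + f z * d2).
Proof.
move=> H1 H2; have cg : cdiff g z by exists d2.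
have [dg dg0 Hg0] := ccont_bound (cdiff_ccont cg).
have Hcg := cdiff_ccont cg; move=> e e0.
pose K := cabs (g z) + 1 + cabs (f z) + cabs d1.
have K0 : 0 < K by rewrite /K -addrA -addrA ltr_wpDl ?cabs_ge0 // addrA -addrA ltr_pwDl // addr_ge0 ?cabs_ge0.
have e2 : 0 < e / K by rewrite divr_gt0.
have [a a0 Ha] := H1 _ e2; have [b b0 Hb] := H2 _ e2; have [c c0 Hc] := Hcg _ e2.
exists (Num.min (Num.min a b) (Num.min c dg)); first by rewrite !lt_min a0 b0 c0.
move=> h; rewrite !lt_min => /andP[/andP[/Ha h1 /Hb h2] /andP[hc hd]].
have -> : f (z + h) * g (z + h) - f z * g z - (d1 * g z + f z * d2) * h =
  (f (z + h) - f z - d1 * h) * g (z + h) + f z * (g (z + h) - g z - d2 * h)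
  + d1 * h * (g (z + h) - g z) by ring.
have zh : z + h - z = h by rewrite addrAC subrr add0r.
have g1 : cabs (g (z + h)) <= cabs (g z) + 1 by apply: Hg0; rewrite zh.
have g2 : cabs (g (z + h) - g z) <= e / K by apply/ltW/Hc; rewrite zh.
have eh : 0 <= e / K * cabs h by rewrite mulr_ge0 ?cabs_ge0 // ltW.
apply: le_trans (cabsD _ _) _; apply: (@le_trans _ _
  (e / K * cabs h * (cabs (g z) + 1) + cabs (f z) * (e / K * cabs h) + cabs d1 * cabs h * (e / K))).
  apply: lerD; last by rewrite !cabsM ler_wpM2l // mulr_ge0 ?cabs_ge0.
  apply: le_trans (cabsD _ _) _; rewrite !cabsM; apply: lerD.
    by apply: ler_pM; rewrite ?cabs_ge0.
  by rewrite ler_wpM2l ?cabs_ge0.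
have -> : e / K * cabs h * (cabs (g z) + 1) + cabs (f z) * (e / K * cabs h) +
   cabs d1 * cabs h * (e / K) = e * cabs h * (K / K) by rewrite /K; ring.
by rewrite divff ?mulr1 // gt_eqF.
Qed.

Lemma cdiffM f g z : cdiff f z -> cdiff g z -> cdiff (fun w => f w * g w) z.
Proof. by move=> [d1 H1] [d2 H2]; exists (d1 * g z + f z * d2); exact: is_cdiffM. Qed.

Lemma is_cdiffV z : z != 0 -> is_cdiff (fun w => w^-1) z (- z ^- 2).
Proof.
move=> z0 e e0.
have nz0 : 0 < cabs z by rewrite cabs_gt0.
exists (Num.min (cabs z / 2) (e * cabs z ^+ 3 / 2)).
  by rewrite lt_min !divr_gt0 // mulr_gt0 // exprn_gt0.
move=> h; rewrite lt_min => /andP[h1 h2].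
have zh : cabs z / 2 <= cabs (z + h).
  have := cabs_le_dist z (z + h); rewrite opprD addrA subrr add0r cabsN; lra.
have zh0 : 0 < cabs (z + h) by apply: lt_le_trans zh; rewrite divr_gt0.
have zhn : z + h != 0 by rewrite -cabs_gt0.
have -> : (z + h)^-1 - z^-1 - - z ^- 2 * h = h ^+ 2 / (z ^+ 2 * (z + h)).
  by field; rewrite z0 zhn.
rewrite (_ : cabs _ = cabs h ^+ 2 / (cabs z ^+ 2 * cabs (z + h))); last first.
  by rewrite -!cabsX -cabsM -cabsV -cabsM.
rewrite ler_pdivrMr; last by rewrite mulr_gt0 // exprn_gt0.
rewrite expr2 [leRHS]mulrAC ler_wpM2r ?cabs_ge0 //.
apply: ltW (lt_le_trans h2 _).
apply: (@le_trans _ _ (e * (cabs z ^+ 2 * (cabs z / 2)))); first by rewrite !exprS !expr0; lra.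
by rewrite ler_wpM2l ?(ltW e0) // ler_wpM2l // exprn_ge0 // ltW.
Qed.

Lemma cdiffV z : z != 0 -> cdiff (fun w => w^-1) z.
Proof. by move=> z0; exists (- z ^- 2); exact: is_cdiffV. Qed.

Lemma cdiff_comp f g z : cdiff g z -> cdiff f (g z) -> cdiff (fun w => f (g w)) z.
Proof.
move=> cg [d1 H1]; have Hcg := cdiff_ccont cg; case: cg => [d2 H2].
exists (d1 * d2) => e e0.
pose K := cabs d1 + cabs d2 + 1.
have K0 : 0 < K by rewrite ltr_wpDl // addr_ge0 ?cabs_ge0.
pose e1 := Num.min 1 (e / K); have e10 : 0 < e1 by rewrite lt_min ltr01 divr_gt0.
have [a a0 Ha] := H1 _ e10; have [b b0 Hb] := H2 _ e10; have [c c0 Hc] := Hcg _ a0.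
exists (Num.min b c); first by rewrite lt_min b0.
move=> h; rewrite lt_min => /andP[/Hb h1 h2].
have zh : z + h - z = h by rewrite addrAC subrr add0r.
have := Hc (z + h); rewrite zh => /(_ h2) /Ha; rewrite [g z + _]addrC subrK => h3.
have -> : f (g (z + h)) - f (g z) - d1 * d2 * h =
  (f (g (z + h)) - f (g z) - d1 * (g (z + h) - g z)) + d1 * (g (z + h) - g z - d2 * h) by ring.
have h4 : cabs (g (z + h) - g z) <= (cabs d2 + 1) * cabs h.
  have := cabs_le_dist (g (z + h) - g z) (d2 * h); rewrite cabsM => /le_trans; apply.
  rewrite mulrDl mul1r lerD2l; apply: (le_trans h1).
  by rewrite ler_piMl ?cabs_ge0 // ge_min lexx.
have e1K : e1 * K <= e by rewrite -ler_pdivlMr // ge_min lexx orbT.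
apply: le_trans (cabsD _ _) _; rewrite [cabs (d1 * _)]cabsM.
apply: (@le_trans _ _ (e1 * ((cabs d2 + 1) * cabs h) + cabs d1 * (e1 * cabs h))).
  apply: lerD; last by rewrite ler_wpM2l ?cabs_ge0.
  by apply: le_trans h3 _; rewrite ler_wpM2l // ltW.
have -> : e1 * ((cabs d2 + 1) * cabs h) + cabs d1 * (e1 * cabs h) = e1 * K * cabs h.
  by rewrite /K; ring.
by rewrite ler_wpM2r ?cabs_ge0.
Qed.

Lemma cdiffB f g z : cdiff f z -> cdiff g z -> cdiff (fun w => f w - g w) z.
Proof.
move=> cf cg; apply: (@cdiff_local (fun w => f w + (-1) * g w) _ _ 1) => //.
  by move=> w _; ring.
by apply: cdiffD => //; apply: cdiffM => //; exact: cdiff_cst.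
Qed.

Lemma cdiff_div f g z : g z != 0 -> cdiff f z -> cdiff g z ->
  cdiff (fun w => f w / g w) z.
Proof.
move=> g0 cf cg; apply: cdiffM => //.
by apply: (@cdiff_comp (fun w => w^-1)) => //; exact: cdiffV.
Qed.

Lemma is_derive_eps (f : R -> R) (x d : R) : is_derive x 1 f d ->
  forall e : R, 0 < e -> exists2 dl : R, 0 < dl & forall h : R, `|h| < dl ->
    `|f (x + h) - f x - d * h| <= e * `|h|.
Proof.
move=> [df Ed] e e0; have /cvg_ex [l Hl] := df.
have El : l = d by rewrite -Ed; apply/esym/cvg_lim.
move: Hl; rewrite El => /cvgrPdist_le /(_ e e0) [dl dl0 H]; exists dl => // h hdl.
have [->|h0] := eqVneq h 0; first by rewrite addr0 mulr0 !subrr normr0 mulr0.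
have /= := H h; rewrite sub0r normrN => /(_ hdl h0).
rewrite -(@ler_pM2r _ `|h|) ?normr_gt0 // => /(le_trans _); apply.
rewrite -normrM distrC mulrBl /GRing.scale /= mulr1 [h + x]addrC.
by rewrite [h^-1 * _ * _]mulrC mulVKf.
Qed.

Definition cis (t : R) : C := cos t +i* sin t.
Definition cexp w : C := (expR (Re w))%:C * cis (Im w).

Lemma cisD s t : cis (s + t) = cis s * cis t.
Proof.
by apply: complex_ext; rewrite ?ReM ?ImM /= ?cosD ?sinD // [cos s * _ + _]addrC.
Qed.

Lemma cabs_cis t : cabs (cis t) = 1.
Proof. by rewrite cabsE /= cos2Dsin2 sqrtr1. Qed.

Lemma cexpD w z : cexp (w + z) = cexp w * cexp z.
Proof. by rewrite /cexp ReD ImD expRD cisD rmorphM /=; ring. Qed.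

Lemma cabs_cexp w : cabs (cexp w) = expR (Re w).
Proof. by rewrite cabsM cabs_cis mulr1 cabs_ge0R // expR_ge0. Qed.

(** Differentiability at 0 is enough, since the addition law carries it to every point. It is read
    off from the derivatives at 0 of the real functions [expR], [cos] and [sin]. *)
Lemma cexp0_diff (e : R) : 0 < e -> exists2 dl : R, 0 < dl & forall h : C, cabs h < dl ->
  cabs (cexp h - 1 - h) <= e * cabs h.
Proof.
(* The real and the imaginary part of the error are each at most [3 * (e1 * m)], and 6 <= 8. The
   bound by 1 keeps [expR x] below 2. *)
move=> e0; pose e1 := Num.min 1 (e / 8).
have e10 : 0 < e1 by rewrite lt_min ltr01 divr_gt0.
have [d1 d10 H1] := is_derive_eps (is_derive_expR 0) e10.
have [d2 d20 H2] := is_derive_eps (is_derive_cos 0) e10.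
have [d3 d30 H3] := is_derive_eps (is_derive_sin 0) e10.
exists (Num.min (Num.min d1 d2) (Num.min d3 (e1 / 2))).
  by rewrite !lt_min d10 d20 d30 divr_gt0.
move=> h; rewrite !lt_min => /andP[/andP[l1 l2] /andP[l3 l4]].
have rh := Re_le_cabs h; have ih := Im_le_cabs h; have hp := cabs_ge0 h.
have := H1 (Re h) (le_lt_trans rh l1); have := H2 (Im h) (le_lt_trans ih l2).
have := H3 (Im h) (le_lt_trans ih l3).
rewrite !add0r expR0 cos0 sin0 oppr0 mul0r !subr0 ?addr0 !mul1r.
set x := Re h in rh *; set y := Im h in ih *; set m := cabs h in rh ih hp l4 *.
set E := expR x; set S := sin y; set K := cos y => h3 h2 h1.
have e1e : 8 * e1 <= e by rewrite mulrC -ler_pdivlMr // ge_min lexx orbT.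
have e11 : e1 <= 1 by rewrite ge_min lexx.
have h1' : `|E - 1 - x| <= e1 * m by apply: le_trans h1 _; rewrite ler_wpM2l // ltW.
have h2' : `|K - 1| <= e1 * m by apply: le_trans h2 _; rewrite ler_wpM2l // ltW.
have h3' : `|S - y| <= e1 * m by apply: le_trans h3 _; rewrite ler_wpM2l // ltW.
have e1m : e1 * m <= m by rewrite ler_piMl.
have E1 : `|E - 1| <= e1.
  have -> : E - 1 = (E - 1 - x) + x by ring.
  apply: le_trans (ler_normD _ _) _; apply: le_trans (lerD h1' rh) _; lra.
have E2 : `|E| <= 2.
  have -> : E = (E - 1) + 1 by ring.
  apply: le_trans (ler_normD _ _) _; rewrite normr1; lra.
have K1 : `|E * K - 1 - x| <= 3 * (e1 * m).
  have -> : E * K - 1 - x = (E - 1 - x) + E * (K - 1) by ring.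
  apply: le_trans (ler_normD _ _) _; rewrite normrM.
  have : `|E| * `|K - 1| <= 2 * (e1 * m) by apply: ler_pM.
  lra.
have K2 : `|E * S - y| <= 3 * (e1 * m).
  have -> : E * S - y = (E - 1) * y + E * (S - y) by ring.
  apply: le_trans (ler_normD _ _) _; rewrite !normrM.
  have : `|E| * `|S - y| <= 2 * (e1 * m) by apply: ler_pM.
  have : `|E - 1| * `|y| <= e1 * m by apply: ler_pM.
  lra.
apply: le_trans (cabs_le_ReIm _) _; rewrite !ReB !ImB /cexp /cis !ReMr !ImMr /=.
rewrite subr0 -/x -/y -/E -/K -/S.
apply: le_trans (lerD K1 K2) _.
have : 8 * e1 * m <= e * m by rewrite ler_wpM2r.
have : 0 <= e1 * m by rewrite mulr_ge0 // ltW.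
lra.
Qed.

Lemma cdiff_cexp z : cdiff cexp z.
Proof.
exists (cexp z) => e e0.
have K0 : 0 < cabs (cexp z) by rewrite cabs_cexp expR_gt0.
have [dl dl0 H] := cexp0_diff (divr_gt0 e0 K0); exists dl => // h /H Hh.
have -> : cexp (z + h) - cexp z - cexp z * h = cexp z * (cexp h - 1 - h).
  by rewrite cexpD; ring.
rewrite cabsM -ler_pdivlMl // ; apply: le_trans Hh _.
by rewrite mulrA [e / _]mulrC.
Qed.

Lemma cis_cont t (e : R) : 0 < e ->
  exists2 dl : R, 0 < dl & forall s, `|s - t| < dl -> cabs (cis s - cis t) < e.
Proof.
move=> e0; have [dl dl0 H] := cdiff_ccont (cdiff_cexp (0 +i* t)) e0.
exists dl => // s st; have := H (0 +i* s); rewrite cabs_vert /cexp /= expR0.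
by rewrite !mul1r; exact.
Qed.
End CDiff.

(** * Circle means, Cauchy's formula and Cauchy's estimates *)

Section CircleMean.
Variable R : realType.
Local Notation C := R[i].
Local Notation Re := complex.Re.
Local Notation Im := complex.Im.
Implicit Types (f g h : C -> C) (w z : C) (r t : R).

Definition circ r t : C := r%:C * cis t.
(** Up to the factor ['i] this is the contour integral of h(w)/w. It is not divided by the length of
    the interval, which explains the factors [pi *+ 2] below. *)
Definition cmean h r : C := citv 0 (pi *+ 2) (fun t => h (circ r t)).

Let pi2_ge0 : 0 <= (pi *+ 2 : R). Proof. by rewrite mulrn_wge0 // pi_ge0. Qed.

Lemma cabs_circ r t : 0 <= r -> cabs (circ r t) = r.
Proof. by move=> r0; rewrite cabsM cabs_cis mulr1 cabs_ge0R. Qed.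

Lemma circ_cont r t (e : R) : 0 < e -> exists2 dl : R, 0 < dl &
  forall r' s, `|r' - r| < dl -> `|s - t| < dl -> cabs (circ r' s - circ r t) < e.
Proof.
move=> e0; have K0 : 0 < `|r| + 1 by rewrite ltr_wpDl.
have e1 : 0 < e / 2 / (`|r| + 1) by rewrite !divr_gt0.
have [dl dl0 H] := cis_cont t e1.
exists (Num.min dl (e / 2)); first by rewrite lt_min dl0 divr_gt0.
move=> r' s; rewrite !lt_min => /andP[_ h1] /andP[/H h2 _].
have -> : circ r' s - circ r t = (r' - r)%:C * cis s + r%:C * (cis s - cis t).
  by rewrite /circ rmorphB /=; ring.
apply: le_lt_trans (cabsD _ _) _; rewrite !cabsM cabs_cis mulr1 !cabsR (splitr e).
apply: ltr_leD => //; apply: (@le_trans _ _ ((`|r| + 1) * cabs (cis s - cis t))).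
  by rewrite ler_wpM2r ?cabs_ge0 // lerDl.
by rewrite mulrC -ler_pdivlMr // ltW.
Qed.

Lemma rccont_circ h r t : ccont h (circ r t) -> rccont (fun s => h (circ r s)) t.
Proof.
move=> H e /H [d d0 Hd]; have [dl dl0 Hdl] := circ_cont r t d0.
by exists dl => // s st; apply/Hd/Hdl => //; rewrite subrr normr0.
Qed.

Lemma circ_cexp s t : cexp (s +i* t) = circ (expR s) t.
Proof. by []. Qed.

Lemma circ_2pi r : circ r (pi *+ 2) = circ r 0.
Proof. by rewrite /circ /cis cos2pi sin2pi cos0 sin0. Qed.

(** The exponential maps the rectangle with sides [ln r1, ln r2] and [0, 2 pi] onto the annulus. The
    two horizontal sides have the same image and cancel, so Goursat's theorem equates the vertical
    sides, which are the two means. *)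
Lemma cmean_const h r1 r2 : 0 < r1 -> r1 <= r2 ->
  (forall z, r1 <= cabs z <= r2 -> cdiff h z) -> cmean h r1 = cmean h r2.
Proof.
move=> r10 r12 H; have r20 := lt_le_trans r10 r12.
pose G w := h (cexp w).
have l12 : ln r1 <= ln r2 by rewrite ler_ln ?posrE.
have cG : on_rect (cdiff G) (ln r1) (ln r2) 0 (pi *+ 2).
  move=> w /andP[w1 w2] _; apply: cdiff_comp; first exact: cdiff_cexp.
  apply: H; rewrite cabs_cexp -{1}(lnK (r10 : r1 \in Num.pos)) ler_expR w1.
  by rewrite -{1}(lnK (r20 : r2 \in Num.pos)) ler_expR w2.
have cG' : on_rect (ccont G) (ln r1) (ln r2) 0 (pi *+ 2).
  by move=> w w1 w2; apply/cdiff_ccont/cG.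
have := goursat l12 pi2_ge0 cG; rewrite /crect.
have -> : citv (ln r1) (ln r2) (fun s => G (s +i* 0) - G (s +i* (pi *+ 2))) = 0.
  rewrite -[RHS](@cint0 _ _ _ lebesgue_measure `[ln r1, ln r2]%classic) //.
  congr (cint _ _ _); apply/funext => s.
  by rewrite /G !circ_cexp circ_2pi subrr.
rewrite add0r => /eqP; rewrite mulf_eq0 => /orP[/eqP/(congr1 (@complex.Im R))/= /eqP|/eqP].
  by rewrite oner_eq0.
rewrite /citv cintB //; last 2 first.
- apply: citv_integrable; apply: (rect_contV l12 pi2_ge0 cG').
  by rewrite lexx l12.
- apply: citv_integrable; apply: (rect_contV l12 pi2_ge0 cG').
  by rewrite lexx l12.
move/eqP; rewrite subr_eq0 => /eqP E; rewrite /cmean /citv.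
transitivity (cint lebesgue_measure `[0, pi *+ 2]%classic (fun u => G (ln r1 +i* u))).
  by congr (cint _ _ _); apply/funext => s; rewrite /G circ_cexp lnK.
rewrite -E; congr (cint _ _ _); apply/funext => s; by rewrite /G circ_cexp lnK.
Qed.

(** By compactness of [0, 2 pi], [h (circ r' t)] is close to [h (circ r t)] uniformly in [t] once
    [r'] is close to [r]. *)
Lemma cmean_cont h r : (forall t, ccont h (circ r t)) ->
  forall e : R, 0 < e -> exists2 dl : R, 0 < dl &
    forall r', `|r' - r| < dl -> (forall t, ccont h (circ r' t)) ->
    cabs (cmean h r' - cmean h r) <= e.
Proof.
move=> Hc e e0; have K0 : 0 < 4 * (pi *+ 2 + 1) :> R.
  by rewrite mulr_gt0 // ltr_wpDl.
pose e1 := e / (4 * (pi *+ 2 + 1)); have e10 : 0 < e1 by rewrite divr_gt0.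
have : \forall r' \near nbhs r, `[0, pi *+ 2]%classic `<=`
    (fun t => cabs (h (circ r' t) - h (circ r t)) < e1 + e1).
  have /compact_near_coveringP := @segment_compact R 0 (pi *+ 2).
  move=> /(_ R (nbhs r) (fun r' t => cabs (h (circ r' t) - h (circ r t)) < e1 + e1)).
  apply => // t _.
  have [d d0 Hd] := Hc t _ e10; have [dl dl0 Hdl] := circ_cont r t d0.
  exists (ball t dl, ball r dl); first by split; exact: nbhsx_ballx.
  move=> [s r'] /= [bs br].
  have st : `|s - t| < dl by rewrite distrC.
  have rr : `|r' - r| < dl by rewrite distrC.
  have h1 := Hd _ (Hdl _ _ rr st).
  have h2 : cabs (h (circ r s) - h (circ r t)) < e1.
    by apply/Hd/Hdl => //; rewrite subrr normr0.
  have -> : h (circ r' s) - h (circ r s) =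
    (h (circ r' s) - h (circ r t)) - (h (circ r s) - h (circ r t)) by ring.
  by apply: le_lt_trans (cabsB _ _) _; rewrite ltrD.
move=> [dl /= dl0 H]; exists dl => // r' rr' Hr'.
have {}H t : 0 <= t <= pi *+ 2 -> cabs (h (circ r' t) - h (circ r t)) <= e1 + e1.
  move=> tb; apply: ltW; apply: H; first by rewrite /ball /= distrC.
  by rewrite /= in_itv.
rewrite /cmean /citv -cintB //; last 2 first.
- by apply: citv_integrable => t _; exact: rccont_circ.
- by apply: citv_integrable => t _; exact: rccont_circ.
apply: le_trans (citv_bound pi2_ge0 _ H) _.
  by move=> t _; apply: rccontB; exact: rccont_circ.
have -> : 2 * (e1 + e1) * (pi *+ 2 - 0) = e * ((pi *+ 2) / (pi *+ 2 + 1)).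
  rewrite /e1 subr0; move: (pi *+ 2 : R) pi2_ge0 => p p0.
  by field; rewrite gt_eqF // ltr_wpDl.
rewrite ler_piMr ?(ltW e0) // ler_pdivrMr ?mul1r ?lerDl //.
by rewrite ltr_wpDl.
Qed.

Lemma cmean0 h : cmean h 0 = h 0 * (pi *+ 2)%:C.
Proof.
rewrite /cmean /citv -[pi *+ 2 in RHS]subr0 -itv_measE // -cint_cst ?itv_fin //.
by congr (cint _ _ _); apply/funext => t; rewrite /circ mul0r.
Qed.

(* The means are locally constant off the exceptional radius and continuous
   across it. *)
Lemma mean_value h z rho r : (forall w, cabs w < rho -> ccont h w) ->
  (forall w, cabs w < rho -> w != z -> cdiff h w) -> 0 <= r -> r < rho ->
  cmean h r = h 0 * (pi *+ 2)%:C.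
Proof.
move=> Hc Hd r0 rrho; rewrite -cmean0.
have cc s t : 0 <= s -> s < rho -> ccont h (circ s t).
  by move=> s0 srho; apply: Hc; rewrite cabs_circ.
have small s : 0 <= s -> s < rho -> forall e : R, 0 < e -> exists2 dl, 0 < dl &
    forall r', 0 <= r' -> r' < rho -> `|r' - s| < dl -> cabs (cmean h r' - cmean h s) <= e.
  move=> s0 srho e /(cmean_cont (fun t => cc s t s0 srho)) [dl dl0 H].
  by exists dl => // r' r'0 r'rho /H; apply => t; exact: cc.
(* If [cabs z = 0], the exceptional point is the centre and no circle of positive radius meets it,
   so every [s] is allowed. Otherwise [s] must stay below [cabs z]. In both cases the mean is
   compared with one over a tiny circle. *)
have below s : 0 <= s -> s < rho -> s < cabs z \/ cabs z = 0 -> cmean h s = cmean h 0.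
  move=> s0 srho sz; apply: cabs_eps_eq => e e0.
  have [dl dl0 H] := small 0 (lexx 0) (le_lt_trans s0 srho) _ e0.
  have [->|sn0] := eqVneq s 0; first by rewrite subrr cabs0 ltW.
  have sp : 0 < s by rewrite lt_def sn0.
  pose s' := Num.min s (dl / 2).
  have s'0 : 0 < s' by rewrite lt_min sp divr_gt0.
  have s's : s' <= s by rewrite ge_min lexx.
  rewrite -(@cmean_const h s' s) //.
    apply: H; rewrite ?(ltW s'0) //; first exact: le_lt_trans srho.
    rewrite subr0 gtr0_norm // gt_min; apply/orP; right.
    by rewrite ltr_pdivrMr // mulr_natr mulr2n ltrDl.
  move=> w /andP[w1 w2]; apply: Hd; first exact: le_lt_trans srho.
  apply/eqP => wz; rewrite -wz in sz; case: sz => [|w0]; first by rewrite ltNge w2.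
  by move: w1; rewrite w0 leNgt s'0.
have at_z : cabs z < rho -> cmean h (cabs z) = cmean h 0.
  move=> zrho; have [z0|zn0] := eqVneq (cabs z) 0; first by rewrite z0.
  have zp : 0 < cabs z by rewrite lt_def zn0 cabs_ge0.
  apply: cabs_eps_eq => e e0.
  have [dl dl0 H] := small (cabs z) (cabs_ge0 _) zrho _ e0.
  pose s := Num.max 0 (cabs z - dl / 2).
  have sz : s < cabs z by rewrite gt_max zp ltrBlDr ltrDl divr_gt0.
  have s0 : 0 <= s by rewrite le_max lexx.
  have srho : s < rho by apply: lt_trans zrho.
  rewrite cabsBC -(below s) //; last by left.
  rewrite cabsBC cabsBC; apply: H => //.
  rewrite distrC ger0_norm ?subr_ge0 ?(ltW sz) //.
  have : cabs z - dl / 2 <= s by rewrite le_max lexx orbT.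
  have : dl / 2 < dl by rewrite ltr_pdivrMr // mulr_natr mulr2n ltrDl.
  lra.
have [rz|zr] := ltP r (cabs z); first by apply: below => //; left.
have [zr'|] := ltP (cabs z) r; last first.
  by move=> rz; have <- : cabs z = r; [apply/eqP; rewrite eq_le zr|apply/at_z/(le_lt_trans zr)].
have zrho := lt_trans zr' rrho.
apply: cabs_eps_eq => e e0.
have [dl dl0 H] := small (cabs z) (cabs_ge0 _) zrho _ e0.
pose s := Num.min r (cabs z + dl / 2).
have sz : cabs z < s by rewrite lt_min zr' ltrDl divr_gt0.
have sr : s <= r by rewrite ge_min lexx.
have s0 : 0 < s by apply: le_lt_trans sz; exact: cabs_ge0.
rewrite -at_z // -(@cmean_const h s r) //.
  apply: H; rewrite ?(ltW s0) ?(le_lt_trans sr) // gtr0_norm ?subr_gt0 //.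
  have : s <= cabs z + dl / 2 by rewrite ge_min lexx orbT.
  have : dl / 2 < dl by rewrite ltr_pdivrMr // mulr_natr mulr2n ltrDl.
  lra.
move=> w /andP[w1 w2]; apply: Hd; first exact: le_lt_trans rrho.
by apply: contraTneq w1 => ->; rewrite -ltNge.
Qed.

Lemma circ_neq r t z : cabs z < r -> circ r t - z != 0.
Proof.
move=> zr; rewrite subr_eq0; apply: contraTneq zr => <-.
have [r0|r0] := leP 0 r; first by rewrite cabs_circ // ltxx.
by rewrite -leNgt; apply: le_trans (cabs_ge0 _); exact: ltW.
Qed.

Lemma cmean_bound h r M : (forall t, ccont h (circ r t)) ->
  (forall t, cabs (h (circ r t)) <= M) -> cabs (cmean h r) <= 2 * M * (pi *+ 2).
Proof.
move=> Hc HM; rewrite -[X in _ * X](subr0 (pi *+ 2)); apply: citv_bound => // t _.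
exact: rccont_circ.
Qed.

(** Beyond [cabs z] the mean does not depend on the radius, and it tends to 0 as the radius grows;
    the radius [r'] of the proof makes it smaller than [e]. *)
Lemma cmean_pole z r : cabs z < r -> cmean (fun w => z / (w - z)) r = 0.
Proof.
move=> zr; apply: cabs_eps_eq => e e0; rewrite subr0.
have r0 : 0 < r by apply: le_lt_trans zr; exact: cabs_ge0.
have cd w : cabs z < cabs w -> cdiff (fun w => z / (w - z)) w.
  move=> zw; apply: (@cdiff_div _ (fun=> z) (fun w => w - z)).
  - by rewrite subr_eq0; apply: contraTneq zw => ->; rewrite ltxx.
  - exact: cdiff_cst.
  - apply: (@cdiffB _ id (fun=> z)); [exact: cdiff_id|exact: cdiff_cst].
pose K := 2 * (cabs z + 1) * (pi *+ 2 + 1) : R.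
have K0 : 0 < K by rewrite !mulr_gt0 // ltr_wpDl ?cabs_ge0.
pose r' := r + K / e; have r'r : r <= r' by rewrite lerDl ltW // divr_gt0.
rewrite (@cmean_const _ r r') //; last first.
  by move=> w /andP[rw _]; apply: cd; exact: lt_le_trans rw.
have zr' := lt_le_trans zr r'r; have r'0 := lt_le_trans r0 r'r.
have D0 : 0 < r' - cabs z by rewrite subr_gt0.
apply: (@le_trans _ _ (2 * (cabs z / (r' - cabs z)) * (pi *+ 2))).
  apply: cmean_bound => t; first by apply/cdiff_ccont/cd; rewrite cabs_circ // ltW.
  rewrite cabsM cabsV ler_wpM2l ?cabs_ge0 // lef_pV2 ?posrE //; last first.
    by rewrite cabs_gt0 circ_neq.
  by rewrite lerBlDl -{1}(@cabs_circ r' t) ?(ltW r'0) // cabs_le_dist.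
rewrite mulrAC mulrA ler_pdivrMr //.
apply: (@le_trans _ _ K).
  rewrite /K mulrAC; apply: ler_pM => //; rewrite ?lerDl //.
    by rewrite mulr_ge0 // cabs_ge0.
  by rewrite ler_wpM2l // lerDl.
rewrite -ler_pdivrMl // mulrC /r'; lra.
Qed.

(** The integrand is [h w + f z * (1 + z / (w - z))], where h(w) = (f(w) - f(z)) w / (w - z) is
    extended by f'(z) z at w = z. The extension is continuous and vanishes at 0, so [mean_value]
    gives it mean 0, as [cmean_pole] does for the last term. The factor [w] compensates the division
    by w hidden in [cmean]. *)
Lemma cauchy_formula f rho r z : (forall w, cabs w < rho -> cdiff f w) ->
  cabs z < r -> r < rho ->
  cmean (fun w => f w * w / (w - z)) r = f z * (pi *+ 2)%:C.
Proof.
move=> Hf zr rrho; have zrho := lt_trans zr rrho.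
have r0 : 0 < r by apply: le_lt_trans zr; exact: cabs_ge0.
have [d Hd] := Hf z zrho.
pose h w := if w == z then d * z else (f w - f z) * w / (w - z).
have cidz w : cdiff (fun w => w - z) w.
  by apply: (@cdiffB _ id (fun=> z)); [exact: cdiff_id|exact: cdiff_cst].
have hd w : cabs w < rho -> w != z -> cdiff h w.
  move=> wrho wz; have d0 : 0 < cabs (w - z) by rewrite cabs_gt0 subr_eq0.
  apply: (@cdiff_local _ (fun w => (f w - f z) * w / (w - z)) _ _ _ d0).
    move=> v vw; rewrite /h ifF //; apply: contraTF vw => /eqP ->.
    by rewrite cabsBC ltxx.
  apply: (@cdiff_div _ (fun w => (f w - f z) * w) (fun w => w - z)) => //.
    by rewrite subr_eq0.
  apply: (@cdiffM _ (fun w => f w - f z) id); last exact: cdiff_id.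
  by apply: cdiffB; [exact: Hf|exact: cdiff_cst].
have hc w : cabs w < rho -> ccont h w.
  have [->|wz] := eqVneq w z; last by move=> ?; apply/cdiff_ccont/hd.
  move=> _ e e0; pose K := cabs z + 2 + cabs d.
  have K0 : 0 < K by rewrite ltr_wpDr ?cabs_ge0 // ltr_wpDl ?cabs_ge0.
  pose e1 := Num.min 1 (e / K / 2).
  have e10 : 0 < e1 by rewrite lt_min ltr01 !divr_gt0.
  have [dl dl0 Hdl] := Hd _ e10.
  exists (Num.min dl e1); first by rewrite lt_min dl0.
  move=> v; rewrite lt_min => /andP[v1 v2].
  rewrite {2}/h eqxx /h; case: eqP => [_|/eqP vz]; first by rewrite subrr cabs0.
  have vz0 : v - z != 0 by rewrite subr_eq0.
  have -> : (f v - f z) * v / (v - z) - d * z =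
     (f v - f z - d * (v - z)) / (v - z) * v + d * (v - z) by field.
  have := Hdl _ v1; rewrite [z + _]addrC subrK => H1.
  have H2 : cabs ((f v - f z - d * (v - z)) / (v - z)) <= e1.
    by rewrite cabsM cabsV ler_pdivrMr // cabs_gt0.
  have H3 : cabs v <= cabs z + 1.
    apply: le_trans (cabs_le_dist v z) _; rewrite lerD2l.
    by apply: le_trans (ltW v2) _; rewrite ge_min lexx.
  apply: le_lt_trans (cabsD _ _) _; rewrite [cabs (d * _)]cabsM cabsM.
  apply: (@le_lt_trans _ _ (e1 * (cabs z + 1) + cabs d * e1)).
    apply: lerD; first by apply: ler_pM; rewrite ?cabs_ge0.
    by rewrite ler_wpM2l ?cabs_ge0 // ltW.
  have H4 : e1 * K <= e / 2.
    rewrite -ler_pdivlMr // ge_min; apply/orP; right; by rewrite mulrAC.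
  have : e1 * (cabs z + 1) + cabs d * e1 < e1 * K.
    by rewrite /K [cabs d * _]mulrC -mulrDr ltr_pM2l //; lra.
  lra.
have h0 : h 0 = 0.
  rewrite /h; case: eqP => [<-|_]; first by rewrite mulr0.
  by rewrite mulr0 mul0r.
have := mean_value hc hd (ltW r0) rrho; rewrite h0 mul0r => mh.
have nz t : circ r t - z != 0 by exact: circ_neq.
have crho t : cabs (circ r t) < rho by rewrite cabs_circ // ltW.
have cpole t : ccont (fun w => z / (w - z)) (circ r t).
  by apply/cdiff_ccont; apply: (@cdiff_div _ (fun=> z) (fun w => w - z)) => //; exact: cdiff_cst.
have ci g : (forall t, ccont g (circ r t)) ->
    cintegrable lebesgue_measure `[0, pi *+ 2] (fun t => g (circ r t)).
  by move=> H; apply: citv_integrable => t _; exact: rccont_circ.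
have ch : forall t, ccont h (circ r t) by move=> t; apply: hc.
have -> : cmean (fun w => f w * w / (w - z)) r =
   cmean h r + f z * (cint lebesgue_measure `[0, pi *+ 2] (fun=> 1) + cmean (fun w => z / (w - z)) r).
  rewrite /cmean /citv -cintD //; [|exact: cintegrable_cst (itv_fin _ _) _|exact: (ci (fun w => z / (w - z)))].
  rewrite -cintZ //; last first.
    apply: cintegrableD => //; first exact: cintegrable_cst (itv_fin _ _) _.
    exact: (ci (fun w => z / (w - z))).
  rewrite -cintD //; last 2 first.
  - exact: ci.
  - apply: cintegrableZ => //; apply: cintegrableD => //.
      exact: cintegrable_cst (itv_fin _ _) _.
    exact: (ci (fun w => z / (w - z))).
  congr (cint _ _ _); apply/funext => t; rewrite /h ifF; last first.
    by apply/negbTE; rewrite -subr_eq0.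
  by field; exact: nz.
by rewrite mh cmean_pole // addr0 add0r cint_cst ?itv_fin // itv_measE // subr0 mul1r.
Qed.

(** In Cauchy's formula w / (w - z) is a finite geometric sum plus the remainder (z/w)^K w / (w -
    z), so only finite sums cross the integral. The factor 2 is that of [cint_bound]. *)
Lemma cauchy_coef f rho r M : (forall w, cabs w < rho -> cdiff f w) ->
  0 < r -> r < rho -> (forall w, cabs w = r -> cabs (f w) <= M) ->
  exists a : nat -> C, (forall k, cabs (a k) * r ^+ k <= 2 * M) /\
    forall z, cabs z < r -> forall K,
    cabs (f z - \sum_(k < K) a k * z ^+ k) <=
      2 * M * (r / (r - cabs z)) * (cabs z / r) ^+ K.
Proof.
move=> Hf r0 rrho HM; have rn := ltW r0.
have pp : 0 < pi *+ 2 :> R by rewrite mulrn_wgt0 // pi_gt0.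
have c2p : cabs ((pi *+ 2)%:C) = pi *+ 2 :> R by rewrite cabs_ge0R.
have p2n : (pi *+ 2)%:C != 0 :> C by rewrite -cabs_gt0 c2p.
have cn t : circ r t != 0 by rewrite -cabs_gt0 cabs_circ.
have crho t : cabs (circ r t) < rho by rewrite cabs_circ.
have cexpn k w : w != 0 -> cdiff (fun w => w ^- k) w.
  move=> w0; elim: k => [|k IH].
    by rewrite (_ : (fun _ => _) = fun=> 1) ?expr0 ?invr1; [exact: cdiff_cst|apply/funext => v; rewrite expr0 invr1].
  rewrite (_ : (fun _ => _) = fun w => w^-1 * w ^- k); last first.
    by apply/funext => v; rewrite exprS invfM.
  by apply: cdiffM => //; exact: cdiffV.
have ci g : (forall t, ccont g (circ r t)) ->
    cintegrable lebesgue_measure `[0, pi *+ 2] (fun t => g (circ r t)).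
  by move=> H; apply: citv_integrable => t _; exact: rccont_circ.
have cck k t : ccont (fun w => f w * w ^- k) (circ r t).
  by apply/cdiff_ccont/cdiffM; [exact: Hf|exact: cexpn].
exists (fun k => cmean (fun w => f w * w ^- k) r / (pi *+ 2)%:C); split => [k|z zr K].
  rewrite cabsM cabsV c2p mulrAC ler_pdivrMr //.
  have : cabs (cmean (fun w => f w * w ^- k) r) <= 2 * (M * r ^- k) * (pi *+ 2).
    apply: cmean_bound => t; first exact: cck.
    rewrite cabsM cabsV cabsX cabs_circ // ler_wpM2r ?invr_ge0 ?exprn_ge0 //.
    by apply: HM; rewrite cabs_circ.
  rewrite -(@ler_pM2r _ (r ^+ k)) ?exprn_gt0 // => /le_trans; apply.
  rewrite -!mulrA [pi *+ 2 * _]mulrC mulKf // gt_eqF // exprn_gt0 //.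
have nz t : circ r t - z != 0 by exact: circ_neq.
have D0 : 0 < r - cabs z by rewrite subr_gt0.
have cz : forall t, cdiff (fun w => w - z) (circ r t).
  by move=> t; apply: (@cdiffB _ id (fun=> z)); [exact: cdiff_id|exact: cdiff_cst].
pose g w := f w * w / (w - z).
have cg t : ccont g (circ r t).
  apply/cdiff_ccont; apply: (@cdiff_div _ (fun w => f w * w) (fun w => w - z)) => //.
  by apply: cdiffM; [exact: Hf|exact: cdiff_id].
pose g2 w := f w * (z ^+ K * (w ^- K * (w / (w - z)))).
have cg2 t : ccont g2 (circ r t).
  apply/cdiff_ccont; apply: cdiffM; first exact: Hf.
  apply: cdiffM; first exact: cdiff_cst.
  apply: cdiffM; first exact: cexpn.
  by apply: (@cdiff_div _ id (fun w => w - z)) => //; exact: cdiff_id.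
have -> : f z - \sum_(k < K) cmean (fun w => f w * w ^- k) r / (pi *+ 2)%:C * z ^+ k =
    cmean g2 r / (pi *+ 2)%:C.
  apply: (@mulIf _ (pi *+ 2)%:C) => //.
  have Ek k : cmean (fun w => f w * w ^- k) r / (pi *+ 2)%:C * z ^+ k * (pi *+ 2)%:C =
      cint lebesgue_measure `[0, pi *+ 2]%classic
        (fun t => z ^+ k * (f (circ r t) * circ r t ^- k)).
    rewrite cintZ //; last exact: (ci (fun w => f w * w ^- k)).
    by rewrite mulrAC mulfVK // mulrC.
  rewrite mulrBl -(cauchy_formula Hf zr rrho) mulfVK // mulr_suml.
  rewrite (eq_bigr _ (fun (k : 'I_K) _ => Ek k)) /cmean /citv.
  rewrite -cint_sum //; last first.
    by move=> k; apply: cintegrableZ => //; exact: (ci (fun w => f w * w ^- k)).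
  rewrite -cintB //; last 2 first.
  - exact: (ci g).
  - by apply: cintegrable_sum => // k; apply: cintegrableZ => //; exact: (ci (fun w => f w * w ^- k)).
  congr (cint _ _ _); apply/funext => t; rewrite /g2; set w := circ r t.
  have w0 : w != 0 := cn t; have wz : w - z != 0 := nz t.
  have -> : \sum_(k < K) z ^+ k * (f w * w ^- k) = f w * \sum_(k < K) (z / w) ^+ k.
    rewrite mulr_sumr; apply: eq_bigr => k _; rewrite expr_div_n; ring.
  have geo : (\sum_(k < K) (z / w) ^+ k) * (1 - z / w) = 1 - (z / w) ^+ K.
    by rewrite mulrC -[LHS]opprK -mulNr opprB -subrX1 opprB.
  have u0 : 1 - z / w != 0.
    have -> : 1 - z / w = (w - z) / w by field.
    by rewrite mulf_neq0 // invr_neq0.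
  have -> : \sum_(k < K) (z / w) ^+ k = (1 - (z / w) ^+ K) * (w / (w - z)).
    apply: (mulIf u0); rewrite geo -mulrA (_ : w / (w - z) * _ = 1) ?mulr1 //.
    by field; rewrite w0 wz.
  rewrite expr_div_n.
  move: (z ^+ K) (w ^- K) => a b; ring.
rewrite cabsM cabsV c2p ler_pdivrMr // -(mulrA 2 M) -(mulrA 2 _ (_ ^+ K)).
apply: cmean_bound => // t.
rewrite /g2 !cabsM !cabsV !cabsX cabs_circ // -!mulrA.
have M0 : 0 <= M by apply: le_trans (HM (circ r t) _); rewrite ?cabs_ge0 // cabs_circ.
have H1 : cabs (f (circ r t)) <= M by apply: HM; rewrite cabs_circ.
have H2 : (cabs (circ r t - z))^-1 <= (r - cabs z)^-1.
  rewrite lef_pV2 ?posrE // ?cabs_gt0 //.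
  by rewrite lerBlDl -{1}(@cabs_circ r t) // cabs_le_dist.
apply: ler_pM; rewrite ?cabs_ge0 //.
  by rewrite !mulr_ge0 ?invr_ge0 ?exprn_ge0 ?cabs_ge0.
have -> : r * ((r - cabs z)^-1 * (cabs z / r) ^+ K) =
    cabs z ^+ K * (r ^- K * (r * (r - cabs z)^-1)) by rewrite expr_div_n; ring.
apply: ler_wpM2l; first by rewrite exprn_ge0 ?cabs_ge0.
apply: ler_wpM2l; first by rewrite invr_ge0 exprn_ge0.
by rewrite cabs_cis mul1r cabs_ge0R //; exact: ler_wpM2l.
Qed.

End CircleMean.

(** * Sums over multi-indices *)

Section BoxSums.
Variables (R : realType) (n : nat).
Local Notation C := R[i].
Local Notation Cn := 'rV[R[i]]_n.
Local Notation Re := complex.Re.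
Local Notation Im := complex.Im.
Implicit Types (u v : multi_index n -> C) (N : nat).

(** Cubes, rather than sets of bounded total degree: sums over them factor over the coordinates,
    which the geometric bounds and the averages over roots of unity rely on. *)
Definition box N : seq (multi_index n) :=
  [seq [ffun i => (a i : nat)] | a : {ffun 'I_n -> 'I_N}].

Lemma mem_box N (a : multi_index n) : (a \in box N) = [forall i, a i < N]%N.
Proof.
apply/mapP/forallP => [[b _ ->] i|H]; first by rewrite ffunE.
exists [ffun i => Ordinal (H i)]; first by rewrite mem_enum.
by apply/ffunP => i; rewrite !ffunE.
Qed.

Lemma box_uniq N : uniq (box N).
Proof.
rewrite map_inj_uniq; first exact: enum_uniq.
move=> a b /ffunP E; apply/ffunP => i.
by have := E i; rewrite !ffunE => /ord_inj.
Qed.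

Lemma box_sub N N' : (N <= N')%N -> {subset box N <= box N'}.
Proof.
move=> NN a; rewrite !mem_box => /forallP H; apply/forallP => i.
exact: leq_trans (H i) NN.
Qed.

Lemma seq_in_box (X : seq (multi_index n)) : exists N, {subset X <= box N}.
Proof.
elim: X => [|a X [N IH]]; first by exists 0%N.
exists (maxn N (\max_i a i).+1) => b; rewrite inE => /predU1P[->|/IH].
  rewrite mem_box; apply/forallP => i; rewrite leq_max ltnS.
  by rewrite (leq_bigmax (F := fun i => a i)) orbT.
by apply: box_sub; rewrite leq_maxl.
Qed.

Lemma sum_box (V : nmodType) N (u : multi_index n -> V) :
  \sum_(a <- box N) u a =
  \sum_(a : {ffun 'I_n -> 'I_N}) u [ffun i => (a i : nat)].
Proof. by rewrite /box big_map big_enum. Qed.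

Lemma sum_sub_seq (V : nmodType) (X Y : seq (multi_index n)) (u : multi_index n -> V) :
  uniq X -> uniq Y -> {subset X <= Y} ->
  \sum_(a <- Y) u a = \sum_(a <- X) u a + \sum_(a <- Y | a \notin X) u a.
Proof.
move=> uX uY XY; rewrite (bigID (fun a => a \in X)) /=; congr (_ + _).
rewrite -big_filter; apply: perm_big; apply: uniq_perm => //; first exact: filter_uniq.
move=> a; rewrite mem_filter; case aX : (a \in X) => //=; exact: XY.
Qed.

Lemma sum_sub_le (X Y : seq (multi_index n)) (u : multi_index n -> R) :
  (forall a, 0 <= u a) -> uniq X -> uniq Y -> {subset X <= Y} ->
  \sum_(a <- X) u a <= \sum_(a <- Y) u a.
Proof. by move=> u0 uX uY XY; rewrite (sum_sub_seq _ uX uY XY) lerDl sumr_ge0. Qed.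

(** Absolute convergence, as boundedness of the box sums, together with the value along boxes. The
    first clause makes the value independent of the exhaustion and links it to [summable]. *)
Definition has_sum u (S : C) : Prop :=
  (exists M : R, forall N, \sum_(a <- box N) cabs (u a) <= M) /\
  forall e : R, 0 < e -> exists N0, forall N, (N0 <= N)%N ->
    cabs (\sum_(a <- box N) u a - S) < e.

Lemma has_sum_unique u S S' : has_sum u S -> has_sum u S' -> S = S'.
Proof.
move=> [_ H] [_ H']; apply: cabs_lt_eps_eq => e e0.
have e2 : 0 < e / 2 by rewrite divr_gt0.
have [N HN] := H _ e2; have [N' HN'] := H' _ e2.
pose m := maxn N N'; have h := HN m (leq_maxl _ _); have h' := HN' m (leq_maxr _ _).
have -> : S - S' = (\sum_(a <- box m) u a - S') - (\sum_(a <- box m) u a - S) by ring.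
by apply: le_lt_trans (cabsB _ _) _; rewrite (splitr e) ltrD.
Qed.

Lemma eq_has_sum u v S : u =1 v -> has_sum u S -> has_sum v S.
Proof. by move=> /funext ->. Qed.

Lemma has_sumD u v S T : has_sum u S -> has_sum v T -> has_sum (fun a => u a + v a) (S + T).
Proof.
move=> [[M HM] Hu] [[M' HM'] Hv]; split.
  exists (M + M') => N; apply: le_trans (lerD (HM N) (HM' N)).
  by rewrite -big_split; apply: ler_sum => a _; exact: cabsD.
move=> e e0; have e2 : 0 < e / 2 by rewrite divr_gt0.
have [N HN] := Hu _ e2; have [N' HN'] := Hv _ e2; exists (maxn N N') => m.
rewrite geq_max => /andP[/HN h /HN' h']; rewrite big_split /=.
rewrite opprD addrACA; apply: le_lt_trans (cabsD _ _) _.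
by rewrite (splitr e) ltrD.
Qed.

Lemma has_sumZ c u S : has_sum u S -> has_sum (fun a => c * u a) (c * S).
Proof.
move=> [[M HM] Hu]; split.
  exists (cabs c * M) => N; apply: le_trans (ler_wpM2l (cabs_ge0 c) (HM N)).
  by rewrite mulr_sumr; apply: ler_sum => a _; rewrite cabsM.
move=> e e0; have K0 : 0 < cabs c + 1 by rewrite ltr_wpDl ?cabs_ge0.
have [N HN] := Hu _ (divr_gt0 e0 K0); exists N => m /HN.
rewrite ltr_pdivlMr // -mulr_sumr -mulrBr cabsM => H; apply: le_lt_trans H.
by rewrite mulrC ler_wpM2l ?cabs_ge0 // lerDl.
Qed.

Lemma has_sum_seq (I : Type) (r : seq I) (u : I -> multi_index n -> C) (S : I -> C) :
  (forall i, has_sum (u i) (S i)) ->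
  has_sum (fun a => \sum_(i <- r) u i a) (\sum_(i <- r) S i).
Proof.
move=> H; elim: r => [|i r IH].
  rewrite big_nil; apply: (@eq_has_sum (fun=> 0)); first by move=> a; rewrite big_nil.
  split; first by exists 0 => N; rewrite big1 // => a _; rewrite cabs0.
  by move=> e e0; exists 0%N => N _; rewrite big1 // subrr cabs0.
rewrite big_cons; apply: eq_has_sum (has_sumD (H i) IH) => a; by rewrite big_cons.
Qed.

Lemma has_sumJ u S : has_sum u S -> has_sum (fun a => (u a)^*) S^*.
Proof.
move=> [[M HM] Hu]; split.
  by exists M => N; apply: le_trans (HM N); apply: ler_sum => a _; rewrite cabsJ.
move=> e /Hu [N HN]; exists N => m /HN.
by rewrite -(cabsJ (_ - _)) rmorphB rmorph_sum.
Qed.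

Lemma has_sum_fin (X : seq (multi_index n)) u : uniq X ->
  (forall a, a \notin X -> u a = 0) -> has_sum u (\sum_(a <- X) u a).
Proof.
move=> uX u0; have [N0 XN] := seq_in_box X; split.
  exists (\sum_(a <- X) cabs (u a)) => N.
  have sub := @box_sub N (maxn N N0) (leq_maxl _ _).
  apply: le_trans (sum_sub_le _ (box_uniq _) (box_uniq _) sub) _.
    by move=> a; exact: cabs_ge0.
  rewrite (sum_sub_seq _ uX (box_uniq _)); last first.
    by move=> a /XN; apply: box_sub; exact: leq_maxr.
  by rewrite addrC big1 ?add0r // => a /u0 ->; rewrite cabs0.
move=> e e0; exists N0 => N N0N.
rewrite (sum_sub_seq _ uX (box_uniq N)); last by move=> a /XN; exact: box_sub.
by rewrite addrAC subrr add0r big1 ?cabs0 // => a /u0.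
Qed.

(* The convergence is unconditional: any finite set containing a large box does. *)
Lemma has_sum_net u S : has_sum u S -> forall e : R, 0 < e ->
  exists N0, forall X, uniq X -> {subset box N0 <= X} -> cabs (\sum_(a <- X) u a - S) < e.
Proof.
move=> [[M HM] Hu] e e0.
pose T := [set \sum_(a <- box N) cabs (u a) | N in setT].
have hT : has_sup T.
  split; first by exists (\sum_(a <- box 0) cabs (u a)), 0%N.
  by exists M => _ [N _ <-].
(* The sum of moduli over [box N1] is within [e / 2] of the supremum, so any finite set of further
   indices contributes less than [e / 2]. *)
have [_ [N1 _ <-] HN1] := sup_adherent (divr_gt0 e0 (ltr0n R 2)) hT.
have [N2 HN2] := Hu _ (divr_gt0 e0 (ltr0n R 2)).
pose N0 := maxn N1 N2; exists N0 => X uX bX.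
rewrite (sum_sub_seq _ (box_uniq N0) uX bX) addrAC.
apply: le_lt_trans (cabsD _ _) _; rewrite (splitr e) ltrD //.
  by apply: HN2; rewrite leq_maxr.
have [m Xm] := seq_in_box X.
have N0m : {subset box N0 <= box (maxn m N0)} by apply: box_sub; rewrite leq_maxr.
have s1 : \sum_(a <- box (maxn m N0)) cabs (u a) <= sup T.
  by apply: ub_le_sup; [exists M => _ [N _ <-]|exists (maxn m N0)].
have s2 : \sum_(a <- box N1) cabs (u a) <= \sum_(a <- box N0) cabs (u a).
  apply: sum_sub_le; rewrite ?box_uniq //; first by move=> a; exact: cabs_ge0.
  by apply: box_sub; rewrite leq_maxl.
rewrite (sum_sub_seq _ (box_uniq N0) (box_uniq _) N0m) in s1.
apply: le_lt_trans (cabs_sum _ _ _) _.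
have s3 : \sum_(a <- X | a \notin box N0) cabs (u a) <=
          \sum_(a <- box (maxn m N0) | a \notin box N0) cabs (u a).
  rewrite -big_filter -[leRHS]big_filter; apply: sum_sub_le.
  - by move=> a; exact: cabs_ge0.
  - exact: filter_uniq.
  - exact/filter_uniq/box_uniq.
  - move=> a; rewrite !mem_filter => /andP[-> /Xm] /=; apply: box_sub; exact: leq_maxl.
lra.
Qed.

(** An injection does not send boxes to boxes, so unconditional convergence is used: the image of a
    large box is completed by the indices [Z] outside the image, where [u] vanishes. This serves the
    index shift of a differentiated series. *)
Lemma has_sum_inj u S (f : multi_index n -> multi_index n) :
  injective f -> (forall a, (forall b, f b != a) -> u a = 0) ->
  has_sum u S -> has_sum (fun b => u (f b)) S.
Proof.
move=> inj u0 Hs; have [[M HM] _] := Hs; split.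
  exists M => N; have [m Hm] := seq_in_box [seq f b | b <- box N].
  apply: le_trans (HM m); rewrite -(big_map f xpredT (fun a => cabs (u a))).
  apply: sum_sub_le => //; [by move=> a; exact: cabs_ge0| |exact: box_uniq].
  by rewrite (map_inj_uniq inj); exact: box_uniq.
move=> e /(has_sum_net Hs) [N0 HN0].
have /choice [g Hg] : forall a, exists b, (exists b, f b = a) -> f b = a.
  move=> a; have [[b fb]|nb] := pselect (exists b, f b = a); first by exists b.
  by exists a => /nb.
have [N1 HN1] := seq_in_box [seq g a | a <- box N0].
exists N1 => N N1N.
pose Y := [seq f b | b <- box N].
pose Z := [seq a <- box N0 | a \notin Y].
have uY : uniq Y by rewrite (map_inj_uniq inj); exact: box_uniq.
have YZ : uniq (Y ++ Z).
  rewrite cat_uniq uY filter_uniq ?box_uniq // andbT.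
  by apply/hasPn => a; rewrite mem_filter => /andP[].
have sub : {subset box N0 <= Y ++ Z}.
  by move=> a aN; rewrite mem_cat mem_filter aN andbT; case: (a \in Y).
have := HN0 _ YZ sub; rewrite big_cat /= big_map.
have -> : \sum_(a <- Z) u a = 0; last by rewrite addr0.
rewrite big_seq; apply: big1 => a; rewrite mem_filter => /andP[aY aN].
apply: u0 => b; apply: contraNneq aY => fb; apply/mapP; exists (g a).
  by apply: (box_sub N1N); apply: HN1; apply/mapP; exists a.
by rewrite Hg //; exists b.
Qed.

Definition mono (z : Cn) (a : multi_index n) : C := \prod_i z ord0 i ^+ a i.

Definition rmono (s : 'I_n -> R) (a : multi_index n) : R := \prod_i s i ^+ a i.

Lemma cabs_mono z a : cabs (mono z a) = rmono (fun i => cabs (z ord0 i)) a.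
Proof. by rewrite /mono cabs_prod; apply: eq_bigr => i _; rewrite cabsX. Qed.

Lemma rmono_ge0 s a : (forall i, 0 <= s i) -> 0 <= rmono s a.
Proof. by move=> s0; apply: prodr_ge0 => i _; rewrite exprn_ge0. Qed.

Lemma ler_rmono s t a : (forall i, 0 <= s i <= t i) -> rmono s a <= rmono t a.
Proof.
move=> st; apply: ler_prod => i _; have /andP[s0 sti] := st i.
by rewrite exprn_ge0 // lerXn2r // nnegrE // (le_trans s0).
Qed.

Lemma rmonoM s t a : rmono (fun i => s i * t i) a = rmono s a * rmono t a.
Proof. by rewrite /rmono -big_split; apply: eq_bigr => i _; rewrite exprMn. Qed.

Lemma geo_le (q : R) N : 0 <= q -> q < 1 -> \sum_(k < N) q ^+ k <= (1 - q)^-1.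
Proof.
move=> q0 q1; have D : 0 < 1 - q by rewrite subr_gt0.
rewrite -[leRHS]mul1r ler_pdivlMr // mulrC -[leLHS]opprK -mulNr opprB -subrX1 opprB.
by rewrite lerBlDr lerDl exprn_ge0.
Qed.

Lemma sum_box_rmono s N : \sum_(a <- box N) rmono s a = \prod_i \sum_(k < N) s i ^+ k.
Proof.
rewrite sum_box bigA_distr_bigA; apply: eq_bigr => a _.
by apply: eq_bigr => i _; rewrite ffunE.
Qed.

Lemma sum_box_geo (s : 'I_n -> R) N : (forall i, 0 <= s i < 1) ->
  \sum_(a <- box N) rmono s a <= \prod_i (1 - s i)^-1.
Proof.
move=> H; rewrite sum_box_rmono; apply: ler_prod => i _; have /andP[s0 s1] := H i.
by rewrite sumr_ge0 /= ?geo_le // => k _; rewrite exprn_ge0.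
Qed.

(** [R[i]] is algebraically closed and X^N - 1 is separable in characteristic 0, so it has N
    distinct roots, among them a primitive one. *)
Lemma prim_root_ex N : (0 < N)%N -> exists w : C, N.-primitive_root w.
Proof.
move=> N0; pose p : {poly C} := 'X^N - 1; have [r Dp] := closed_field_poly_normal p.
rewrite (monicP _) ?monicXnsubC // scale1r in Dp.
have rn1 : all N.-unity_root r by apply/allP => z; rewrite -root_prod_XsubC -Dp.
have sz_r : (N < (size r).+1)%N.
  by rewrite -(size_prod_XsubC r id) -Dp size_XnsubC.
have [|z] := hasP (has_prim_root N0 rn1 _ sz_r); last by exists z.
by rewrite -separable_prod_XsubC -Dp separable_Xn_sub_1 // pnatr_eq0 -lt0n.
Qed.

Lemma cabs_root N (w : C) : N.-primitive_root w -> cabs w = 1.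
Proof.
move=> pw; have N0 := prim_order_gt0 pw; have := congr1 (@cabs R) (prim_expr_order pw).
by rewrite cabsX cabs1 => /eqP; rewrite pexpr_eq1 ?cabs_ge0 // => /eqP.
Qed.

Lemma root_orth N (w : C) (m k : 'I_N) : N.-primitive_root w ->
  \sum_(l < N) (w ^+ l) ^+ m * (w ^+ l) ^- k = (m == k)%:R * N%:R.
Proof.
move=> pw; have w0 : w != 0 by rewrite -cabs_gt0 (cabs_root pw).
pose u := w ^+ m / w ^+ k.
have Eu l : (w ^+ l) ^+ m * (w ^+ l) ^- k = u ^+ l.
  by rewrite /u expr_div_n -!exprM ![(l * _)%N]mulnC.
rewrite (eq_bigr (fun l : 'I_N => u ^+ l)) //.
have [Emk|mk] := eqVneq m k.
  rewrite mul1r (eq_bigr (fun=> 1)); first by rewrite sumr_const card_ord.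
  by move=> l _; rewrite /u Emk divff ?expr1n // expf_neq0.
have uN : u ^+ N = 1.
  by rewrite /u expr_div_n -!exprM ![(_ * N)%N]mulnC !exprM (prim_expr_order pw) !expr1n divr1.
have u1 : u != 1.
  apply: contraNneq mk => u1; apply/eqP/ord_inj.
  have : w ^+ m == w ^+ k.
    by rewrite -[X in _ == X]mul1r -u1 /u divfK // expf_neq0.
  by rewrite (eq_prim_root_expr pw) !modn_small // => /eqP.
rewrite mul0r; apply: (@mulfI _ (u - 1)); first by rewrite subr_eq0.
by rewrite -subrX1 uN subrr mulr0.
Qed.

End BoxSums.
Arguments box {n} N.
Arguments box_uniq {n} N.
Arguments box_sub {n} [N N'] _ [x] _.

(** * Power series in several variables *)

Section Polydisc.
Variables (R : realType) (n : nat).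
Local Notation C := R[i].
Local Notation Cn := 'rV[R[i]]_n.

Definition upd (z : Cn) (j : 'I_n) (t : C) : Cn :=
  \row_i (if i == j then t else z ord0 i).

(** The Cauchy kernel 1 / (1 - t/z), truncated at degree N. *)
Definition kern N (t z : C) : C := \sum_(k < N) t ^+ k * z ^- k.

Lemma kern_bound N t z (s r : R) : 0 < r -> 0 <= s -> s < r -> cabs t <= s -> cabs z = r ->
  cabs (kern N t z) <= (1 - s / r)^-1.
Proof.
move=> r0 s0 sr ts zr; have q0 : 0 <= s / r by rewrite divr_ge0 // ltW.
have q1 : s / r < 1 by rewrite ltr_pdivrMr // mul1r.
apply: le_trans (geo_le N q0 q1); apply: le_trans (cabs_sum _ _ _) _.
apply: ler_sum => k _; rewrite cabsM cabsV !cabsX zr expr_div_n.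
by rewrite ler_wpM2r ?invr_ge0 ?exprn_ge0 ?(ltW r0) // lerXn2r // nnegrE ?cabs_ge0.
Qed.

(** A discrete Cauchy formula, exact on polynomials of degree less than N by orthogonality of the
    roots of unity. *)
Lemma kern_exact N (w : C) (a : nat -> C) (t : C) (r : R) : N.-primitive_root w -> 0 < r ->
  N%:R^-1 * \sum_(l < N) (\sum_(k < N) a k * (r%:C * w ^+ l) ^+ k) * kern N t (r%:C * w ^+ l)
  = \sum_(k < N) a k * t ^+ k.
Proof.
move=> pw r0; have N0 : N%:R != 0 :> C by rewrite pnatr_eq0 -lt0n (prim_order_gt0 pw).
have rn : r%:C != 0 :> C by rewrite -cabs_gt0 cabs_ge0R // ltW.
apply: (mulfI N0); rewrite mulVKf //.
transitivity (\sum_(l < N) \sum_(k < N) \sum_(m < N)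
   (a k * r%:C ^+ k * t ^+ m * r%:C ^- m) * ((w ^+ l) ^+ k * (w ^+ l) ^- m)).
  apply: eq_bigr => l _; rewrite /kern mulr_suml; apply: eq_bigr => k _.
  rewrite mulr_sumr; apply: eq_bigr => m _; rewrite !exprMn invfM; ring.
rewrite exchange_big /= mulr_sumr; apply: eq_bigr => k _.
rewrite exchange_big /= (bigD1 k) //= [X in _ + X]big1 ?addr0 => [|m mk].
  rewrite -mulr_sumr root_orth // eqxx mul1r.
  by field; rewrite expf_neq0.
by rewrite -mulr_sumr root_orth // eq_sym (negbTE mk) mul0r mulr0.
Qed.

Section Approx.
Variables (f : Cn -> C) (M rho r s : R).
Hypothesis rho1 : 1 < rho.
Hypothesis Hd : forall (z : Cn) j (t : C), (forall i, cabs (z ord0 i) <= 1) -> cabs t < rho ->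
  cdiff (fun t => f (upd z j t)) t.
Hypothesis HM : forall z : Cn, (forall i, cabs (z ord0 i) <= 1) -> cabs (f z) <= M.
Hypotheses (s0 : 0 < s) (sr : s < r) (r1 : r < 1).

Let r0 : 0 < r. Proof. exact: lt_trans sr. Qed.
Let B : R := (1 - s / r)^-1.
Let M0 : 0 <= M.
Proof. by apply: le_trans (HM (z := 0) _) => [|i]; rewrite ?cabs_ge0 // mxE cabs0. Qed.
Let D0 : 0 < 1 - s / r. Proof. by rewrite subr_gt0 ltr_pdivrMr // mul1r. Qed.
Let B1 : 1 <= B.
Proof. by rewrite /B -[leLHS]invr1 lef_pV2 ?posrE // gerBl divr_ge0 // ltW. Qed.
Let B0 : 0 <= B. Proof. exact: le_trans B1. Qed.
(** The Taylor remainder of order N on the disc of radius [r], counted once at the evaluation point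
    and once, weighted by the bound [B] of the kernel, at the nodes. *)
Let E N : R := 2 * M * (1 - r)^-1 * r ^+ N * (1 + B).
Let E0 N : 0 <= E N.
Proof.
by rewrite /E !mulr_ge0 ?exprn_ge0 ?(ltW r0) ?invr_ge0 ?subr_ge0 ?(ltW r1) // addr_ge0.
Qed.

Lemma one_var_approx N (w : C) (z : Cn) j t : N.-primitive_root w ->
  (forall i, cabs (z ord0 i) <= 1) -> cabs t <= s ->
  cabs (f (upd z j t) - N%:R^-1 *
    \sum_(l < N) f (upd z j (r%:C * w ^+ l)) * kern N t (r%:C * w ^+ l)) <= E N.
Proof.
move=> pw Hz ts; pose g t := f (upd z j t).
have [a [_ Ha]] : exists a : nat -> C, (forall k, cabs (a k) * 1 ^+ k <= 2 * M) /\
    forall z, cabs z < 1 -> forall K, cabs (g z - \sum_(k < K) a k * z ^+ k) <=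
      2 * M * (1 / (1 - cabs z)) * (cabs z / 1) ^+ K.
  apply: (@cauchy_coef R g rho) => // [v vr|v v1]; first exact: Hd.
  by apply: HM => i; rewrite mxE; case: ifP => //; rewrite v1.
have Hr v : cabs v <= r -> cabs (g v - \sum_(k < N) a k * v ^+ k) <= 2 * M * (1 - r)^-1 * r ^+ N.
  move=> vr; apply: le_trans (Ha v (le_lt_trans vr r1) N) _; rewrite div1r divr1.
  apply: ler_pM; rewrite ?exprn_ge0 ?cabs_ge0 ?mulr_ge0 ?invr_ge0 ?subr_ge0 //.
  - exact: le_trans vr (ltW r1).
  - rewrite ler_wpM2l ?mulr_ge0 // lef_pV2 ?posrE ?subr_gt0 //; last exact: le_lt_trans r1.
    by rewrite lerD2l lerN2.
  - by rewrite lerXn2r // nnegrE ?cabs_ge0 // ltW.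
have N0 : (0 < N)%N := prim_order_gt0 pw.
have cw l : cabs (r%:C * w ^+ l) = r.
  by rewrite cabsM cabsX (cabs_root pw) expr1n mulr1 cabs_ge0R // ltW.
have -> : f (upd z j t) - N%:R^-1 *
    \sum_(l < N) f (upd z j (r%:C * w ^+ l)) * kern N t (r%:C * w ^+ l) =
   (g t - \sum_(k < N) a k * t ^+ k) - N%:R^-1 * \sum_(l < N)
    (g (r%:C * w ^+ l) - \sum_(k < N) a k * (r%:C * w ^+ l) ^+ k) * kern N t (r%:C * w ^+ l).
  have -> : \sum_(l < N) (g (r%:C * w ^+ l) - \sum_(k < N) a k * (r%:C * w ^+ l) ^+ k)
        * kern N t (r%:C * w ^+ l) =
      \sum_(l < N) g (r%:C * w ^+ l) * kern N t (r%:C * w ^+ l) -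
      \sum_(l < N) (\sum_(k < N) a k * (r%:C * w ^+ l) ^+ k) * kern N t (r%:C * w ^+ l).
    by rewrite -sumrB; apply: eq_bigr => l _; rewrite mulrBl.
  rewrite mulrBr (kern_exact a t pw r0) /g; ring.
apply: le_trans (cabsB _ _) _; rewrite /E mulrDr mulr1; apply: lerD.
  by apply: Hr; apply: le_trans ts (ltW sr).
rewrite cabsM cabsV cabs_nat mulrC ler_pdivrMr ?ltr0n //.
apply: le_trans (cabs_sum _ _ _) _.
apply: le_trans (ler_sum (G := fun=> 2 * M * (1 - r)^-1 * r ^+ N * B) _ _) _.
  move=> l _; rewrite cabsM; apply: ler_pM; rewrite ?cabs_ge0 //.
    by apply: Hr; rewrite cw.
  exact: kern_bound (ltW s0) sr ts (cw l).
by rewrite sumr_const card_ord mulr_natr.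
Qed.

Section FixedN.
Variables (N : nat) (w : C).
Hypothesis pw : N.-primitive_root w.
Let N0 : (0 < N)%N := prim_order_gt0 pw.
Let Nn0 : N%:R != 0 :> C. Proof. by rewrite pnatr_eq0 -lt0n. Qed.

Local Notation pt k := (r%:C * w ^+ k).
Let cpt k : cabs (pt k) = r.
Proof. by rewrite cabsM cabsX (cabs_root pw) expr1n mulr1 cabs_ge0R // ltW. Qed.

Definition mix m (l : {ffun 'I_n -> 'I_N}) (z : Cn) : Cn :=
  \row_i (if (i < m)%N then pt (l i) else z ord0 i).

(** An interpolation between [f] (for m = 0) and a polynomial (for m = n): the discrete Cauchy
    formula is applied in the first [m] coordinates. The average always runs over all the nodes,
    although the later ones do not matter, so that consecutive values of [m] are compared over the
    same index set. *)
Definition partial_mean m (z : Cn) : C :=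
  (N%:R ^+ n)^-1 * \sum_(l : {ffun 'I_n -> 'I_N})
    f (mix m l z) * \prod_(i : 'I_n | (i < m)%N) kern N (z ord0 i) (pt (l i)).

(** An average is unchanged when coordinate [j] is sampled afresh; the involution [h] exchanges
    [l j] with the new index. *)
Lemma average_coord (j : 'I_n) (G : {ffun 'I_n -> 'I_N} -> 'I_N -> C) :
  (forall (l l' : {ffun 'I_n -> 'I_N}) v, (forall i, i != j -> l i = l' i) -> G l v = G l' v) ->
  \sum_l G l (l j) = N%:R^-1 * \sum_l \sum_v G l v.
Proof.
move=> HG; apply: (mulfI Nn0); rewrite mulVKf //.
pose h (p : {ffun 'I_n -> 'I_N} * 'I_N) :=
  ([ffun i => if i == j then p.2 else p.1 i] : {ffun 'I_n -> 'I_N}, p.1 j).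
have hK : involutive h.
  move=> [l v]; rewrite /h /= ffunE eqxx; congr (_, _).
  by apply/ffunP => i; rewrite !ffunE; case: eqP => // ->.
rewrite pair_big /= (reindex_inj (inv_inj hK)) /= .
transitivity (\sum_(p : {ffun 'I_n -> 'I_N} * 'I_N) G p.1 (p.1 j)).
  rewrite -(pair_big xpredT xpredT (fun l _ => G l (l j))) /= mulr_sumr.
  by apply: eq_bigr => l _; rewrite sumr_const card_ord mulr_natl.
apply: eq_bigr => -[l v] _ /=; apply: HG => i ij; by rewrite ffunE (negbTE ij).
Qed.

Lemma mix_bound m l (z : Cn) : (forall i, cabs (z ord0 i) <= 1) ->
  forall i, cabs (mix m l z ord0 i) <= 1.
Proof. by move=> Hz i; rewrite mxE; case: ifP => // _; rewrite cpt ltW. Qed.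

(** The two means differ by the one-variable error in coordinate [m], weighted by the kernels of the
    earlier coordinates; their product is at most [B ^+ n] because [1 <= B]. *)
Lemma partial_mean_step (m : 'I_n) (z : Cn) : (forall i, cabs (z ord0 i) <= s) ->
  cabs (partial_mean m z - partial_mean m.+1 z) <= B ^+ n * E N.
Proof.
move=> Hz; have Hz1 i : cabs (z ord0 i) <= 1.
  by apply: le_trans (Hz i) _; apply/ltW/(lt_trans sr).
pose W (l : {ffun 'I_n -> 'I_N}) := \prod_(i : 'I_n | (i < m)%N) kern N (z ord0 i) (pt (l i)).
have WE (l : {ffun 'I_n -> 'I_N}) : \prod_(i : 'I_n | (i < m.+1)%N) kern N (z ord0 i) (pt (l i)) =
    kern N (z ord0 m) (pt (l m)) * W l.
  rewrite (bigD1 m) //=; congr (_ * _); apply: eq_bigl => i.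
  by rewrite ltnS ltn_neqAle andbC -val_eqE.
have mixS l : mix m.+1 l z = upd (mix m l z) m (pt (l m)).
  apply/rowP => i; rewrite !mxE ltnS leq_eqVlt -val_eqE.
  by case: eqP => //= E1; congr (_ * _ ^+ _); congr (nat_of_ord (l _)); apply: val_inj.
have mix0 l : mix m l z = upd (mix m l z) m (z ord0 m).
  by apply/rowP => i; rewrite !mxE -val_eqE; case: eqP => [E1|//]; rewrite E1 ltnn; congr (z _ _); exact: val_inj.
pose G (l : {ffun 'I_n -> 'I_N}) (v : 'I_N) := f (upd (mix m l z) m (pt v)) * (kern N (z ord0 m) (pt v) * W l).
have EG : \sum_l G l (l m) = N%:R^-1 * \sum_l \sum_v G l v.
  apply: average_coord => l l' v ll; rewrite /G.
  have -> : W l = W l'.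
    apply: eq_bigr => i im; rewrite ll //; apply: contraTneq im => ->; by rewrite ltnn.
  congr (f _ * _); apply/rowP => i; rewrite !mxE; case: eqP => // /eqP im.
  by rewrite ll.
rewrite /partial_mean -mulrBr cabsM cabsV cabsX cabs_nat mulrC ler_pdivrMr ?exprn_gt0 ?ltr0n //.
have -> : \sum_l f (mix m.+1 l z) * \prod_(i : 'I_n | (i < m.+1)%N) kern N (z ord0 i) (pt (l i))
   = \sum_l G l (l m).
  by apply: eq_bigr => l _; rewrite WE mixS.
rewrite EG mulr_sumr -sumrB; apply: le_trans (cabs_sum _ _ _) _.
apply: le_trans (ler_sum (G := fun=> B ^+ n * E N) _ _) _; last first.
  by rewrite sumr_const card_ffun !card_ord -[leLHS]mulr_natr natrX.
move=> l _; rewrite -/(W l).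
have -> : f (mix m l z) * W l - N%:R^-1 * \sum_v G l v =
  W l * (f (upd (mix m l z) m (z ord0 m)) - N%:R^-1 *
    \sum_(v < N) f (upd (mix m l z) m (pt v)) * kern N (z ord0 m) (pt v)).
  rewrite -mix0 mulrBr mulrC; congr (_ - _); rewrite mulrCA; congr (_ * _).
  by rewrite mulr_sumr; apply: eq_bigr => v _; rewrite /G; ring.
rewrite cabsM; apply: ler_pM; rewrite ?cabs_ge0 //; last first.
  by apply: one_var_approx => //; exact: mix_bound.
rewrite cabs_prod; apply: (@le_trans _ _ (\prod_(i : 'I_n) B)).
  rewrite [leRHS](bigID (fun i : 'I_n => (i < m)%N)) /=.
  rewrite -[leLHS]mulr1; apply: ler_pM; rewrite ?ler01 ?prodr_ge0 //.
  - by move=> i _; exact: cabs_ge0.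
  - apply: ler_prod => i _; rewrite cabs_ge0 /=.
    exact: kern_bound (ltW s0) sr (Hz i) (cpt _).
  - by apply: (big_ind (fun x => 1 <= x)) => // x y x1 y1; apply: mulr_ege1.
by rewrite prodr_const card_ord.
Qed.

Lemma partial_mean0 z : partial_mean 0 z = f z.
Proof.
rewrite /partial_mean (eq_bigr (fun=> f z)).
  by rewrite sumr_const card_ffun !card_ord -[f z *+ _]mulr_natl natrX mulKf // expf_neq0.
move=> l _; rewrite big_pred0 // mulr1; congr f; apply/rowP => i; by rewrite mxE.
Qed.

Lemma full_mean_approx (z : Cn) : (forall i, cabs (z ord0 i) <= s) ->
  cabs (f z - partial_mean n z) <= n%:R * (B ^+ n * E N).
Proof.
move=> Hz; rewrite -partial_mean0.
suff H m : (m <= n)%N -> cabs (partial_mean 0 z - partial_mean m z) <= m%:R * (B ^+ n * E N).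
  exact: H.
elim: m => [|m IH] mn; first by rewrite subrr cabs0 mul0r.
have := partial_mean_step (Ordinal mn) Hz => /= H1.
have -> : partial_mean 0 z - partial_mean m.+1 z =
  (partial_mean 0 z - partial_mean m z) + (partial_mean m z - partial_mean m.+1 z) by ring.
apply: le_trans (cabsD _ _) _; rewrite -natr1 mulrDl mul1r; apply: lerD => //.
exact/IH/ltnW.
Qed.

Definition torus_coef (a : multi_index n) : C :=
  (N%:R ^+ n)^-1 * \sum_(l : {ffun 'I_n -> 'I_N})
    f (\row_i pt (l i)) * \prod_(i : 'I_n) pt (l i) ^- a i.

Lemma full_meanE z : partial_mean n z = \sum_(a <- box N) torus_coef a * mono z a.
Proof.
rewrite /partial_mean /torus_coef.
under [in RHS]eq_bigr do rewrite -mulrA.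
rewrite -mulr_sumr; congr (_ * _).
under [in RHS]eq_bigr do rewrite mulr_suml.
rewrite exchange_big /=; apply: eq_bigr => l _.
have -> : mix n l z = \row_i pt (l i) by apply/rowP => i; rewrite !mxE ltn_ord.
rewrite (eq_bigl xpredT); last by move=> i; rewrite ltn_ord.
rewrite /kern bigA_distr_bigA sum_box mulr_sumr; apply: eq_bigr => a _.
rewrite -mulrA; congr (_ * _); rewrite /mono -big_split; apply: eq_bigr => i _.
by rewrite ffunE mulrC.
Qed.

Lemma torus_coef_bound a : cabs (torus_coef a) * rmono (fun=> r) a <= M.
Proof.
have rm0 : 0 < rmono (fun=> r) a :> R by apply: prodr_gt0 => i _; rewrite exprn_gt0.
rewrite -ler_pdivlMr // /torus_coef cabsM cabsV cabsX cabs_nat mulrC.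
rewrite ler_pdivrMr ?exprn_gt0 ?ltr0n //; apply: le_trans (cabs_sum _ _ _) _.
apply: le_trans (ler_sum (G := fun=> M / rmono (fun=> r) a) _ _) _; last first.
  by rewrite sumr_const card_ffun !card_ord -[leLHS]mulr_natr natrX.
move=> l _; rewrite cabsM; apply: ler_pM; rewrite ?cabs_ge0 //.
  by apply: HM => i; rewrite mxE cpt ltW.
rewrite cabs_prod /rmono -prodfV; apply: ler_prod => i _.
by rewrite cabs_ge0 /= cabsV cabsX cpt.
Qed.

End FixedN.
End Approx.

(** Discrete Fourier inversion: a coefficient is the average of the values at N^n points of the
    torus against a character of modulus 1. *)
Lemma poly_coef_bound N (c : multi_index n -> C) (s d : R) : (0 < N)%N -> 0 < s ->
  (forall z : Cn, (forall i, cabs (z ord0 i) = s) ->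
     cabs (\sum_(a <- box N) c a * mono z a) <= d) ->
  forall a, a \in box N -> cabs (c a) * rmono (fun=> s) a <= d.
Proof.
move=> N0 s0 H _ /mapP[b _ ->]; set a : multi_index n := [ffun i => (b i : nat)].
have [w pw] := @prim_root_ex R N N0.
have Nn0 : N%:R != 0 :> C by rewrite pnatr_eq0 -lt0n.
have cw l : cabs (s%:C * w ^+ l) = s.
  by rewrite cabsM cabsX (cabs_root pw) expr1n mulr1 cabs_ge0R // ltW.
pose z (l : {ffun 'I_n -> 'I_N}) : Cn := \row_i (s%:C * w ^+ l i).
have E : c a * (rmono (fun=> s) a)%:C = (N%:R ^+ n)^-1 * \sum_(l : {ffun 'I_n -> 'I_N})
    (\sum_(a <- box N) c a * mono (z l) a) * \prod_i (w ^+ l i) ^- a i.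
  apply: (mulfI (expf_neq0 n Nn0)); rewrite mulVKf ?expf_neq0 //.
  under [in RHS]eq_bigr do rewrite sum_box mulr_suml.
  rewrite exchange_big /= (bigD1 b) //= [X in _ + X]big1 ?addr0 => [|b' bb'].
    transitivity (\sum_(l : {ffun 'I_n -> 'I_N}) c a * (rmono (fun=> s) a)%:C).
      by rewrite sumr_const card_ffun !card_ord -[RHS]mulr_natl natrX.
    apply: eq_bigr => l _; rewrite -mulrA; congr (_ * _).
    rewrite /rmono rmorph_prod /mono -big_split; apply: eq_bigr => i _ /=.
    rewrite !mxE !ffunE exprMn rmorphXn /= mulfK //.
    by rewrite !expf_neq0 // -cabs_gt0 (cabs_root pw).
  set a' : multi_index n := [ffun i => (b' i : nat)].
  transitivity (c a' * ((rmono (fun=> s) a')%:C * \prod_i \sum_(k < N)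
     (w ^+ k) ^+ b' i * (w ^+ k) ^- b i)).
    rewrite bigA_distr_bigA !mulr_sumr; apply: eq_bigr => l _; rewrite -mulrA; congr (_ * _).
    rewrite /rmono rmorph_prod /mono -!big_split; apply: eq_bigr => i _ /=.
    by rewrite !mxE !ffunE exprMn rmorphXn /= mulrA.
  have [i bi] : exists i, b' i != b i.
    by apply/existsP; apply: contraNT bb'; rewrite negb_exists => /forallP Hb;
      apply/eqP/ffunP => i; apply/eqP/negPn/Hb.
  by rewrite (bigD1 i) //= root_orth // (negbTE bi) !mul0r !mulr0.
have <- : cabs (c a * (rmono (fun=> s) a)%:C) = cabs (c a) * rmono (fun=> s) a.
  by rewrite cabsM cabs_ge0R // rmono_ge0 // => i; exact: ltW.
rewrite E cabsM cabsV cabsX cabs_nat mulrC ler_pdivrMr ?exprn_gt0 ?ltr0n //.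
apply: le_trans (cabs_sum _ _ _) _.
apply: le_trans (ler_sum (G := fun=> d) _ _) _; last first.
  by rewrite sumr_const card_ffun !card_ord -[leLHS]mulr_natr natrX.
move=> l _; rewrite cabsM cabs_prod (eq_bigr (fun=> 1)) => [|i _]; last first.
  by rewrite cabsV !cabsX (cabs_root pw) !expr1n invr1.
by rewrite prodr_const expr1n mulr1; apply: H => i; rewrite mxE cw.
Qed.

End Polydisc.

(** * Power series expansion on a polydisc *)

Section Expansion.
Variable (R : realType).
Local Notation C := R[i].
Local Notation Re := complex.Re.
Local Notation Im := complex.Im.

(** Every [v k - e k] lies below every [v m + e m]; the supremum of the former is the required
    value, with the error bound already attached. *)
Lemma sandwich_lim (v e : nat -> R) : (forall k m, `|v k - v m| <= e k + e m) ->
  exists l, forall k, `|v k - l| <= e k.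
Proof.
move=> H; pose T := [set v k - e k | k in setT].
have ub m : ubound T (v m + e m).
  by move=> _ [k _ <-]; have := H k m; rewrite ler_norml => /andP[_]; lra.
have hT : has_sup T by split; [exists (v 0 - e 0), 0|exists (v 0 + e 0)].
exists (sup T) => k; have h1 : v k - e k <= sup T.
  by apply: ub_le_sup; [exists (v 0 + e 0)|exists k].
have h2 : sup T <= v k + e k by apply: sup_le_ub; [case: hT|exact: ub].
by rewrite ler_norml; apply/andP; split; lra.
Qed.

Lemma csandwich_lim (u : nat -> C) (e : nat -> R) :
  (forall k m, cabs (u k - u m) <= e k + e m) ->
  exists l, forall k, cabs (u k - l) <= 2 * e k.
Proof.
move=> H.
have [a Ha] : exists a, forall k, `|Re (u k) - a| <= e k.
  by apply: sandwich_lim => k m; rewrite -ReB; apply: le_trans (Re_le_cabs _) _.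
have [b Hb] : exists b, forall k, `|Im (u k) - b| <= e k.
  by apply: sandwich_lim => k m; rewrite -ImB; apply: le_trans (Im_le_cabs _) _.
exists (a +i* b) => k; apply: le_trans (cabs_le_ReIm _) _.
by rewrite ReB ImB mulrDl !mul1r lerD.
Qed.

Variable n : nat.
Local Notation Cn := 'rV[R[i]]_n.
Variables (f : Cn -> C) (M rho q : R).
Hypothesis rho1 : 1 < rho.
Hypothesis Hd : forall (z : Cn) j (t : C), (forall i, cabs (z ord0 i) <= 1) ->
  cabs t < rho -> cdiff (fun t => f (upd z j t)) t.
Hypothesis HM : forall z : Cn, (forall i, cabs (z ord0 i) <= 1) -> cabs (f z) <= M.
Hypotheses (q0 : 0 < q) (q1 : q < 1).

(** Three radii are in play: the expansion is obtained on [q], approximating polynomials are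
    compared on [s], and their nodes lie on [r]. *)
Let s : R := q + (1 - q) / 3.
Let r : R := q + 2 * (1 - q) / 3.
Let qs : q < s. Proof. by rewrite /s ltrDl divr_gt0 // subr_gt0. Qed.
Let sr : s < r.
Proof. by rewrite /s /r ltrD2l ltr_pM2r ?invr_gt0 // ltr_pMl ?subr_gt0 // ltr1n. Qed.
Let r1 : r < 1.
Proof. by rewrite /r -ltrBrDl ltr_pdivrMr // mulrC ltr_pM2l ?subr_gt0 // ltr_nat. Qed.
Let s0 : 0 < s. Proof. exact: lt_trans qs. Qed.
Let r0 : 0 < r. Proof. exact: lt_trans sr. Qed.

(** Polynomials on growing boxes approximate [f] on radius [s] with geometric error [e k]. Two of
    them differ by at most [e k + e m] there, so their coefficients are close and converge; the
    series of the limits has sum [f] on radius [q]. *)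
Lemma polydisc_expansion : exists c : multi_index n -> C,
  forall z : Cn, (forall i, cabs (z ord0 i) <= q) ->
    has_sum (fun a => c a * mono z a) (f z).
Proof.
have /choice [w Hw] : forall k, exists w : C, k.+1.-primitive_root w.
  by move=> k; apply: prim_root_ex.
pose B := (1 - s / r)^-1.
pose K : R := n%:R * (B ^+ n * (2 * M * (1 - r)^-1 * (1 + B))).
pose e k : R := K * r ^+ k.+1.
have appr k (z : Cn) : (forall i, cabs (z ord0 i) <= s) ->
    cabs (f z - \sum_(a <- box k.+1) torus_coef f r k.+1 (w k) a * mono z a) <= e k.
  move=> Hz; rewrite -full_meanE.
  have := full_mean_approx rho1 Hd HM s0 sr r1 (Hw k) Hz.
  by rewrite /e /K; congr (_ <= _); rewrite -/B; ring.
pose cN k a := torus_coef f r k.+1 (w k) a.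
have padE k m (z : Cn) : (k <= m)%N -> \sum_(a <- box k.+1) cN k a * mono z a =
    \sum_(a <- box m.+1) (if a \in box k.+1 then cN k a else 0) * mono z a.
  move=> km; rewrite (sum_sub_seq _ (box_uniq k.+1) (box_uniq m.+1)); last exact: box_sub.
  rewrite [X in _ = _ + X]big1 ?addr0 => [|a /negbTE->]; last by rewrite mul0r.
  by rewrite big_seq [RHS]big_seq; apply: eq_bigr => a ->.
have close k m a : (k <= m)%N -> a \in box k.+1 ->
    cabs (cN k a - cN m a) * rmono (fun=> s) a <= e k + e m.
  move=> km ak; have am : a \in box m.+1 by exact: box_sub ak.
  have := @poly_coef_bound R n m.+1
    (fun a => (if a \in box k.+1 then cN k a else 0) - cN m a) s (e k + e m) isT s0.
  move=> /(_ _ a am); rewrite ak; apply => z Hz.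
  have -> : \sum_(a <- box m.+1) ((if a \in box k.+1 then cN k a else 0) - cN m a) * mono z a
    = (f z - \sum_(a <- box m.+1) cN m a * mono z a) -
      (f z - \sum_(a <- box k.+1) cN k a * mono z a).
    rewrite (padE _ _ _ km); under eq_bigr do rewrite mulrBl.
    by rewrite sumrB; ring.
  apply: le_trans (cabsB _ _) _; rewrite [leRHS]addrC lerD //; apply: appr => i; by rewrite Hz.
have rs0 (a : multi_index n) : 0 < rmono (fun=> s) a :> R by apply: prodr_gt0 => i _; rewrite exprn_gt0.
have /choice [c Hc] : forall a : multi_index n, exists l : C, forall k, a \in box k.+1 ->
    cabs (cN k a - l) * rmono (fun=> s) a <= 2 * e k.
  move=> a; have [k0 ak0] : exists k0, a \in box k0.+1.
    have [k0 Hk] := seq_in_box [:: a]; exists k0; apply: (box_sub (leqnSn _)).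
    by apply: Hk; rewrite inE.
  (* The index [a] has a coefficient only from some box on; the earlier entries are filled with the
     one at [k0], so that [csandwich_lim] applies to a full sequence. *)
  pose u k := if a \in box k.+1 then cN k a else cN k0 a.
  pose eu k := (if a \in box k.+1 then e k else e k0) / rmono (fun=> s) a.
  have Hu k m : cabs (u k - u m) <= eu k + eu m.
    rewrite /u /eu -mulrDl ler_pdivlMr //.
    have cl k' m' : a \in box k'.+1 -> a \in box m'.+1 ->
        cabs (cN k' a - cN m' a) * rmono (fun=> s) a <= e k' + e m'.
      move=> ak am; have [km|mk] := leqP k' m'; first exact: close.
      by rewrite cabsBC [leRHS]addrC; apply: close => //; exact: ltnW.
    by case: ifP => ak; case: ifP => am; apply: cl.
  have [l Hl] := csandwich_lim Hu.
  exists l => k ak; have := Hl k; rewrite /u /eu ak mulrA.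
  by rewrite ler_pdivlMr.
have e_small d : 0 < d -> exists k0, forall k, (k0 <= k)%N -> e k < d.
  move=> d0; have [k0 Hk] := geo_small K (ltW r0) r1 d0; exists k0 => k k0k.
  by apply: Hk; exact: leqW.
have rr0 (a : multi_index n) : 0 < rmono (fun=> r) a :> R by apply: prodr_gt0 => i _; rewrite exprn_gt0.
(* The bound on radius [r] passes to the limit. As q < r, it provides the geometric majorant for
   absolute convergence. *)
have cb a : cabs (c a) * rmono (fun=> r) a <= M.
  apply/ler_addgt0Pr => d d0; pose t := rmono (fun=> r) a / rmono (fun=> s) a.
  have t0 : 0 < t by rewrite divr_gt0.
  have [k0 Hk0] := e_small (d / (2 * t)) ltac:(by rewrite divr_gt0 // mulr_gt0).
  have [k1 Hk1] := seq_in_box [:: a].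
  have ak : a \in box (maxn k0 k1).+1.
    by apply: (@box_sub n k1); [exact: leqW (leq_maxr _ _)|apply: Hk1; rewrite inE].
  have h1 := Hc a _ ak; have h2 := Hk0 _ (leq_maxl k0 k1).
  have h3 : cabs (cN (maxn k0 k1) a) * rmono (fun=> r) a <= M.
    exact: (torus_coef_bound HM s0 sr r1 (Hw _)).
  apply: (@le_trans _ _ ((cabs (cN (maxn k0 k1) a) + cabs (cN (maxn k0 k1) a - c a)) * rmono (fun=> r) a)).
    have hh := cabs_le_dist (c a) (cN (maxn k0 k1) a); rewrite cabsBC in hh.
    exact: (ler_wpM2r (ltW (rr0 a)) hh).
  rewrite mulrDl; apply: lerD => //.
  have -> : cabs (cN (maxn k0 k1) a - c a) * rmono (fun=> r) a =
     cabs (cN (maxn k0 k1) a - c a) * rmono (fun=> s) a * t.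
    by rewrite /t; field; rewrite gt_eqF.
  apply: (@le_trans _ _ (2 * e (maxn k0 k1) * t)); first by rewrite ler_wpM2r // ltW.
  have tt : 0 < 2 * t by rewrite mulr_gt0.
  have h4 := ltW h2; rewrite ler_pdivlMr // in h4.
  by rewrite -mulrA mulrCA.
exists c => z Hz.
have M0 : 0 <= M.
  by apply: le_trans (HM (z := 0) _) => [|i]; rewrite ?cabs_ge0 // mxE cabs0.
have qn : 0 <= q by exact: ltW.
have mz a : cabs (mono z a) <= rmono (fun=> q) a.
  by rewrite cabs_mono; apply: ler_rmono => i; rewrite cabs_ge0 Hz.
split.
  exists (M * \prod_(i < n) (1 - q / r)^-1) => N.
  apply: (@le_trans _ _ (\sum_(a <- box N) M * rmono (fun=> q / r) a)).
    apply: ler_sum => a _; rewrite cabsM rmonoM mulrA.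
    have -> : rmono (fun=> r^-1) a = (rmono (fun=> r) a)^-1 :> R.
      by rewrite /rmono -prodfV; apply: eq_bigr => i _; rewrite exprVn.
    rewrite ler_pdivlMr // mulrAC; apply: ler_pM; rewrite ?cabs_ge0 ?mulr_ge0 ?cabs_ge0 //.
    exact: ltW.
  rewrite -mulr_sumr ler_wpM2l //; apply: sum_box_geo => i.
  by rewrite divr_ge0 ?(ltW r0) //= ltr_pdivrMr // mul1r (lt_trans qs).
move=> d d0.
pose G : R := \prod_(i < n) (1 - q / s)^-1.
have G0 : 0 <= G.
  by apply: prodr_ge0 => i _; rewrite invr_ge0 subr_ge0 ler_pdivrMr // mul1r ltW.
have G1 : 0 < 1 + 2 * G by rewrite ltr_pwDl // mulr_ge0.
have [k0 Hk0] := e_small (d / (1 + 2 * G)) ltac:(by rewrite divr_gt0).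
exists k0.+1 => -[//|N]; rewrite ltnS => k0N; have {}Hk0 := Hk0 _ k0N.
have Hzs i : cabs (z ord0 i) <= s by apply: le_trans (Hz i) (ltW qs).
have -> : \sum_(a <- box N.+1) c a * mono z a - f z =
   - \sum_(a <- box N.+1) (cN N a - c a) * mono z a
   - (f z - \sum_(a <- box N.+1) cN N a * mono z a).
  under [in RHS]eq_bigr do rewrite mulrBl.
  by rewrite sumrB; ring.
apply: le_lt_trans (cabsB _ _) _; rewrite cabsN.
apply: (@le_lt_trans _ _ (2 * e N * G + e N)); last first.
  by rewrite ltr_pdivlMr // in Hk0; apply: le_lt_trans Hk0; rewrite mulrDr; lra.
apply: lerD; last exact: appr.
apply: le_trans (cabs_sum _ _ _) _.
apply: (@le_trans _ _ (\sum_(a <- box N.+1) 2 * e N * rmono (fun=> q / s) a)).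
  rewrite big_seq [leRHS]big_seq; apply: ler_sum => a aN; rewrite cabsM rmonoM mulrA.
  have -> : rmono (fun=> s^-1) a = (rmono (fun=> s) a)^-1 :> R.
    by rewrite /rmono -prodfV; apply: eq_bigr => i _; rewrite exprVn.
  rewrite ler_pdivlMr // mulrAC; apply: ler_pM; rewrite ?cabs_ge0 ?mulr_ge0 ?cabs_ge0 //.
    exact: ltW.
  exact: Hc.
have eN0 : 0 <= 2 * e N.
  have : 0 <= e N by apply: le_trans (appr N z Hzs); exact: cabs_ge0.
  lra.
rewrite -mulr_sumr ler_wpM2l //; apply: sum_box_geo => i.
by rewrite divr_ge0 ?(ltW s0) //= ltr_pdivrMr // mul1r.
Qed.

End Expansion.

(** * Comparison of box sums with [esum], [summable] and [csum] *)

Section AbsoluteSums.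
Variables (R : realType) (n : nat).
Local Notation C := R[i].
Local Notation Re := complex.Re.
Local Notation Im := complex.Im.
Implicit Types (u : multi_index n -> C) (v : multi_index n -> R).

Lemma esum_box_le v M : (forall a, 0 <= v a) -> (forall N, \sum_(a <- box N) v a <= M) ->
  (\esum_(a in setT) (v a)%:E <= M%:E)%E.
Proof.
move=> v0 H; apply: ge_ereal_sup => _ [X [fX _] <-].
rewrite fsbig_finite //= sumEFin lee_fin.
have [N HN] := seq_in_box (finmap.enum_fset (fset_set X)).
apply: le_trans (H N); apply: sum_sub_le => //; [exact: finmap.fset_uniq|exact: box_uniq].
Qed.

Lemma box_le_esum v N : (forall a, 0 <= v a) ->
  ((\sum_(a <- box N) v a)%:E <= \esum_(a in setT) (v a)%:E)%E.
Proof.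
move=> v0; apply: ereal_sup_ubound; exists [set` box N].
  by split=> //; exact: finite_seq.
by rewrite -fsbig_seq ?box_uniq // sumEFin.
Qed.

Lemma esum_box v M : (forall a, 0 <= v a) -> (forall N, \sum_(a <- box N) v a <= M) ->
  let s := fine (\esum_(a in setT) (v a)%:E) in
  (forall N, \sum_(a <- box N) v a <= s) /\
  forall e, 0 < e -> exists N0, forall N, (N0 <= N)%N -> s - e < \sum_(a <- box N) v a.
Proof.
move=> v0 H s; have fs : (\esum_(a in setT) (v a)%:E)%E \is a fin_num.
  rewrite fin_numE; apply/andP; split.
    rewrite gt_eqF // (lt_le_trans (ltNyr 0)) //; apply: esum_ge0 => a _.
    by rewrite lee_fin.
  by rewrite lt_eqF // (le_lt_trans (esum_box_le v0 H)) // ltry.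
have lts N : \sum_(a <- box N) v a <= s by rewrite -lee_fin fineK // box_le_esum.
split=> // e e0; apply: contrapT => /forallNP nH.
have {}nH N : \sum_(a <- box N) v a <= s - e.
  have /existsNP [N' /not_implyP [NN' /negP]] := nH N; rewrite -leNgt; apply: le_trans.
  by apply: sum_sub_le; [ |exact: box_uniq|exact: box_uniq|exact: box_sub].
have := esum_box_le v0 nH; rewrite -(fineK fs) lee_fin -/s; lra.
Qed.

Definition box_bounded u := exists M : R, forall N, \sum_(a <- box N) cabs (u a) <= M.

Lemma summable_box u : summable setT (fun a => (cabs (u a))%:E) <-> box_bounded u.
Proof.
have E : (\esum_(a in [set: multi_index n]) `|(cabs (u a))%:E| =
   \esum_(a in [set: multi_index n]) (cabs (u a))%:E)%E.
  by apply: eq_esum => a _ /=; rewrite ger0_norm ?cabs_ge0.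
rewrite /summable E; split=> [H|[M HM]]; last first.
  by apply: le_lt_trans (esum_box_le _ HM) _; [move=> a; exact: cabs_ge0|exact: ltry].
exists (fine (\esum_(a in [set: multi_index n]) (cabs (u a))%:E)) => N.
rewrite -lee_fin fineK; first by apply: box_le_esum => a; exact: cabs_ge0.
by rewrite ge0_fin_numE // esum_ge0 // => a _; rewrite lee_fin cabs_ge0.
Qed.

(** Positive and negative parts have bounded box sums, so both infinite sums in [rsum] are finite
    and [fine] does not fall back on its default. *)
Lemma rsum_box (v : multi_index n -> R) (M : R) : (forall N, \sum_(a <- box N) `|v a| <= M) ->
  forall e, 0 < e -> exists N0, forall N, (N0 <= N)%N ->
  `|\sum_(a <- box N) v a - rsum v| < e.
Proof.
move=> HM e e0.
have pb (w : multi_index n -> R) : (forall a, w a <= `|v a|) ->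
    forall N, \sum_(a <- box N) w a <= M.
  by move=> H N; apply: le_trans (HM N); exact: ler_sum.
have p0 a : 0 <= Num.max (v a) 0 by rewrite le_max lexx orbT.
have n0 a : 0 <= Num.max (- v a) 0 by rewrite le_max lexx orbT.
have pv a : Num.max (v a) 0 <= `|v a| by rewrite ge_max ler_norm normr_ge0.
have nv a : Num.max (- v a) 0 <= `|v a| by rewrite ge_max -normrN ler_norm normr_ge0.
have [pl pe] := esum_box p0 (pb _ pv); have [nl ne] := esum_box n0 (pb _ nv).
have [N1 H1] := pe _ e0; have [N2 H2] := ne _ e0.
exists (maxn N1 N2) => N; rewrite geq_max => /andP[/H1 h1 /H2 h2].
have := pl N; have := nl N; rewrite /rsum.
have -> : \sum_(a <- box N) v a = \sum_(a <- box N) Num.max (v a) 0 - \sum_(a <- box N) Num.max (- v a) 0.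
  rewrite -sumrB; apply: eq_bigr => a _.
  have [va|va] := leP 0 (v a).
    by rewrite max_r ?oppr_le0 // subr0.
  by rewrite max_l ?oppr_ge0 ?(ltW va) // opprK add0r.
move=> h3 h4; rewrite ltr_norml; apply/andP; split; lra.
Qed.

Lemma has_sum_csum u : box_bounded u -> has_sum u (csum u).
Proof.
move=> [M HM]; split; first by exists M.
move=> e e0; have e2 : 0 < e / 2 by rewrite divr_gt0.
have [|N1 H1] := @rsum_box (fun a => Re (u a)) M _ _ e2.
  by move=> N; apply: le_trans (HM N); apply: ler_sum => a _; exact: Re_le_cabs.
have [|N2 H2] := @rsum_box (fun a => Im (u a)) M _ _ e2.
  by move=> N; apply: le_trans (HM N); apply: ler_sum => a _; exact: Im_le_cabs.
exists (maxn N1 N2) => N; rewrite geq_max => /andP[/H1 h1 /H2 h2].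
apply: le_lt_trans (cabs_le_ReIm _) _; rewrite ReB ImB Re_sum Im_sum /csum /=.
by rewrite (splitr e) ltrD.
Qed.

Lemma csum_has_sum u S : has_sum u S -> csum u = S.
Proof. by move=> H; apply: (has_sum_unique _ H); apply: has_sum_csum; case: H. Qed.

Lemma has_sum_bound u S (K : R) : has_sum u S ->
  (forall N, cabs (\sum_(a <- box N) u a) <= K) -> cabs S <= K.
Proof.
move=> [_ H] HK; apply/ler_addgt0Pr => e /H [N HN].
apply: le_trans (cabs_le_dist S (\sum_(a <- box N) u a)) _.
by apply: lerD => //; rewrite cabsBC; apply/ltW/HN.
Qed.

End AbsoluteSums.

(** * Frechet derivatives in coordinates *)

Lemma differentiable_near (K : numFieldType) (V W : normedModType K) (f : V -> W)
    (L : {linear V -> W}) (x : V) : continuous L ->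
  (forall e, 0 < e -> \forall h \near (0 : V), `|f (h + x) - f x - L h| <= e * `|h|) ->
  differentiable f x /\ 'd f x = L :> (V -> W).
Proof.
move=> cL H; have E : f \o shift x = cst (f x) + L +o_ 0 id.
  apply/eqaddoP => e /H He; near=> h.
  rewrite -[X in `|X|]/(f (h + x) - (f x + L h)) opprD addrA; near: h; exact: He.
have Ed : 'd f x = L :> (V -> W) by exact: diff_unique E.
by split=> //; apply/diff_locallyP; rewrite Ed.
Unshelve. all: by end_near. Qed.

Section Coordinates.
Variables (R : realType) (n : nat).
Local Notation C := R[i].
Local Notation Cn := 'rV[R[i]]_n.

Lemma norm_realc (V : normedModType C) (h : V) : `|h| = (complex.Re `|h|)%:C.
Proof. by rewrite RRe_real // ger0_real. Qed.

Lemma nbhs_coordP (z : Cn) (A : set Cn) : nbhs z A <->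
  exists2 dl : R, 0 < dl &
    forall w : Cn, (forall i, cabs (w ord0 i - z ord0 i) < dl) -> A w.
Proof.
split=> [/nbhs_ballP [e /= /gt0_realc [d d0 ->] H]|[d d0 H]].
  exists d => // w Hw; apply: H; split=> [|i j]; rewrite ?ltcR // (ord1 i) -ball_normE /=.
  by rewrite distrC normC_cabs ltcR.
apply/nbhs_ballP; exists d%:C; first by rewrite /= ltcR.
move=> w [_ Hw]; apply: H => i; have := Hw ord0 i; rewrite -ball_normE /=.
by rewrite distrC normC_cabs ltcR.
Qed.

Lemma cabs_le_norm (h : Cn) i : cabs (h ord0 i) <= complex.Re `|h|.
Proof.
apply/ler_addgt0Pr => e e0.
have : ball (0 : Cn) (complex.Re `|h| + e)%:C h.
  by rewrite mx_norm_ball /ball_ /= sub0r normrN [ltLHS]norm_realc ltcR ltrDl.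
by move=> [_ /(_ ord0 i)]; rewrite -ball_normE /= mxE sub0r normrN normC_cabs ltcR => /ltW.
Qed.

Definition coord_open (D : set Cn) : Prop := forall z, D z ->
  exists2 dl : R, 0 < dl &
    forall w : Cn, (forall i, cabs (w ord0 i - z ord0 i) < dl) -> D w.

(** These are the complete Reinhardt domains. Two occur: the ball, and a polydisc around 0 on which
    an expansion is first found. *)
Definition reinhardt (D : set Cn) : Prop := forall z w : Cn, D z ->
  (forall i, cabs (w ord0 i) <= cabs (z ord0 i)) -> D w.

Definition PS (D : set Cn) (f : Cn -> C) (c : multi_index n -> C) : Prop :=
  forall z, D z -> has_sum (fun a => c a * mono z a) (f z).

Lemma reinhardt_room D z : coord_open D -> reinhardt D -> D z ->
  exists2 dl : R, 0 < dl & D (\row_i (cabs (z ord0 i) + dl)%:C).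
Proof.
move=> oD rD Dz; pose x : Cn := \row_i (cabs (z ord0 i))%:C.
have Dx : D x by apply: rD Dz _ => i; rewrite mxE cabs_ge0R // cabs_ge0.
have [d d0 Hd] := oD _ Dx; exists (d / 2); first by rewrite divr_gt0.
apply: Hd => i; rewrite !mxE -rmorphB addrAC subrr add0r /= cabs_ge0R ?divr_ge0 ?ltW //.
lra.
Qed.

Definition lform (g : 'I_n -> C) (h : Cn) : C := \sum_j h ord0 j * g j.

Lemma lform_linear g : linear (lform g).
Proof.
move=> k u v; rewrite /lform /GRing.scale /= mulr_sumr -big_split; apply: eq_bigr => i _ /=.
by rewrite !mxE mulrDl mulrA.
Qed.

HB.instance Definition _ g := GRing.isLinear.Build C Cn C *:%R (lform g) (@lform_linear g).

Lemma lform_bound g h : cabs (lform g h) <= (\sum_j cabs (g j)) * complex.Re `|h|.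
Proof.
apply: le_trans (cabs_sum _ _ _) _; rewrite mulr_suml; apply: ler_sum => j _.
by rewrite cabsM mulrC ler_wpM2l ?cabs_ge0 // cabs_le_norm.
Qed.

Lemma lform_continuous g : continuous (lform g).
Proof.
apply: bounded_linear_continuous.
apply/ex_bound; exists (\sum_j cabs (g j))%:C.
apply/nbhs_ballP; exists 1 => //= h; rewrite mx_norm_ball /ball_ /= sub0r normrN.
rewrite norm_realc -(rmorph1 (real_complex R)) ltcR => h1.
rewrite normC_cabs lecR; apply: le_trans (lform_bound _ _) _.
by rewrite ler_piMr ?(ltW h1) // sumr_ge0 // => j _; exact: cabs_ge0.
Qed.

Lemma differentiable_eps (f : Cn -> C) (z : Cn) (g : 'I_n -> C) :
  (forall e : R, 0 < e -> exists2 dl : R, 0 < dl & forall h : Cn, complex.Re `|h| < dl ->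
     cabs (f (z + h) - f z - lform g h) <= e * complex.Re `|h|) ->
  differentiable f z /\ forall j, 'D_(delta_mx ord0 j) f z = g j.
Proof.
move=> H.
have [|df Ed] := @differentiable_near C Cn C f (lform g) z (@lform_continuous g).
  move=> e /gt0_realc [d d0 ->].
  have [dl dl0 Hdl] := H _ d0; apply/nbhs_ballP; exists dl%:C; first by rewrite /= ltcR.
  move=> h; rewrite mx_norm_ball /ball_ /= sub0r normrN norm_realc ltcR => /Hdl Hh.
  by rewrite [`|h|]norm_realc normC_cabs -rmorphM lecR /= [h + z]addrC.
split=> // j; rewrite deriveE // Ed -[LHS]/(\sum_i (delta_mx ord0 j : Cn) ord0 i * g i) (bigD1 j) //= mxE !eqxx mul1r.
by rewrite big1 ?addr0 // => i ij; rewrite mxE (negbTE ij) andbF mul0r.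
Qed.

End Coordinates.

(** * First-order expansions of products with explicit remainders *)

Section Jets.
Variables (R : realType).
Local Notation C := R[i].
Variable t : R.
Hypotheses (t0 : 0 <= t) (t1 : t <= 1).

(* [u = u0 + u1 + O(t^2)] with all constants absorbed in the majorant [b]. *)
Definition jet (u u0 u1 : C) (b : R) : Prop := exists p r : R,
  [/\ 0 <= p, 0 <= r, cabs u1 <= t * p, cabs (u - u0 - u1) <= t ^+ 2 * r
    & cabs u0 + p + r <= b].

(** The six cross terms of second order or higher are those of the product of the majorants;
    [t <= 1] absorbs the cubes and fourth powers of [t] into the square. *)
Lemma jet_mul u u0 u1 b v v0 v1 c : jet u u0 u1 b -> jet v v0 v1 c ->
  jet (u * v) (u0 * v0) (u0 * v1 + u1 * v0) (b * c).
Proof.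
move=> [p [r [p0 r0 H1 H2 H3]]] [p' [r' [p'0 r'0 H1' H2' H3']]].
set x := cabs u0 in H3; set x' := cabs v0 in H3'.
have x0 : 0 <= x by exact: cabs_ge0. have x'0 : 0 <= x' by exact: cabs_ge0.
exists (x * p' + p * x'), (p * p' + x * r' + p * r' + r * x' + r * p' + r * r').
have tt : t ^+ 2 <= t by rewrite expr2 ler_piMl.
have tt1 : t ^+ 2 <= 1 by exact: le_trans tt t1.
have tt0 : 0 <= t ^+ 2 by rewrite exprn_ge0.
split.
- by rewrite addr_ge0 ?mulr_ge0.
- by rewrite !addr_ge0 ?mulr_ge0.
- apply: le_trans (cabsD _ _) _; rewrite !cabsM mulrDr; apply: lerD.
    by rewrite mulrCA ler_wpM2l.
  by rewrite mulrA ler_wpM2r.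
- have -> : u * v - u0 * v0 - (u0 * v1 + u1 * v0) =
    u1 * v1 + u0 * (v - v0 - v1) + u1 * (v - v0 - v1) + (u - u0 - u1) * v0
    + (u - u0 - u1) * v1 + (u - u0 - u1) * (v - v0 - v1) by ring.
  have sum6 (x1 x2 x3 x4 x5 x6 : C) : cabs (x1 + x2 + x3 + x4 + x5 + x6) <=
      cabs x1 + cabs x2 + cabs x3 + cabs x4 + cabs x5 + cabs x6.
    do 4 (apply: le_trans (cabsD _ _) _; rewrite lerD2r); exact: cabsD.
  apply: le_trans (sum6 _ _ _ _ _ _) _; rewrite !cabsM !mulrDr.
  have h1 : cabs u1 * cabs v1 <= t ^+ 2 * (p * p').
    apply: le_trans (ler_pM (cabs_ge0 _) (cabs_ge0 _) H1 H1') _.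
    by rewrite le_eqVlt; apply/orP; left; apply/eqP; ring.
  have h2 : cabs u0 * cabs (v - v0 - v1) <= t ^+ 2 * (x * r') by rewrite mulrCA ler_wpM2l.
  have h3 : cabs u1 * cabs (v - v0 - v1) <= t ^+ 2 * (p * r').
    apply: le_trans (ler_pM (cabs_ge0 _) (cabs_ge0 _) H1 H2') _.
    have -> : t * p * (t ^+ 2 * r') = t ^+ 2 * t * (p * r') by ring.
    by rewrite ler_wpM2r ?mulr_ge0 // ler_piMr.
  have h4 : cabs (u - u0 - u1) * cabs v0 <= t ^+ 2 * (r * x') by rewrite mulrA ler_wpM2r.
  have h5 : cabs (u - u0 - u1) * cabs v1 <= t ^+ 2 * (r * p').
    apply: le_trans (ler_pM (cabs_ge0 _) (cabs_ge0 _) H2 H1') _.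
    have -> : t ^+ 2 * r * (t * p') = t ^+ 2 * t * (r * p') by ring.
    by rewrite ler_wpM2r ?mulr_ge0 // ler_piMr.
  have h6 : cabs (u - u0 - u1) * cabs (v - v0 - v1) <= t ^+ 2 * (r * r').
    apply: le_trans (ler_pM (cabs_ge0 _) (cabs_ge0 _) H2 H2') _.
    have -> : t ^+ 2 * r * (t ^+ 2 * r') = t ^+ 2 * t ^+ 2 * (r * r') by ring.
    by rewrite ler_wpM2r ?mulr_ge0 // ler_piMr.
  by rewrite !lerD.
- rewrite cabsM; apply: (@le_trans _ _ ((x + p + r) * (x' + p' + r'))).
    by rewrite le_eqVlt; apply/orP; left; apply/eqP; rewrite /x /x'; ring.
  by apply: ler_pM => //; rewrite !addr_ge0.
Qed.

Lemma jet1 : jet 1 1 0 1.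
Proof.
exists 0, 0; split => //; first by rewrite cabs0 mulr0.
  by rewrite subrr subr0 cabs0 mulr0.
by rewrite cabs1 !addr0.
Qed.

Lemma jet_expr (z h : C) (d : R) k : 0 <= d -> cabs h <= t * d ->
  jet ((z + h) ^+ k) (z ^+ k) (k%:R * z ^+ k.-1 * h) ((cabs z + d) ^+ k).
Proof.
move=> d0 hd; have j1 : jet (z + h) z h (cabs z + d).
  exists d, 0; split => //.
    by rewrite (_ : z + h - z - h = 0) ?cabs0 ?mulr0 //; ring.
  by rewrite addr0.
elim: k => [|k IH]; first by rewrite !mul0r; exact: jet1.
have := jet_mul j1 IH; rewrite -!exprS; congr jet; case: k {IH} => [|k] /=.
  by ring.
rewrite -(natr1 k.+1) exprS; ring.
Qed.

Lemma jet_prod (I : eqType) (r : seq I) (u u0 u1 : I -> C) (b : I -> R) : uniq r ->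
  (forall i, jet (u i) (u0 i) (u1 i) (b i)) ->
  jet (\prod_(i <- r) u i) (\prod_(i <- r) u0 i)
    (\sum_(j <- r) u1 j * \prod_(i <- r | i != j) u0 i) (\prod_(i <- r) b i).
Proof.
move=> + H; elim: r => [_|x r IH] /=; first by rewrite !big_nil; exact: jet1.
move=> /andP[xr ur]; have := jet_mul (H x) (IH ur); rewrite !big_cons eqxx /=.
congr jet; rewrite addrC; congr (_ * _ + _).
  rewrite big_seq [RHS]big_seq_cond; apply: eq_big => [i|//].
  by case ir : (i \in r) => //=; apply/esym; apply: contraNneq xr => <-.
rewrite mulr_sumr; apply: eq_big_seq => j jr.
rewrite big_cons ifT; last by apply: contraNneq xr => ->.
by rewrite mulrCA.
Qed.

End Jets.

(** * Termwise differentiation and uniqueness of power series *)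

Section PowerSeries.
Variables (R : realType) (n : nat).
Local Notation C := R[i].
Local Notation Cn := 'rV[R[i]]_n.
Implicit Types (c : multi_index n -> C) (a : multi_index n).

(** The partial derivative of [mono]. At [a j = 0] the predecessor is 0, but the factor [(a j)%:R]
    vanishes. *)
Definition dmono (z : Cn) (j : 'I_n) a : C :=
  (a j)%:R * z ord0 j ^+ (a j).-1 * \prod_(i | i != j) z ord0 i ^+ a i.

Definition shift_mi (j : 'I_n) a : multi_index n := [ffun i => a i + (i == j)]%N.

Definition dcoef c (j : 'I_n) a : C := (a j).+1%:R * c (shift_mi j a).

Lemma shift_mi_inj j : injective (shift_mi j).
Proof.
by move=> a b /ffunP E; apply/ffunP => i; have := E i; rewrite !ffunE => /addIn.
Qed.

Lemma dmono_shift z j a : dmono z j (shift_mi j a) = (a j).+1%:R * mono z a.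
Proof.
rewrite /dmono /mono ffunE eqxx addn1 /= -mulrA; congr (_ * _).
rewrite [RHS](bigD1 j) //=; congr (_ * _); apply: eq_bigr => i ij.
by rewrite ffunE (negbTE ij) addn0.
Qed.

Lemma dmono_out z j a : (forall b, shift_mi j b != a) -> dmono z j a = 0.
Proof.
move=> H; case aj : (a j) => [|k]; first by rewrite /dmono aj !mul0r.
have := H [ffun i => a i - (i == j)]%N; case/negP; apply/eqP/ffunP => i.
by rewrite !ffunE; case: eqP => [->|_]; rewrite ?aj ?subn1 ?addn1 //= subn0 addn0.
Qed.

(** The majorant is the monomial at the moduli enlarged by [d], so a single convergent series
    dominates the values, the derivatives and the remainders. *)
Lemma mono_jet (t d : R) (z h : Cn) a : 0 <= t -> t <= 1 -> 0 <= d ->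
  (forall i, cabs (h ord0 i) <= t * d) ->
  jet t (mono (z + h) a) (mono z a) (\sum_j h ord0 j * dmono z j a)
    (rmono (fun i => cabs (z ord0 i) + d) a).
Proof.
move=> t0 t1 d0 Hh.
have := @jet_prod R t t0 t1 _ (index_enum 'I_n) (fun i => (z + h) ord0 i ^+ a i)
  (fun i => z ord0 i ^+ a i) (fun i => (a i)%:R * z ord0 i ^+ (a i).-1 * h ord0 i)
  (fun i => (cabs (z ord0 i) + d) ^+ a i) (index_enum_uniq _).
have E : \sum_j (a j)%:R * z ord0 j ^+ (a j).-1 * h ord0 j * \prod_(i | i != j) z ord0 i ^+ a i
   = \sum_j h ord0 j * dmono z j a.
  by apply: eq_bigr => j _; rewrite /dmono; ring.
rewrite E; apply => i; rewrite mxE; exact: jet_expr.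
Qed.

(** The linear part of [mono_jet] for the increment [d] in coordinate [j], taken at t = 1. *)
Lemma dmono_bound (d : R) (z : Cn) j a : 0 < d ->
  cabs (dmono z j a) <= d^-1 * rmono (fun i => cabs (z ord0 i) + d) a.
Proof.
move=> d0; pose h : Cn := \row_i (if i == j then d%:C else 0).
have Hh i : cabs (h ord0 i) <= 1 * d.
  by rewrite mxE mul1r; case: ifP => _; rewrite ?cabs0 ?cabs_ge0R // ltW.
have [p [r [p0 r0 H1 _ H2]]] := mono_jet z a ler01 (lexx 1) (ltW d0) Hh.
have E : \sum_j h ord0 j * dmono z j a = d%:C * dmono z j a.
  rewrite (bigD1 j) //= mxE eqxx big1 ?addr0 // => i ij.
  by rewrite mxE (negbTE ij) mul0r.
rewrite E cabsM cabs_ge0R ?(ltW d0) // mul1r in H1.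
rewrite ler_pdivlMl //; apply: le_trans H1 (le_trans _ H2).
by have := cabs_ge0 (mono z a); lra.
Qed.

Lemma mono0 a : mono (0 : Cn) a = (a == [ffun=> 0%N])%:R.
Proof.
have [->|na] := eqVneq; first by rewrite /mono big1 // => i _; rewrite ffunE expr0.
have [i ai] : exists i, a i != 0%N.
  apply/existsP; apply: contraNT na; rewrite negb_exists => /forallP H.
  by apply/eqP/ffunP => i; rewrite ffunE; apply/eqP/negPn/H.
by rewrite /mono (bigD1 i) //= mxE expr0n (negbTE ai) mul0r.
Qed.

Lemma has_sum_single (u : multi_index n -> C) a0 : (forall a, a != a0 -> u a = 0) ->
  has_sum u (u a0).
Proof.
move=> H; have := @has_sum_fin R n [:: a0] u isT; rewrite big_seq1; apply => a.
by rewrite inE => /H.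
Qed.

Lemma PS_at0 D f c : D (0 : Cn) -> PS D f c -> f 0 = c [ffun=> 0%N].
Proof.
move=> D0 /(_ _ D0) H; apply: (has_sum_unique H).
have E : c [ffun=> 0%N] = c [ffun=> 0%N] * mono (0 : Cn) [ffun=> 0%N].
  by rewrite mono0 eqxx mulr1.
rewrite E; apply: (@has_sum_single (fun a => c a * mono (0 : Cn) a)) => a na.
by rewrite mono0 (negbTE na) mulr0.
Qed.

Section Fixed.
Variable D : set Cn.
Hypotheses (oD : coord_open D) (rD : reinhardt D).

Lemma PS_bounded f c (x : 'I_n -> R) : PS D f c -> (forall i, 0 <= x i) ->
  D (\row_i (x i)%:C) -> exists M, forall N, \sum_(a <- box N) cabs (c a) * rmono x a <= M.
Proof.
move=> H x0 /H [[M HM] _]; exists M => N; apply: le_trans (HM N); apply: ler_sum => a _.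
rewrite cabsM cabs_mono ler_wpM2l ?cabs_ge0 //; apply: ler_rmono => i.
by rewrite mxE cabs_ge0R // x0 lexx.
Qed.

(** There is room to enlarge all moduli by [d] inside [D], and the series of absolute values at that
    point bounds every remainder: an increment with coordinates at most [t * d] leaves an error of
    at most [t ^+ 2 * M]. *)
Lemma PS_derive f c : PS D f c -> forall z, D z ->
  differentiable f z /\
  forall j, has_sum (fun a => dcoef c j a * mono z a) ('D_(delta_mx ord0 j) f z).
Proof.
move=> H z Dz; have [d d0 Dd] := reinhardt_room oD rD Dz.
have [|M HM] := PS_bounded H _ Dd.
  by move=> i; rewrite addr_ge0 ?cabs_ge0 // ltW.
have M0 : 0 <= M.
  apply: le_trans (HM 0%N); apply: sumr_ge0 => a _.
  by rewrite mulr_ge0 ?cabs_ge0 // rmono_ge0 // => i; rewrite addr_ge0 ?cabs_ge0 // ltW.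
pose g j := csum (fun a => c a * dmono z j a).
have Hg j : has_sum (fun a => c a * dmono z j a) (g j).
  apply: has_sum_csum; exists (d^-1 * M) => N.
  apply: le_trans (ler_wpM2l _ (HM N)); last by rewrite invr_ge0 ltW.
  rewrite mulr_sumr; apply: ler_sum => a _; rewrite cabsM mulrCA ler_wpM2l ?cabs_ge0 //.
  exact: dmono_bound.
have est (h : Cn) (t : R) : 0 <= t -> t <= 1 -> (forall i, cabs (h ord0 i) <= t * d) ->
    cabs (f (z + h) - f z - lform g h) <= t ^+ 2 * M.
  move=> t0 t1 Hh; have Dzh : D (z + h).
    apply: rD Dd _ => i; rewrite !mxE cabs_ge0R; last by rewrite addr_ge0 ?cabs_ge0 // ltW.
    apply: le_trans (cabsD _ _) _; rewrite lerD2l; apply: le_trans (Hh i) _.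
    by rewrite ler_piMl // ltW.
  have Hl : has_sum (fun a => \sum_j h ord0 j * (c a * dmono z j a)) (lform g h).
    by apply: has_sum_seq => j; exact: has_sumZ.
  have := has_sumD (has_sumD (H _ Dzh) (has_sumZ (-1) (H _ Dz))) (has_sumZ (-1) Hl).
  rewrite !mulN1r => /has_sum_bound; apply => N.
  apply: le_trans (cabs_sum _ _ _) _.
  apply: le_trans (ler_wpM2l (exprn_ge0 2 t0) (HM N)); rewrite mulr_sumr.
  apply: ler_sum => a _.
  have [p [r [p0 r0 _ H1 H2]]] := mono_jet z a t0 t1 (ltW d0) Hh.
  have -> : c a * mono (z + h) a + -1 * (c a * mono z a) +
     -1 * (\sum_j h ord0 j * (c a * dmono z j a)) =
     c a * (mono (z + h) a - mono z a - \sum_j h ord0 j * dmono z j a).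
    rewrite (eq_bigr (fun j => c a * (h ord0 j * dmono z j a))); last by move=> j _; rewrite mulrCA.
    by rewrite -mulr_sumr; ring.
  rewrite cabsM mulrCA ler_wpM2l ?cabs_ge0 //; apply: le_trans H1 _.
  rewrite ler_wpM2l ?exprn_ge0 //; apply: le_trans H2.
  by have := cabs_ge0 (mono z a); lra.
have [|df Dj] := @differentiable_eps R n f z g.
  (* An increment of norm m is treated with t = m/d, and (m/d)^2 M <= e m as soon as m (M + 1) <= e
     d^2. *)
  move=> e e0; exists (Num.min d (e * d ^+ 2 / (M + 1))).
    by rewrite lt_min d0 divr_gt0 ?mulr_gt0 ?exprn_gt0 // ltr_wpDl.
  move=> h; rewrite lt_min => /andP[h1 h2]; set m := complex.Re `|h| in h1 h2 *.
  have m0 : 0 <= m by have := normr_ge0 h; rewrite norm_realc ler0c.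
  have := est h (m / d) ltac:(by rewrite divr_ge0 // ltW) ltac:(by rewrite ler_pdivrMr // mul1r ltW).
  move=> /(_ _)/le_trans; apply; first by move=> i; rewrite divfK ?gt_eqF //; exact: cabs_le_norm.
  rewrite expr_div_n expr2 -!mulrA [leRHS]mulrC ler_wpM2l //.
  rewrite mulrCA ler_pdivrMl ?exprn_gt0 //.
  have := ltW h2; rewrite ler_pdivlMr ?ltr_wpDl // => h3.
  apply: (@le_trans _ _ (m * (M + 1))); first by rewrite ler_wpM2l // lerDl.
  by rewrite [leRHS]mulrC.
split=> // j; rewrite Dj.
(* The indices that are not shifts have entry 0 at [j], where the derivative of the monomial
   vanishes. *)
have := has_sum_inj (@shift_mi_inj j) _ (Hg j); rewrite /=.
move=> /(_ _)/eq_has_sum; apply; last first.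
  by move=> a /dmono_out ->; rewrite mulr0.
by move=> b; rewrite dmono_shift /dcoef; ring.
Qed.

Lemma PS_deriv f c j : PS D f c -> PS D ('D_(delta_mx ord0 j) f) (dcoef c j).
Proof. by move=> H z Dz; have [_] := PS_derive H Dz; apply. Qed.

Definition add_mi a b : multi_index n := [ffun i => a i + b i]%N.

Definition derive_coef c (m a : multi_index n) : C :=
  (mi_fact (add_mi a m))%:R / (mi_fact a)%:R * c (add_mi a m).

Lemma mi_fact_shift j a : mi_fact (shift_mi j a) = ((a j).+1 * mi_fact a)%N.
Proof.
rewrite /mi_fact (bigD1 j) //= [in RHS](bigD1 j) //= ffunE eqxx addn1 factS mulnA.
by congr (_ * _)%N; apply: eq_bigr => i ij; rewrite ffunE (negbTE ij) addn0.
Qed.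

Lemma mi_fact_neq0 a : (mi_fact a)%:R != 0 :> C.
Proof. by rewrite pnatr_eq0 -lt0n prodn_gt0 // => i; exact: fact_gt0. Qed.

Lemma PS_derive_coef f c m j : PS D f (derive_coef c m) ->
  PS D ('D_(delta_mx ord0 j) f) (derive_coef c (shift_mi j m)).
Proof.
move=> H0; have H := @PS_deriv _ _ j H0 => z Dz; apply: eq_has_sum (H z Dz) => a; congr (_ * _).
have E : add_mi (shift_mi j a) m = add_mi a (shift_mi j m).
  by apply/ffunP => i; rewrite !ffunE addnAC addnA.
rewrite /dcoef /derive_coef E mi_fact_shift natrM.
have : (a j).+1%:R != 0 :> C by rewrite pnatr_eq0.
move: ((a j).+1%:R : C) (mi_fact_neq0 a) => X X0 Y0; move: X0 Y0.
by move: ((mi_fact a)%:R : C) => Y Y0 X0; field; rewrite X0 Y0.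
Qed.

Lemma PS_iter_derive f c m j k : PS D f (derive_coef c m) ->
  PS D (iter k (fun h : Cn -> C => 'D_(delta_mx ord0 j) h) f)
    (derive_coef c [ffun i => m i + (i == j) * k]%N).
Proof.
move=> H; elim: k => [|k IH].
  by rewrite (_ : [ffun i => _] = m) //; apply/ffunP => i; rewrite ffunE muln0 addn0.
rewrite (_ : [ffun i => _] = shift_mi j [ffun i => m i + (i == j) * k]%N).
  exact: PS_derive_coef.
by apply/ffunP => i; rewrite !ffunE mulnSr addnA.
Qed.

Lemma PS_mi_derive f c a : PS D f c -> PS D (mi_derive a f) (derive_coef c a).
Proof.
move=> H; rewrite /mi_derive.
(* After the coordinates in [s] have been treated, the order of differentiation is [a] on [s] and 0
   elsewhere. *)
suff K (s : seq 'I_n) : uniq s ->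
    PS D (foldr (fun i g => iter (a i) (fun h : Cn -> C => 'D_(delta_mx ord0 i) h) g) f s)
      (derive_coef c [ffun i => (i \in s) * a i]%N).
  have := K _ (enum_uniq 'I_n); rewrite (_ : [ffun i => _] = a) //.
  by apply/ffunP => i; rewrite ffunE mem_enum mul1n.
elim: s => [_|j s IH /= /andP[js us]].
  move=> z Dz; apply: eq_has_sum (H z Dz) => b; rewrite /derive_coef.
  rewrite (_ : add_mi b _ = b) ?divff ?mul1r ?mi_fact_neq0 //.
  by apply/ffunP => i; rewrite !ffunE mul0n addn0.
have := PS_iter_derive j (a j) (IH us); congr (PS D _ (derive_coef c _)).
apply/ffunP => i; rewrite !ffunE inE; case: eqP => [->|_] /=.
  by rewrite (negbTE js) mul0n.
by rewrite mul0n addn0.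
Qed.

(** Evaluating the differentiated series at 0 leaves its constant term; in particular an expansion
    on such a domain is unique. *)
Lemma PS_taylor_coef f c a : D 0 -> PS D f c -> taylor_coef f a = c a.
Proof.
move=> D0 /(PS_mi_derive a) /(PS_at0 D0); rewrite /taylor_coef => ->.
have E : add_mi [ffun=> 0%N] a = a by apply/ffunP => i; rewrite !ffunE.
have F : mi_fact ([ffun=> 0%N] : multi_index n) = 1%N.
  by rewrite /mi_fact big1 // => i _; rewrite ffunE.
by rewrite /derive_coef E F divr1 mulrAC divff ?mul1r // mi_fact_neq0.
Qed.

End Fixed.
End PowerSeries.

(** * Holomorphic functions on the ball and their Taylor series *)

Section Taylor.
Variables (R : realType) (n : nat).
Local Notation C := R[i].
Local Notation Cn := 'rV[R[i]]_n.
Local Notation Re := complex.Re.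
Local Notation Im := complex.Im.
Implicit Types (f : Cn -> C) (z w : Cn).

Lemma unit_ballE z : unit_ball z <-> \sum_i cabs (z ord0 i) ^+ 2 < 1.
Proof.
rewrite /unit_ball /= (eq_bigr (fun i => (cabs (z ord0 i) ^+ 2)%:C)).
  by rewrite -realc_sum -(rmorph1 (real_complex R)) ltcR.
by move=> i _; rewrite normC_cabs rmorphXn.
Qed.

Lemma unit_sphereE z : unit_sphere z <-> \sum_i cabs (z ord0 i) ^+ 2 = 1.
Proof.
rewrite /unit_sphere /= (eq_bigr (fun i => (cabs (z ord0 i) ^+ 2)%:C)).
  by rewrite -realc_sum; split => [[]|->].
by move=> i _; rewrite normC_cabs rmorphXn.
Qed.

Lemma reinhardt_ball : reinhardt (@unit_ball R n).
Proof.
move=> z w /unit_ballE Hz H; apply/unit_ballE; apply: le_lt_trans Hz.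
by apply: ler_sum => i _; rewrite lerXn2r ?nnegrE ?cabs_ge0.
Qed.

Lemma ball_cabs_lt1 z i : unit_ball z -> cabs (z ord0 i) < 1.
Proof.
move=> /unit_ballE H; rewrite -(@ltr_pXn2r _ 2) ?nnegrE ?cabs_ge0 // expr1n.
by apply: le_lt_trans H; rewrite (bigD1 i) //= lerDl sumr_ge0 // => j _; rewrite sqr_ge0.
Qed.

Lemma coord_open_ball : coord_open (@unit_ball R n).
Proof.
move=> z /unit_ballE H; pose S := \sum_i cabs (z ord0 i) ^+ 2.
(* As |z_i| < 1 and d <= 1, moving a coordinate by at most d raises its squared modulus by at most
   2d + d^2 <= 3d. *)
pose d := Num.min 1 ((1 - S) / (3 * n.+1%:R)); exists d.
  by rewrite lt_min ltr01 divr_gt0 ?subr_gt0 // mulr_gt0 // ltr0n.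
move=> w Hw; apply/unit_ballE.
have d1 : d <= 1 by rewrite ge_min lexx.
have d2 : d * (3 * n.+1%:R) <= 1 - S.
  by rewrite -ler_pdivlMr ?mulr_gt0 ?ltr0n // ge_min lexx orbT.
have z1 i : cabs (z ord0 i) < 1 by apply: ball_cabs_lt1; apply/unit_ballE.
apply: (@le_lt_trans _ _ (\sum_i (cabs (z ord0 i) ^+ 2 + 3 * d))).
  apply: ler_sum => i _; have h := ltW (Hw i); have := z1 i => zi.
  have := cabs_le_dist (w ord0 i) (z ord0 i) => h2.
  have := cabs_ge0 (w ord0 i); have := cabs_ge0 (z ord0 i).
  have h3 : cabs (w ord0 i) <= cabs (z ord0 i) + d by lra.
  move=> z0 w0; apply: (@le_trans _ _ ((cabs (z ord0 i) + d) ^+ 2)).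
    by rewrite lerXn2r // nnegrE // addr_ge0 // (le_trans _ h) // cabs_ge0.
  have d0 : 0 <= d by apply: le_trans h; exact: cabs_ge0.
  by rewrite !expr2; nra.
have d0 : 0 < d by rewrite lt_min ltr01 divr_gt0 ?subr_gt0 // mulr_gt0 // ltr0n.
rewrite big_split /= sumr_const card_ord -mulr_natr -/S.
have : 3 * d * n%:R < d * (3 * n.+1%:R).
  by rewrite [3 * d]mulrC -mulrA ltr_pM2l // ltr_pM2l // ltr_nat.
lra.
Qed.

Lemma unit_ball0 : unit_ball (0 : Cn).
Proof. by apply/unit_ballE; rewrite big1 // => i _; rewrite mxE cabs0 expr0n. Qed.

(** The derivative along a complex line is the differential applied to its direction. Dividing by
    [m + 1] instead of the norm [m] covers the direction 0. *)
Lemma slice_cdiff f (p v : Cn) (t : C) : differentiable f (p + t *: v) ->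
  cdiff (fun s => f (p + s *: v)) t.
Proof.
move=> df; have [_ /eqaddoP H] := (iffLR (diff_locallyP _ _) df).
exists ('d f (p + t *: v) v) => e e0; pose m := Re `|v|.
have m0 : 0 <= m by have := normr_ge0 v; rewrite norm_realc ler0c.
have m1 : 0 < m + 1 by rewrite ltr_wpDl.
have e1 : 0 < (e / (m + 1))%:C by rewrite ltcR divr_gt0.
have /nbhs_ballP [_ /gt0_realc [d d0 ->] Hd] := H _ e1.
exists (d / (m + 1)); first by rewrite divr_gt0.
move=> h hd; have nh : `|h *: v| = (cabs h * m)%:C.
  by rewrite normrZ normC_cabs [`|v|]norm_realc -rmorphM.
have := Hd (h *: v); rewrite mx_norm_ball /ball_ /= sub0r normrN nh ltcR => /(_ _).
have hm : cabs h * m <= cabs h * (m + 1) by rewrite ler_wpM2l ?cabs_ge0 // lerDl.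
rewrite (le_lt_trans hm) -?ltr_pdivlMr // => /(_ isT).
rewrite -[X in `|X|]/(f (h *: v + (p + t *: v)) - (f (p + t *: v) + 'd f (p + t *: v) (h *: v))).
rewrite linearZ normC_cabs -rmorphM lecR opprD addrA.
have -> : h *: v + (p + t *: v) = p + (t + h) *: v by rewrite scalerDl addrC addrA.
rewrite -[X in cabs (_ - X) <= _ -> _]/(h * 'd f (p + t *: v) v) [h * _]mulrC.
move=> /le_trans; apply.
have -> : e / (m + 1) * (cabs h * m) = e * cabs h * (m / (m + 1)) by ring.
rewrite ler_piMr ?mulr_ge0 ?cabs_ge0 ?(ltW e0) // ler_pdivrMr // mul1r; lra.
Qed.

Lemma continuous_cabs : continuous (fun x : C => cabs x : R^o).
Proof.
move=> x; apply/(@cvgrPdist_lt _ _ _ (nbhs x)) => e e0; apply/nbhs_ballP; exists e%:C; first by rewrite /= ltcR.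
move=> y; rewrite -ball_normE /= normC_cabs ltcR => H; apply: le_lt_trans H.
have h1 := cabs_le_dist x y; have h2 := cabs_le_dist y x; rewrite cabsBC in h2.
by rewrite ler_norml; apply/andP; split; lra.
Qed.

Lemma continuous_pair : continuous (fun p : R * R => (p.1 +i* p.2 : C)).
Proof.
move=> p; apply/(@cvgrPdist_lt C C _ (nbhs p)) => e /gt0_realc [d d0 ->].
have d2 : 0 < d / 2 by rewrite divr_gt0.
exists (ball p.1 (d / 2), ball p.2 (d / 2)) => /=.
  by split; exact: nbhsx_ballx.
move=> q [/= h1 h2]; rewrite normC_cabs ltcR; apply: le_lt_trans (cabs_le_ReIm _) _.
by rewrite (splitr d) ltrD.
Qed.

Lemma compact_disc (r : R) : compact [set x : C | cabs x <= r].
Proof.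
have K : compact ((fun p : R * R => (p.1 +i* p.2 : C)) @` (`[- r, r] `*` `[- r, r])).
  apply: continuous_compact; last by apply: compact_setX; exact: segment_compact.
  by apply: continuous_subspaceT; exact: continuous_pair.
apply: (subclosed_compact _ K).
  apply: (@closed_comp C R^o _ [set y : R | y <= r]); last exact: closed_le.
  by move=> x _; exact: continuous_cabs.
move=> x /= xr; exists (Re x, Im x); last by case: (x).
have := Re_le_cabs x; have := Im_le_cabs x; rewrite !ler_norml => /andP[? ?] /andP[? ?].
by split; rewrite /= in_itv /=; apply/andP; split; lra.
Qed.

Lemma polydisc_bounded f (x : 'I_n -> R) :
  (forall z, (forall i, cabs (z ord0 i) <= x i) -> differentiable f z) ->
  exists M : R, forall z, (forall i, cabs (z ord0 i) <= x i) -> cabs (f z) <= M.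
Proof.
move=> H; pose K := [set z : Cn | forall i, [set y : C | cabs y <= x i] (z ord0 i)].
have cK : compact K := (@rV_compact _ n (fun i => [set y : C | cabs y <= x i]) (fun i => @compact_disc (x i))).
have cf : {within K, continuous (fun z => cabs (f z) : R^o)}.
  apply: continuous_in_subspaceT => z /set_mem Kz.
  apply: (@continuous_comp Cn C R^o f (fun y => cabs y)).
    exact/differentiable_continuous/H.
  exact: continuous_cabs.
have /compact_bounded [M [_ HM]] := continuous_compact cf cK.
exists (M + 1) => z Kz; apply: le_trans (ler_norm (cabs (f z))) _.
by apply: (HM (M + 1)); [rewrite ltrDl ltr01|exists z].
Qed.

(** Each point [z] lies in a polydisc with closure in the ball; rescaled to radius 1, it falls under
    [polydisc_expansion]. The coefficients found depend a priori on [z], but all these polydiscs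
    contain 0, so uniqueness identifies them with the Taylor coefficients. *)
Lemma O_ball_PS f : O_ball R n f -> PS (@unit_ball R n) f (taylor_coef f).
Proof.
move=> Of z Bz; have [d0 d00 Hd0] := reinhardt_room coord_open_ball reinhardt_ball Bz.
pose d := Num.min d0 (1 / 2); have d_gt0 : 0 < d by rewrite lt_min d00 divr_gt0.
have d_lt1 : d < 1 by rewrite gt_min; apply/orP; right; rewrite ltr_pdivrMr // mul1r ltr1n.
pose x i := cabs (z ord0 i) + d.
have x0 i : 0 < x i by rewrite ltr_wpDl ?cabs_ge0.
have Bx : unit_ball (\row_i (x i)%:C : Cn).
  apply: reinhardt_ball Hd0 _ => i; rewrite !mxE !cabs_ge0R ?(ltW (x0 i)) //.
    by rewrite lerD2l ge_min lexx.
  by rewrite addr_ge0 ?cabs_ge0 // ltW.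
have x1 i : x i < 1 by have := ball_cabs_lt1 i Bx; rewrite mxE cabs_ge0R // ltW.
have [e e0 He] := coord_open_ball Bx; pose rho := 1 + e / 2.
have rho1 : 1 < rho by rewrite ltrDl divr_gt0.
have rho0 : 0 < rho by apply: lt_trans rho1.
have Brho w : (forall i, cabs (w ord0 i) <= rho * x i) -> unit_ball w.
  move=> Hw; apply: (@reinhardt_ball (\row_i (rho * x i)%:C)); last first.
    by move=> i; rewrite mxE cabs_ge0R // mulr_ge0 // ltW.
  apply: He => i; rewrite !mxE -rmorphB cabs_ge0R.
    rewrite /rho mulrDl mul1r addrAC subrr add0r.
    apply: (@lt_trans _ _ (e / 2)); last lra.
    by rewrite gtr_pMr // divr_gt0.
  by rewrite subr_ge0 ler_peMl // ltW.
have B1 w : (forall i, cabs (w ord0 i) <= x i) -> unit_ball w.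
  by move=> Hw; apply: Brho => i; apply: le_trans (Hw i) _; rewrite ler_peMl // ltW.
have [M HM] := polydisc_bounded (fun w Hw => Of w (B1 w Hw)).
pose sc (w : Cn) : Cn := \row_i (w ord0 i * (x i)%:C).
pose g w := f (sc w).
have gd w j (t : C) : (forall i, cabs (w ord0 i) <= 1) -> cabs t < rho ->
    cdiff (fun t => g (upd w j t)) t.
  move=> Hw ht; have E s : sc (upd w j s) = sc (upd w j 0) + s *: ((x j)%:C *: delta_mx ord0 j).
    apply/rowP => i; rewrite !mxE eqxx /=; case: eqP => [->|_].
      by rewrite mul0r add0r mulr1.
    by rewrite !mulr0 addr0.
  rewrite (_ : (fun _ => _) = fun s => f (sc (upd w j 0) + s *: ((x j)%:C *: delta_mx ord0 j))).
    apply: slice_cdiff; rewrite -E; apply: Of; apply: Brho => i.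
    rewrite !mxE cabsM (cabs_ge0R (ltW (x0 i))) ler_wpM2r ?(ltW (x0 i)) //.
    by case: ifP => _; [exact: ltW|apply: le_trans (Hw i) (ltW rho1)].
  by apply/funext => s; rewrite /g E.
have gM w : (forall i, cabs (w ord0 i) <= 1) -> cabs (g w) <= M.
  move=> Hw; apply: HM => i; rewrite mxE cabsM (cabs_ge0R (ltW (x0 i))).
  by rewrite ler_piMl // ltW.
(* With y = |z_i| and y + d < 1 one has (1 - d/2)(y + d) > y, so that [z] remains in the shrunken
   polydisc. *)
pose q := 1 - d / 2.
have q0 : 0 < q by rewrite /q; lra.
have q1 : q < 1 by rewrite /q; lra.
have [c Hc] := polydisc_expansion rho1 gd gM q0 q1.
pose D := [set w : Cn | forall i, cabs (w ord0 i) < q * x i].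
have xn i : (x i)%:C != 0 :> C by rewrite -cabs_gt0 cabs_ge0R ?(ltW (x0 i)).
have PD : PS D f (fun a => c a / \prod_i (x i)%:C ^+ a i).
  move=> w Dw; pose w' : Cn := \row_i (w ord0 i / (x i)%:C).
  have -> : f w = g w'.
    by congr f; apply/rowP => i; rewrite !mxE mulfVK.
  have := Hc w' _; move=> /(_ _)/eq_has_sum; apply; last first.
    move=> i; rewrite mxE cabsM cabsV (cabs_ge0R (ltW (x0 i))) ler_pdivrMr //.
    exact/ltW/Dw.
  move=> a; rewrite -mulrA; congr (_ * _); rewrite /mono mulrC -prodf_div.
  by apply: eq_bigr => i _; rewrite mxE expr_div_n.
have oD : coord_open D.
  move=> w Dw; have [dl dl0 Hdl] : exists2 dl : R, 0 < dl & forall i, i \in enum 'I_n ->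
      dl <= q * x i - cabs (w ord0 i).
    elim: (enum 'I_n) => [|i s [dl dl0 IH]]; first by exists 1.
    exists (Num.min dl (q * x i - cabs (w ord0 i))); first by rewrite lt_min dl0 subr_gt0 Dw.
    move=> j; rewrite inE ge_min => /predU1P[->|/IH ->//]; by rewrite lexx orbT.
  exists dl => // v Hv i; apply: le_lt_trans (cabs_le_dist _ (w ord0 i)) _.
  by have := Hdl i (mem_enum _ _); have := Hv i; lra.
have rD : reinhardt D by move=> w v Dw Hv i; apply: le_lt_trans (Hv i) (Dw i).
have D0 : D 0 by move=> i; rewrite mxE cabs0 mulr_gt0.
have Dz : D z.
  move=> i; have := x1 i; rewrite /q /x; have := cabs_ge0 (z ord0 i).
  by move: (cabs _) => y y0 y1; nra.
apply: eq_has_sum (PD z Dz) => a; congr (_ * _).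
by rewrite (PS_taylor_coef oD rD a D0 PD).
Qed.

Lemma PS_O_ball f c : PS (@unit_ball R n) f c -> O_ball R n f.
Proof. by move=> H z Bz; have [] := PS_derive coord_open_ball reinhardt_ball H Bz. Qed.

Lemma PS_ball_coef f c a : PS (@unit_ball R n) f c -> taylor_coef f a = c a.
Proof. by move=> H; rewrite (PS_taylor_coef coord_open_ball reinhardt_ball a unit_ball0 H). Qed.

End Taylor.

(** * The kernels 1 / (1 - <z, w>) *)

Section Kernel.
Variables (R : realType) (n : nat).
Local Notation C := R[i].
Local Notation Cn := 'rV[R[i]]_n.
Local Notation Re := complex.Re.
Local Notation Im := complex.Im.
Implicit Types (z w : Cn) (a : multi_index n).

(** The reproducing kernel as the function k_w of z, hence the order of the arguments. *)
Definition knl w z : C := (1 - hdot z w)^-1.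

Lemma hdotDl z h w : hdot (z + h) w = hdot z w + hdot h w.
Proof. by rewrite /hdot -big_split; apply: eq_bigr => i _; rewrite mxE mulrDl. Qed.

Lemma hdotJ z w : (hdot z w)^* = hdot w z.
Proof.
rewrite /hdot rmorph_sum; apply: eq_bigr => i _ /=.
by rewrite rmorphM /= conjcK mulrC.
Qed.

Lemma cabs_hdot_le z w : cabs (hdot z w) <=
  (\sum_i cabs (z ord0 i) ^+ 2 + \sum_i cabs (w ord0 i) ^+ 2) / 2.
Proof.
apply: le_trans (cabs_sum _ _ _) _; rewrite -big_split mulr_suml; apply: ler_sum => i _.
rewrite cabsM cabsJ ler_pdivlMr //= -subr_ge0.
have -> : cabs (z ord0 i) ^+ 2 + cabs (w ord0 i) ^+ 2 - cabs (z ord0 i) * cabs (w ord0 i) * 2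
  = (cabs (z ord0 i) - cabs (w ord0 i)) ^+ 2 by ring.
exact: sqr_ge0.
Qed.

(** The closed ball covers both uses of k_w: [w] on the sphere for the integrals of M^+, and [w] in
    the ball for S^+. *)
Definition cball : set Cn := [set w | \sum_i cabs (w ord0 i) ^+ 2 <= 1].

Lemma cabs_hdot_lt z w : unit_ball z -> cball w -> cabs (hdot z w) < 1.
Proof.
move=> /unit_ballE Hz Hw; apply: le_lt_trans (cabs_hdot_le z w) _.
rewrite /cball /= in Hw; rewrite ltr_pdivrMr //; lra.
Qed.

Lemma one_sub_hdot_neq0 z w : unit_ball z -> cball w -> 1 - hdot z w != 0.
Proof.
move=> Hz Hw; rewrite subr_eq0; apply: contraTneq (cabs_hdot_lt Hz Hw) => <-.
by rewrite cabs1 ltxx.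
Qed.

Lemma ball_cball z : unit_ball z -> cball z.
Proof. by move=> /unit_ballE /ltW. Qed.

Lemma is_cdiff_resolvent (s : C) : 1 - s != 0 ->
  is_cdiff (fun s => (1 - s)^-1) s ((1 - s)^-1 ^+ 2).
Proof.
move=> s0 e /(is_cdiffV s0) [d d0 Hd]; exists d => // h hd.
have := Hd (- h); rewrite cabsN => /(_ hd).
by rewrite mulrNN opprD addrA exprVn.
Qed.

Lemma is_cdiff_resolvent_exp (s : C) k : 1 - s != 0 ->
  is_cdiff (fun s => (1 - s)^-1 ^+ k) s (k%:R * (1 - s)^-1 ^+ k.+1).
Proof.
move=> s0; elim: k => [|k IH].
  by rewrite mul0r; exact: is_cdiff_cst.
have := is_cdiffM (is_cdiff_resolvent s0) IH.
have -> : (fun t : C => (1 - t)^-1 ^+ k.+1) = fun t => (1 - t)^-1 * (1 - t)^-1 ^+ k.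
  by apply/funext => t; rewrite exprS.
by congr (is_cdiff _ _); rewrite -natr1 !exprS; ring.
Qed.

Lemma hdot_derive (phi : C -> C) (d : C) w z : is_cdiff phi (hdot z w) d ->
  differentiable (fun z => phi (hdot z w)) z /\
  forall j, 'D_(delta_mx ord0 j) (fun z => phi (hdot z w)) z = d * (w ord0 j)^*.
Proof.
move=> H; apply: (@differentiable_eps R n _ z (fun j => d * (w ord0 j)^*)) => e e0.
pose K := \sum_j cabs (w ord0 j) + 1.
have K0 : 0 < K by rewrite ltr_wpDl // sumr_ge0 // => j _; exact: cabs_ge0.
have hb (h : Cn) : cabs (hdot h w) <= K * Re `|h|.
  have := @lform_bound R n (fun j => (w ord0 j)^*) h.
  rewrite (eq_bigr (fun j => cabs (w ord0 j))); last by move=> j _; rewrite cabsJ.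
  move=> /le_trans; apply; have h0 : 0 <= Re `|h| by have := normr_ge0 h; rewrite norm_realc ler0c.
  by rewrite ler_wpM2r // lerDl.
have [dl dl0 Hdl] := H _ (divr_gt0 e0 K0); exists (dl / K); first by rewrite divr_gt0.
move=> h hh; have hl : cabs (hdot h w) < dl.
  by apply: le_lt_trans (hb h) _; rewrite mulrC -ltr_pdivlMr.
have := Hdl _ hl; rewrite -hdotDl.
have -> : lform (fun j => d * (w ord0 j)^*) h = d * hdot h w.
  by rewrite /lform /hdot mulr_sumr; apply: eq_bigr => j _; rewrite mulrCA.
move=> /le_trans; apply; rewrite mulrAC ler_pdivrMr // -mulrA ler_wpM2l ?(ltW e0) //.
by rewrite mulrC.
Qed.

Section FixW.
Variable w : Cn.
Hypothesis Hw : cball w.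

Lemma knl_O_ball : O_ball R n (knl w).
Proof.
move=> z Bz; have := is_cdiff_resolvent (one_sub_hdot_neq0 Bz Hw).
by move=> /hdot_derive [].
Qed.

(** Functions of the form K m! k_w^(m+1) are stable under partial derivatives, each producing a
    conjugate coordinate of [w]. The formula is known on the ball only; that suffices because the
    ball is open. *)
Lemma knl_power_derive (g : Cn -> C) (K : C) m j :
  (forall z, unit_ball z -> g z = K * m`!%:R * knl w z ^+ m.+1) ->
  forall z, unit_ball z -> 'D_(delta_mx ord0 j) g z =
    K * (w ord0 j)^* * (m.+1)`!%:R * knl w z ^+ m.+2.
Proof.
move=> Hg z Bz.
pose phi s : C := K * m`!%:R * (1 - s)^-1 ^+ m.+1.
have Hphi : is_cdiff phi (hdot z w) (K * (m.+1)`!%:R * knl w z ^+ m.+2).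
  have := is_cdiffM (is_cdiff_cst (K * m`!%:R) (hdot z w))
    (is_cdiff_resolvent_exp m.+1 (one_sub_hdot_neq0 Bz Hw)).
  by rewrite mul0r add0r factS natrM /knl; congr (is_cdiff _ _); ring.
have [_ /(_ j) E] := hdot_derive Hphi.
transitivity ('D_(delta_mx ord0 j) (fun z => phi (hdot z w)) z); last by rewrite E; ring.
apply: near_eq_derive.
apply/nbhs_coordP; have [d d0 Hd] := coord_open_ball Bz.
by exists d => // v /Hd Bv; rewrite Hg.
Qed.

Lemma knl_iter_derive (g : Cn -> C) (K : C) m j k :
  (forall z, unit_ball z -> g z = K * m`!%:R * knl w z ^+ m.+1) ->
  forall z, unit_ball z -> iter k (fun h : Cn -> C => 'D_(delta_mx ord0 j) h) g z =
    K * (w ord0 j)^* ^+ k * (m + k)`!%:R * knl w z ^+ (m + k).+1.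
Proof.
move=> Hg; elim: k => [|k IH]; first by move=> z Bz; rewrite /= Hg // mulr1 addn0.
move=> z Bz; rewrite iterS (knl_power_derive _ IH) // addnS.
by rewrite [(w ord0 j)^* ^+ k.+1]exprSr !mulrA.
Qed.

Lemma knl_mi_derive a z : unit_ball z -> mi_derive a (knl w) z =
  (mono w a)^* * (mi_abs a)`!%:R * knl w z ^+ (mi_abs a).+1.
Proof.
rewrite /mi_derive /mono /mi_abs rmorph_prod /=.
rewrite -[in RHS]big_enum -[X in (X)`!]big_enum -[X in _ ^+ X.+1]big_enum /=.
move: z; elim: (enum 'I_n) => [|j s IH] /=.
  by move=> z Bz; rewrite !big_nil fact0 expr1 !mul1r.
move=> z Bz; rewrite (knl_iter_derive _ _ IH) // !big_cons rmorphXn /=.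
by rewrite [(a j + _)%N]addnC [_ ^+ _ * \prod_(_ <- _) _]mulrC.
Qed.

Definition kcoef a : C := (mi_abs a)`!%:R / (mi_fact a)%:R * (mono w a)^*.

Lemma hdot0 : hdot (0 : Cn) w = 0.
Proof. by rewrite /hdot big1 // => i _; rewrite mxE mul0r. Qed.

(** Convergence is already given by [O_ball_PS], so it remains to identify the coefficients, through
    the derivatives of k_w at 0. *)
Lemma PS_knl : PS (@unit_ball R n) (knl w) kcoef.
Proof.
move=> z Bz; apply: eq_has_sum (O_ball_PS knl_O_ball Bz) => a; congr (_ * _).
rewrite /taylor_coef knl_mi_derive; last exact: unit_ball0.
by rewrite /knl hdot0 subr0 invr1 expr1n mulr1 /kcoef; ring.
Qed.

End FixW.

Lemma has_sum_ge0_le (v : multi_index n -> R) S : (forall a, 0 <= v a) ->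
  has_sum (fun a => (v a)%:C) S -> forall N, \sum_(a <- box N) v a <= Re S.
Proof.
move=> v0 [_ H] N; apply/ler_addgt0Pr => e /H [N0 HN0].
have := HN0 (maxn N N0) (leq_maxr _ _); rewrite -realc_sum.
have := Re_le_cabs ((\sum_(a <- box (maxn N N0)) v a)%:C - S); rewrite ReB /=.
have : \sum_(a <- box N) v a <= \sum_(a <- box (maxn N N0)) v a.
  apply: sum_sub_le; rewrite ?box_uniq //.
  by move=> a aN; exact: box_sub (leq_maxl _ _) _ aN.
rewrite ler_norml => h1 /andP[_ h2] h3; lra.
Qed.

Definition absv z : Cn := \row_i (cabs (z ord0 i))%:C.

Lemma cabs_kcoef w a : cabs (kcoef w a) = (mi_abs a)`!%:R / (mi_fact a)%:R * rmono (fun i => cabs (w ord0 i)) a.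
Proof. by rewrite /kcoef !cabsM cabsV !cabs_nat cabsJ cabs_mono. Qed.

(** Passing to the moduli of the coordinates makes all terms nonnegative, and their box sums stay
    below the kernel there. Then sum |z_i||w_i| <= (|z|^2 + 1)/2 gives a bound that is uniform in
    [w]. *)
Lemma knl_box_bound z w : unit_ball z -> cball w -> forall N,
  \sum_(a <- box N) cabs (kcoef w a * mono z a) <=
    2 / (1 - \sum_i cabs (z ord0 i) ^+ 2).
Proof.
move=> Bz Cw N; have Bz' : unit_ball (absv z).
  by apply: reinhardt_ball Bz _ => i; rewrite mxE cabs_ge0R ?cabs_ge0.
have Cw' : cball (absv w).
  by rewrite /cball /=; under eq_bigr do rewrite mxE cabs_ge0R ?cabs_ge0 //.
have HS := PS_knl Cw' Bz'.
have E a : kcoef (absv w) a * mono (absv z) a = (cabs (kcoef w a * mono z a))%:C.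
  rewrite cabsM rmorphM /= cabs_mono cabs_kcoef !rmorphM /= fmorphV !rmorph_nat /kcoef.
  congr (_ * _ * _).
    rewrite /mono rmorph_prod /rmono rmorph_prod; apply: eq_bigr => i _ /=.
    by rewrite mxE rmorphXn rmorphXn; congr (_ ^+ _); exact: conjc_real.
  by rewrite /mono /rmono rmorph_prod; apply: eq_bigr => i _ /=; rewrite mxE rmorphXn.
have := has_sum_ge0_le _ (eq_has_sum E HS) N; move=> /(_ (fun a => cabs_ge0 _))/le_trans; apply.
have -> : knl (absv w) (absv z) = ((1 - \sum_i cabs (z ord0 i) * cabs (w ord0 i))^-1)%:C.
  rewrite /knl (fmorphV (real_complex R)) (rmorphB (real_complex R)); congr (_ - _)^-1.
  rewrite (rmorph_sum (real_complex R)); apply: eq_bigr => i _.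
  by apply: complex_ext; rewrite ?ReM ?ImM ?ReJ ?ImJ !mxE /=; ring.
have Hz := iffLR (unit_ballE z) Bz; rewrite /cball /= in Cw.
have S0 : 0 < 1 - \sum_i cabs (z ord0 i) ^+ 2 by rewrite subr_gt0.
have h : \sum_i cabs (z ord0 i) * cabs (w ord0 i) <=
   (\sum_i cabs (z ord0 i) ^+ 2 + 1) / 2.
  apply: (@le_trans _ _ ((\sum_i cabs (z ord0 i) ^+ 2 + \sum_i cabs (w ord0 i) ^+ 2) / 2)); last lra.
  rewrite -big_split mulr_suml; apply: ler_sum => i _ /=.
  by have := sqr_ge0 (cabs (z ord0 i) - cabs (w ord0 i)); rewrite sqrrB; lra.
rewrite /= -[leRHS]invrK lef_pV2 ?posrE ?invr_gt0 ?divr_gt0 //; last lra.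
rewrite invf_div; lra.
Qed.

End Kernel.

(** * Positive functionals and moments *)

Section PositiveExtension.
Variables (R : realType) (T : Type) (S : set T).
Implicit Types (h : T -> R) (r : R) (G : set ((T -> R) * R)).

(* Linear functionals on spaces of functions are handled through their graphs. *)
Definition positive_graph G : Prop :=
  [/\ forall h1 r1 h2 r2, G (h1, r1) -> G (h2, r2) -> G (fun x => h1 x + h2 x, r1 + r2),
      forall k h r, G (h, r) -> G (fun x => k * h x, k * r) &
      forall h r, G (h, r) -> (forall x, S x -> 0 <= h x) -> 0 <= r].

Definition bounded_on h : Prop := exists K, forall x, S x -> `|h x| <= K.

Lemma positive_graph_le G h1 r1 h2 r2 : positive_graph G -> G (h1, r1) -> G (h2, r2) ->
  (forall x, S x -> h1 x <= h2 x) -> r1 <= r2.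
Proof.
move=> [addG sclG posG] H1 H2 le12; rewrite -subr_ge0 -mulN1r.
apply: (posG (fun x => h2 x + -1 * h1 x)); first by apply: addG => //; exact: sclG.
by move=> x Sx; rewrite mulN1r subr_ge0 le12.
Qed.

Lemma positive_graph_eq G h1 r1 h2 r2 : positive_graph G -> G (h1, r1) -> G (h2, r2) ->
  (forall x, S x -> h1 x = h2 x) -> r1 = r2.
Proof.
move=> pG H1 H2 e12; apply/eqP; rewrite eq_le.
by rewrite (positive_graph_le pG H1 H2) ?(positive_graph_le pG H2 H1) // => x Sx; rewrite e12.
Qed.

(** The one-dimensional extension step of M. Riesz: [h0] receives the supremum of the values on its
    minorants. Multiples of the constant 1 lie above and below a bounded [h0], so this supremum is
    finite. *)
Lemma positive_graph_extend G h0 c : positive_graph G -> G (fun=> 1, c) -> bounded_on h0 ->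
  exists v, positive_graph [set p | exists h r t,
    G (h, r) /\ p = (fun x => h x + t * h0 x, r + t * v)].
Proof.
move=> pG G1 [K HK]; have [addG sclG posG] := pG.
pose V := [set r | exists h, G (h, r) /\ forall x, S x -> h x <= h0 x].
have V0 : V !=set0.
  exists (- K * c), (fun x => - K * 1); split; first exact: sclG.
  by move=> x /HK; rewrite mulr1 ler_norml => /andP[].
have Vub h r : G (h, r) -> (forall x, S x -> h0 x <= h x) -> ubound V r.
  move=> Gh h0h q [k [Gk kh]]; apply: (positive_graph_le pG Gk Gh) => x Sx.
  exact: le_trans (kh x Sx) (h0h x Sx).
have hV : has_sup V.
  split=> //; exists (K * c); apply: (Vub (fun x => K * 1)); first exact: sclG.
  by move=> x /HK; rewrite mulr1 ler_norml => /andP[].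
exists (sup V); split.
- move=> _ _ _ _ [h1 [r1 [t1 [G1' [-> ->]]]]] [h2 [r2 [t2 [G2 [-> ->]]]]].
  exists (fun x => h1 x + h2 x), (r1 + r2), (t1 + t2); split; first exact: addG.
  by apply/pair_equal_spec; split; [apply/funext => x; ring|ring].
- move=> k _ _ [h [r [t [Gh [-> ->]]]]].
  exists (fun x => k * h x), (k * r), (k * t); split; first exact: sclG.
  by apply/pair_equal_spec; split; [apply/funext => x; ring|ring].
- move=> _ _ [h [r [t [Gh [-> ->]]]]] pos.
  have [t0|t0|t0] := ltgtP t 0.
  + have Gh' := sclG (- t)^-1 _ _ Gh.
    have nt : 0 < - t by rewrite oppr_gt0.
    have : sup V <= (- t)^-1 * r.
      apply: sup_le_ub => //; apply: Vub Gh' _ => x /pos hx.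
      by rewrite ler_pdivlMl // mulNr; lra.
    rewrite ler_pdivlMl // mulNr; lra.
  + have Gh' := sclG (- t^-1) _ _ Gh.
    have : - t^-1 * r <= sup V.
      apply: ub_le_sup; first by case: hV.
      exists (fun x => - t^-1 * h x); split=> // x /pos hx.
      by rewrite mulNr lerNl ler_pdivlMl // mulrN; lra.
    rewrite mulNr lerNl ler_pdivlMl // mulrN; lra.
  + by move: pos; rewrite t0 mul0r addr0 => pos; apply: posG Gh _ => x /pos; rewrite mul0r addr0.
Qed.

(** Zorn's lemma is applied to sets whose union with [G0] is positive, so that the union of the
    empty chain also qualifies. *)
Lemma positive_extension G0 c : positive_graph G0 -> G0 (fun=> 1, c) ->
  exists G, [/\ positive_graph G, G0 `<=` G & forall h, bounded_on h -> exists r, G (h, r)].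
Proof.
move=> pG0 G01.
have [F FP Ftot|A [pA maxA]] := @Zorn_bigcup _ (fun A => positive_graph (A `|` G0)).
  have [->|/set0P [X0 FX0]] := eqVneq F set0; first by rewrite bigcup_set0 set0U.
  have dir p q : (\bigcup_(X in F) X `|` G0) p -> (\bigcup_(X in F) X `|` G0) q ->
      exists2 X, F X & (X `|` G0) p /\ (X `|` G0) q.
    move=> [[X FX Xp]|Gp] [[Y FY Yq]|Gq].
    - have [XY|YX] := Ftot _ _ FX FY.
        by exists Y => //; split; left => //; exact: XY.
      by exists X => //; split; left => //; exact: YX.
    - by exists X => //; split; [left|right].
    - by exists Y => //; split; [right|left].
    - by exists X0 => //; split; right.
  split.
  - move=> h1 r1 h2 r2 H1 H2; have [X FX [X1 X2]] := dir _ _ H1 H2.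
    have [addX _ _] := FP _ FX; case: (addX _ _ _ _ X1 X2) => H; [left|by right].
    by exists X.
  - move=> k h r H; have [X FX [X1 _]] := dir _ _ H H.
    have [_ sclX _] := FP _ FX; case: (sclX k _ _ X1) => H'; [left|by right].
    by exists X.
  - move=> h r H; have [X FX [X1 _]] := dir _ _ H H.
    by have [_ _ posX] := FP _ FX; exact: posX X1.
exists (A `|` G0); split=> // h0 bh0.
have G1 : (A `|` G0) (fun=> 1, c) by right.
have [v pB] := positive_graph_extend pA G1 bh0.
set B := [set p | _] in pB.
have AB : A `|` G0 `<=` B.
  move=> [h r] Hhr; exists h, r, 0; split => //.
  by apply/pair_equal_spec; split; [apply/funext => x; ring|ring].
have Bh0 : B (h0, v).
  exists (fun=> 0 * 1), (0 * c), 1; split; first by have [_ + _] := pA; apply.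
  by apply/pair_equal_spec; split; [apply/funext => x; ring|ring].
have [|nA] := pselect ((A `|` G0) (h0, v)); first by exists v.
exfalso; apply: (maxA B); last first.
  by rewrite (_ : B `|` G0 = B) //; apply/setUidPl => p Gp; apply: AB; right.
split; first by move=> p Ap; apply: AB; left.
by move=> BA; apply: nA; left; exact: BA.
Qed.

End PositiveExtension.

(** * Nested intervals with prescribed lengths *)

Section NestedIntervals.
Variables (R : realType) (mass : seq bool -> R).
Hypothesis mass_ge0 : forall s, 0 <= mass s.
Hypothesis mass_split : forall s, mass s = mass (false :: s) + mass (true :: s).

(* Finite bit strings are stored with the latest bit first. *)
Fixpoint lo (s : seq bool) : R :=
  if s is b :: s' then lo s' + (if b then mass (false :: s') else 0) else 0.

(** Half-open, so that the two halves partition the interval and mass 0 gives the empty set. *)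
Definition dyadic s : set R := `[lo s, lo s + mass s[%classic.

(** The digits of [x] under successive splitting: for [x] in the root interval they name the
    interval of level [m] that contains it. *)
Fixpoint address (x : R) (m : nat) : seq bool :=
  if m is m'.+1 then
    let s := address x m' in (lo s + mass (false :: s) <= x) :: s
  else [::].

Lemma size_address x m : size (address x m) = m.
Proof. by elim: m => //= m ->. Qed.

Lemma dyadicP s x : dyadic s x <-> lo s <= x /\ x < lo s + mass s.
Proof. by rewrite /dyadic /= in_itv /=; split=> [/andP[]|[-> ->]]. Qed.

Lemma dyadic_split s : dyadic s = dyadic (false :: s) `|` dyadic (true :: s).
Proof.
have := mass_split s; have := mass_ge0 (false :: s); have := mass_ge0 (true :: s).
move=> a b c; apply/seteqP; split=> x.
  move=> /dyadicP [h1 h2]; have [h|h] := ltP x (lo s + mass (false :: s)).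
    by left; apply/dyadicP => /=; rewrite addr0.
  by right; apply/dyadicP => /=; split=> //; lra.
by case=> /dyadicP /= [h1 h2]; apply/dyadicP; split; lra.
Qed.

Lemma dyadic_disj s : [disjoint dyadic (false :: s) & dyadic (true :: s)].
Proof.
rewrite disj_set2E; apply/eqP/seteqP; split=> // x [/dyadicP /= [h1 h2] /dyadicP /= [h3 h4]].
by exfalso; lra.
Qed.

Lemma dyadic_sub b s : dyadic (b :: s) `<=` dyadic s.
Proof. by rewrite (dyadic_split s) => x Hx; case: b Hx => Hx; [right|left]. Qed.

Lemma address_dyadic x m : dyadic [::] x -> dyadic (address x m) x.
Proof.
move=> x0; elim: m => //= m; set s := address x m.
have c := mass_split s.
move=> /dyadicP [h1 h2]; apply/dyadicP => /=.
by have [h|h] := leP (lo s + mass (false :: s)) x; split; lra.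
Qed.

Lemma dyadic_address s x : dyadic s x -> address x (size s) = s.
Proof.
elim: s => //= b s IH Hx; rewrite (IH (dyadic_sub Hx)); congr (_ :: _).
move: Hx => /dyadicP; case: b => /=; first by case.
by rewrite addr0 => -[_ h]; apply/negbTE; rewrite -ltNge.
Qed.

Lemma dyadic_root s : dyadic s `<=` dyadic [::].
Proof. by elim: s => // b s IH x /dyadic_sub /IH. Qed.

Lemma dyadic_measure s : lebesgue_measure (dyadic s : set (measurableTypeR R)) = (mass s)%:E.
Proof.
rewrite /dyadic lebesgue_measure_itv /= lte_fin ltrDl lt_neqAle mass_ge0 andbT.
by have [<-|_] := eqVneq 0 (mass s); rewrite //= -EFinD addrC addKr.
Qed.

Lemma measurable_dyadic s : measurable (dyadic s : set (measurableTypeR R)).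
Proof. exact: measurable_itv. Qed.

End NestedIntervals.

(** * Images of finite measures *)

Section FinitePushforward.
Context d d' (T1 : measurableType d) (T2 : measurableType d') (R : realType).
Variables (m : {finite_measure set T1 -> \bar R}) (f : T1 -> T2).
Hypothesis mf : measurable_fun [set: T1] f.

Let image := pushforward m f.

Let image0 : image set0 = 0%E. Proof. exact: measure0. Qed.

Let image_ge0 A : (0 <= image A)%E. Proof. exact: measure_ge0. Qed.

Let image_sigma_additive : semi_sigma_additive image.
Proof. exact: measure_semi_sigma_additive. Qed.

HB.instance Definition _ := isMeasure.Build _ _ _ image
  image0 image_ge0 image_sigma_additive.

Let image_finite : fin_num_fun image.
Proof.
move=> A mA; apply: fin_num_measure.
by rewrite -[X in measurable X]setTI; exact: mf.
Qed.

HB.instance Definition _ := @Measure_isFinite.Build _ _ _ image image_finite.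

Definition finite_pushforward : {finite_measure set T2 -> \bar R} := image.

Lemma finite_pushforwardE A : finite_pushforward A = m (f @^-1` A).
Proof. by []. Qed.

End FinitePushforward.

(** * From a positive functional to a measure *)

Section Representation.
Variables (R : realType) (n : nat).
Local Notation C := R[i].
Local Notation Cn := 'rV[R[i]]_n.
Variables (S : set Cn) (z0 : Cn) (A : nat -> set Cn) (L : (Cn -> R) -> R).
Hypothesis Sz0 : S z0.
Hypothesis S_closed : forall z : Cn,
  (forall e : R, 0 < e -> exists2 w : Cn, S w & forall i, cabs (w ord0 i - z ord0 i) < e) -> S z.
Hypothesis mS : measurable (S : set (@borel_Cn R n)).
Hypothesis LD : forall h k, bounded_on S h -> bounded_on S k ->
  L (fun x => h x + k x) = L h + L k.
Hypothesis LZ : forall c h, bounded_on S h -> L (fun x => c * h x) = c * L h.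
Hypothesis L_ge0 : forall h, bounded_on S h -> (forall x, S x -> 0 <= h x) -> 0 <= L h.

(** The cells of a given length partition [S] according to membership in the first sets of the
    sequence [A]. *)
Fixpoint cell (s : seq bool) : set Cn :=
  if s is b :: s' then cell s' `&` (if b then A (size s') else ~` A (size s')) else S.

Definition osc_le (s : seq bool) (e : R) := forall z w : Cn, cell s z -> cell s w ->
  forall i, cabs (z ord0 i - w ord0 i) <= e.

Hypothesis fine_cells : forall e : R, 0 < e -> exists m, forall s, size s = m -> osc_le s e.

Implicit Types h k : Cn -> R.

Lemma bounded_onD h k : bounded_on S h -> bounded_on S k -> bounded_on S (fun x => h x + k x).
Proof.
move=> [K HK] [K' HK']; exists (K + K') => x Sx.
by apply: (le_trans (ler_normD _ _)); rewrite lerD ?HK ?HK'.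
Qed.

Lemma bounded_onM h k : bounded_on S h -> bounded_on S k -> bounded_on S (fun x => h x * k x).
Proof.
move=> [K HK] [K' HK']; exists (K * K') => x Sx.
by rewrite normrM ler_pM ?HK ?HK'.
Qed.

Lemma bounded_on_cst (c : R) : bounded_on S (fun=> c).
Proof. by exists `|c|. Qed.

Lemma bounded_on_indic B : bounded_on S (\1_B : Cn -> R).
Proof. by exists 1 => x _; rewrite indicE; case: (_ \in _); rewrite ?normr1 ?normr0 ?ler01. Qed.

Lemma L_le h k : bounded_on S h -> bounded_on S k -> (forall x, S x -> h x <= k x) -> L h <= L k.
Proof.
move=> bh bk hk; have b1 : bounded_on S (fun x => -1 * h x).
  by apply: bounded_onM => //; exact: bounded_on_cst.
have : 0 <= L (fun x => k x + -1 * h x).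
  apply: L_ge0; first exact: bounded_onD.
  by move=> x /hk; rewrite mulN1r subr_ge0.
by rewrite LD // LZ // mulN1r subr_ge0.
Qed.

Lemma eq_L h k : bounded_on S h -> bounded_on S k -> (forall x, S x -> h x = k x) -> L h = L k.
Proof.
by move=> bh bk hk; apply/eqP; rewrite eq_le !L_le // => x Sx; rewrite hk.
Qed.

Definition mass s : R := L (\1_(cell s)).

Lemma mass_ge0 s : 0 <= mass s.
Proof.
by apply: L_ge0; [exact: bounded_on_indic|move=> x _; rewrite indicE ler0n].
Qed.

Lemma cell_split_sum (h : Cn -> R) s x :
  h x * \1_(cell s) x = h x * \1_(cell (false :: s)) x + h x * \1_(cell (true :: s)) x.
Proof.
rewrite -mulrDr; congr (_ * _); rewrite !indicE /= !in_setI in_setC.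
by case: (x \in cell s) => //=; case: (x \in A _); rewrite /= ?addr0 ?add0r.
Qed.

Lemma L_split (h : Cn -> R) s : bounded_on S h ->
  L (fun x => h x * \1_(cell s) x) =
  L (fun x => h x * \1_(cell (false :: s)) x) + L (fun x => h x * \1_(cell (true :: s)) x).
Proof.
move=> bh; have b B := bounded_onM bh (bounded_on_indic B).
by rewrite -LD //; congr (L _); apply/funext => x; exact: cell_split_sum.
Qed.

Lemma mass_split s : mass s = mass (false :: s) + mass (true :: s).
Proof.
have := L_split s (bounded_on_cst 1).
have e B : (fun x => 1 * \1_B x) = \1_B :> (Cn -> R) by apply/funext => x; rewrite mul1r.
by rewrite !e.
Qed.

Lemma cell_root s : cell s `<=` S.
Proof. by elim: s => //= b s IH x [/IH]. Qed.

Local Notation dyadic := (dyadic mass).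
Local Notation address := (address mass).

Lemma cell_address (x : R) (k m : nat) : (k <= m)%N -> cell (address x m) `<=` cell (address x k).
Proof.
elim: m => [|m IH]; first by rewrite leqn0 => /eqP ->.
by rewrite leq_eqVlt => /predU1P[->//|/IH km]; apply: subset_trans km => z [].
Qed.

(** An empty cell has mass 0, hence an empty interval. *)
Lemma dyadic_cell s x : dyadic s x -> cell s !=set0.
Proof.
move=> /dyadicP [h1 h2]; apply/set0P/eqP => s0.
have e0 : mass s = 0.
  rewrite /mass s0 -(mul0r (L (fun=> 1))) -LZ; last exact: bounded_on_cst.
  by congr (L _); apply/funext => z; rewrite indicE in_set0 mul0r.
by move: h2; rewrite e0 addr0 ltNge h1.
Qed.

(** The cells named by the digits of [x] are nonempty and shrink, so points picked in them converge
    to a point of the closed set [S]. The limit may lie outside the cells, which need not be closed;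
    hence the conclusion is a distance estimate. Off the root interval [z0] is a default. *)
Lemma limit_point_exists x : exists z : Cn, [/\ S z,
  dyadic [::] x -> forall m e w, osc_le (address x m) e -> cell (address x m) w ->
    forall i, cabs (w ord0 i - z ord0 i) <= e & ~ dyadic [::] x -> z = z0].
Proof.
have [Dx|nDx] := pselect (dyadic [::] x); last by exists z0.
pose e j : R := j.+1%:R^-1.
have e0 j : 0 < e j by rewrite invr_gt0 ltr0n.
have [M HM] := choice (fun j => fine_cells (e0 j)).
have [u Hu] := choice (fun j => dyadic_cell
  (address_dyadic mass_split (M j) Dx)).
have ue (j j' : nat) i : cabs (u j ord0 i - u j' ord0 i) <= e j + e j'.
  have [jk|/ltnW kj] := leqP (M j) (M j').
    apply: (@le_trans _ _ (e j)); last by rewrite lerDl ltW.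
    by apply: HM (size_address _ _ _) _ _ _ _ _ => //; exact: cell_address jk _ _.
  apply: (@le_trans _ _ (e j')); last by rewrite lerDr ltW.
  by apply: HM (size_address _ _ _) _ _ _ _ _ => //; exact: cell_address kj _ _.
have [l Hl] := choice (fun i => csandwich_lim (fun j j' => ue j j' i)).
have small (c d : R) : 0 < d -> 0 <= c -> exists j, c * e j < d.
  move=> d0 c0; have [j _ Hj] := near_infty_natSinv_lt (PosNum (divr_gt0 d0 (ltr_pwDr ltr01 c0))).
  exists j; have := Hj j (leqnn j); rewrite /= ltr_pdivlMr; last by lra.
  by move: (e0 j); rewrite -/(e j) => h; nra.
exists (\row_i l i); split => //.
- apply: S_closed => d d0; have [j Hj] := small 2 d d0 (ler0n _ _).
  exists (u j); first exact: cell_root (Hu j).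
  by move=> i; rewrite mxE; apply: le_lt_trans (Hl i j) Hj.
- move=> _ m d w Hd Hw i; rewrite mxE; apply/ler_addgt0Pr => g g0.
  have [j Hj] := small 3 g g0 (ler0n _ _).
  apply: (le_trans (cabs_le_dist _ (w ord0 i - u j ord0 i))).
  rewrite (_ : _ - l i - _ = u j ord0 i - l i); last by ring.
  have := Hl i j; suff : cabs (w ord0 i - u j ord0 i) <= d + e j by rewrite -/(e j); lra.
  have [mj|/ltnW jm] := leqP m (M j).
    apply: (@le_trans _ _ d); last by rewrite lerDl ltW.
    by apply: Hd => //; exact: cell_address mj _ _.
  have d0 : 0 <= d by apply: le_trans (Hd w w Hw Hw i); rewrite cabs_ge0.
  apply: (@le_trans _ _ (e j)); last by rewrite lerDr.
  by apply: HM (size_address _ _ _) _ _ _ _ _ => //; exact: cell_address jm _ _.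
Qed.

Section Points.
Variable X : R -> Cn.
Hypothesis XS : forall x, S (X x).
Hypothesis X_near : forall x, dyadic [::] x -> forall m e w, osc_le (address x m) e ->
  cell (address x m) w -> forall i, cabs (w ord0 i - X x ord0 i) <= e.
Hypothesis X_out : forall x, ~ dyadic [::] x -> X x = z0.

(** The preimage of an open set is a union of intervals of the countable family, together with the
    complement of the root interval when [z0] lies in the open set. *)
Lemma measurable_points :
  measurable_fun setT (X : measurableTypeR R -> @borel_Cn R n).
Proof.
apply: (@measurability _ _ (measurableTypeR R) (@borel_Cn R n) setT X (@open Cn)) => //.
move=> _ [U oU <-]; rewrite setTI.
pose V := \bigcup_(s in [set: seq bool])
  (if `[< dyadic s `<=` X @^-1` U >] then dyadic s else set0).
pose W := if `[< U z0 >] then ~` dyadic [::] else set0.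
have -> : X @^-1` U = V `|` W.
  apply/seteqP; split=> [x Ux|x [[s _]|]]; last 2 first.
  - by case: asboolP => // sU /sU.
  - by rewrite /W; case: asboolP => // Uz0 nDx; rewrite /preimage /= (X_out nDx).
  have [Dx|nDx] := pselect (dyadic [::] x); last first.
    by right; rewrite /W -(X_out nDx) asboolT.
  have /nbhs_coordP [d d0 Hd] : nbhs (X x) U by apply: open_nbhs_nbhs.
  (* For [y] in the same interval as [x], both images are within [d / 4] of a common point of the
     cell. *)
  have d40 : 0 < d / 4 by rewrite divr_gt0.
  have [m Hm] := fine_cells d40.
  left; exists (address x m) => //; rewrite asboolT; first exact: (address_dyadic mass_split m Dx).
  move=> y Dy; apply: Hd => i.
  have Oy : osc_le (address x m) (d / 4) by apply: Hm; rewrite size_address.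
  have ay : address y m = address x m.
    by rewrite -[in LHS](size_address mass x m) (dyadic_address mass_ge0 mass_split Dy).
  have [w Hw] := dyadic_cell Dy.
  have h1 := X_near Dx Oy Hw i.
  have h2 : cabs (w ord0 i - X y ord0 i) <= d / 4.
    apply: (@X_near y _ m); rewrite ?ay //.
    exact: (dyadic_root mass_ge0 mass_split Dy).
  apply: (le_lt_trans (cabs_le_dist _ (w ord0 i - X x ord0 i))).
  rewrite (_ : _ - _ - _ = - (w ord0 i - X y ord0 i)); last by ring.
  by rewrite cabsN; lra.
apply: measurableU; last first.
  by rewrite /W; case: asboolP => // _; apply: measurableC; exact: measurable_dyadic.
apply: countable_bigcupT_measurable; first exact: countableP.
by move=> s; case: asboolP => // _; exact: measurable_dyadic.
Qed.

Let finite_root : (lebesgue_measure (dyadic [::] : set (measurableTypeR R)) < +oo)%E.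
Proof. by rewrite (dyadic_measure mass_ge0) ltry. Qed.

Let nu : {finite_measure set (measurableTypeR R) -> \bar R} :=
  mfrestr (measurable_dyadic mass [::]) finite_root.

Let nu_dyadic s : nu (dyadic s) = (mass s)%:E.
Proof.
rewrite /nu /= /mfrestr /mrestr setIidl ?(dyadic_measure mass_ge0) //.
exact: (dyadic_root mass_ge0 mass_split).
Qed.

Let nu_out : nu (~` dyadic [::]) = 0%E.
Proof. by rewrite /nu /= /mfrestr /mrestr setICl measure0. Qed.

Definition point_measure : {finite_measure set (@borel_Cn R n) -> \bar R} :=
  finite_pushforward nu measurable_points.

Lemma point_measure_out : point_measure (~` S) = 0%E.
Proof.
rewrite finite_pushforwardE (_ : _ @^-1` _ = set0) ?measure0 //.
by apply/seteqP; split=> // x /= /(_ (XS x)).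
Qed.

Variable h : Cn -> R.
Hypothesis bh : bounded_on S h.
Hypothesis mh : measurable_fun setT (h : @borel_Cn R n -> R).
Hypothesis uh : forall e : R, 0 < e -> exists2 d : R, 0 < d & forall z w : Cn, S z -> S w ->
  (forall i, cabs (z ord0 i - w ord0 i) <= d) -> `|h z - h w| <= e.

Let hX (x : measurableTypeR R) : R := h (X x).

Let measurable_hX D : measurable_fun D hX.
Proof.
by apply: measurable_funTS; apply: (measurableT_comp mh); exact: measurable_points.
Qed.

Let integrable_hX (D : set (measurableTypeR R)) : measurable D -> nu.-integrable D (EFin \o hX).
Proof.
move=> mD; apply: measurable_bounded_integrable => //.
  by rewrite ltey_eq fin_num_measure.
have [K HK] := bh; exists K; split; rewrite ?num_real // => x kx u _.
by apply: le_trans (ltW kx); exact: HK.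
Qed.

(** On a small cell, the integral [Phi s] and the value [Lam s] are both within [e * mass s] of
    [h w * mass s]. Both are additive under splitting and so is the mass, so the errors add up to at
    most [2 * e * mass [::]] at the root. *)
Lemma integral_point_measure : \int[point_measure]_(u in S) h u = L h.
Proof.
pose Phi s := \int[nu]_(x in dyadic s) hX x.
pose Lam s := L (fun x => h x * \1_(cell s) x).
have Phi_split s : Phi s = Phi (false :: s) + Phi (true :: s).
  rewrite /Phi (dyadic_split mass_ge0 mass_split) Rintegral_setU //;
    try exact: measurable_dyadic.
    by apply: integrable_hX; apply: measurableU; exact: measurable_dyadic.
  exact: dyadic_disj.
have bI (k : Cn -> R) (B : set Cn) : bounded_on S k -> bounded_on S (fun x => k x * \1_B x).
  by move=> bk; apply: bounded_onM => //; exact: bounded_on_indic.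
have base (e : R) : 0 < e -> exists m, forall s, size s = m -> `|Phi s - Lam s| <= 2 * e * mass s.
  move=> e0; have [d d0 Hd] := uh e0.
  have [m Hm] := fine_cells d0; exists m => s sm; have Os := Hm _ sm.
  have [[w Hw]|nw] := pselect (exists w, cell s w); last first.
    have D0 : dyadic s = set0.
      by apply/seteqP; split=> // x /dyadic_cell [w Hw]; case: nw; exists w.
    have c0 : cell s = set0.
      by apply/seteqP; split=> // x Hx; case: nw; exists x.
    rewrite /Phi D0 Rintegral_set0 /Lam c0 (_ : (fun x => _) = fun x => 0 * h x).
      by rewrite LZ // mul0r subr0 normr0 mulr_ge0 ?mass_ge0 //; lra.
    by apply/funext => x; rewrite indicE in_set0 mulr0 mul0r.
  have Sw := cell_root Hw.
  have bcst (c : R) : bounded_on S (fun x => c * \1_(cell s) x).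
    by apply: (bI (fun=> c)); exact: bounded_on_cst.
  have Lcst (c : R) : L (fun x => c * \1_(cell s) x) = c * mass s.
    by rewrite LZ //; exact: bounded_on_indic.
  have l1 : Lam s <= (h w + e) * mass s.
    rewrite -Lcst; apply: L_le => // [|x Sx]; first exact: (bI h).
    rewrite indicE; case: (boolP (x \in cell s)) => [|_]; last by rewrite !mulr0.
    rewrite inE !mulr1 => cx; have := Hd x w Sx Sw (Os _ _ cx Hw).
    by rewrite ler_norml => /andP[_]; lra.
  have l2 : (h w - e) * mass s <= Lam s.
    rewrite -Lcst; apply: L_le => // [|x Sx]; first exact: (bI h).
    rewrite indicE; case: (boolP (x \in cell s)) => [|_]; last by rewrite !mulr0.
    rewrite inE !mulr1 => cx; have := Hd x w Sx Sw (Os _ _ cx Hw).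
    by rewrite ler_norml => /andP[+ _]; lra.
  have mD := measurable_dyadic mass s.
  have hXw x : dyadic s x -> `|hX x - h w| <= e.
    move=> Dx; apply: Hd => // i; rewrite -cabsN opprB.
    have Ds := dyadic_address mass_ge0 mass_split Dx.
    apply: (X_near (dyadic_root mass_ge0 mass_split Dx) (m := size s)); rewrite Ds //.
  have Icst (c : R) : nu.-integrable (dyadic s) (EFin \o (fun=> c)).
    by apply: integrable_cstR => //; have := nu_dyadic s; rewrite /= => ->; rewrite ltry.
  have Ecst (c : R) : \int[nu]_(x in dyadic s) c = c * mass s.
    by have := nu_dyadic s; rewrite Rintegral_cst //= => ->.
  have p1 : Phi s <= (h w + e) * mass s.
    rewrite -Ecst; apply: le_Rintegral => // [|x /hXw]; first exact: integrable_hX.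
    by rewrite ler_norml => /andP[_]; lra.
  have p2 : (h w - e) * mass s <= Phi s.
    rewrite -Ecst; apply: le_Rintegral => // [|x /hXw]; first exact: integrable_hX.
    by rewrite ler_norml => /andP[+ _]; lra.
  by rewrite ler_norml; apply/andP; split; lra.
(* The estimate climbs from the cells of length [m] to the root, by induction on the number of bits
   still missing. *)
have step (e : R) m : 0 < e -> (forall s, size s = m -> `|Phi s - Lam s| <= 2 * e * mass s) ->
    `|Phi [::] - Lam [::]| <= 2 * e * mass [::].
  move=> e0 Hm; suff H : forall j s, (size s + j = m)%N -> `|Phi s - Lam s| <= 2 * e * mass s.
    by apply: (H m).
  elim => [|j IH] s sj; first by apply: Hm; rewrite -sj addn0.
  rewrite Phi_split /Lam (L_split _ bh) mass_split opprD addrACA mulrDr.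
  by apply: le_trans (ler_normD _ _) _; apply: lerD; apply: IH; rewrite /= addSnnS.
have PhiLam : Phi [::] = Lam [::].
  apply/eqP; rewrite -subr_eq0 -normr_le0; apply/ler_addgt0Pr => e e0; rewrite add0r.
  have M0 := mass_ge0 [::]; have M1 : 0 < 2 * (mass [::] + 1) by lra.
  have [m Hm] := base _ (divr_gt0 e0 M1).
  apply: le_trans (step _ _ (divr_gt0 e0 M1) Hm) _.
  rewrite (_ : 2 * _ * _ = e * (mass [::] / (mass [::] + 1))); last by field; lra.
  by apply: ler_piMr; [exact: ltW|rewrite ler_pdivrMr; lra].
have -> : L h = Lam [::].
  by apply: eq_L => //; [exact: (bI h)|move=> x Sx; rewrite indicE mem_set // mulr1].
rewrite -PhiLam /Rintegral integral_pushforward //; first last.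
- by rewrite (_ : _ @^-1` _ = setT) ?integrable_hX //; apply/seteqP; split=> // x _; exact: XS.
- exact/measurable_realfun.measurable_EFinP.
- exact: measurable_points.
rewrite (_ : _ @^-1` _ = dyadic [::] `|` ~` dyadic [::]); last first.
  by rewrite setUv; apply/seteqP; split=> // x _; exact: XS.
have mD := measurable_dyadic mass [::].
rewrite -/(Rintegral nu (dyadic [::] `|` ~` dyadic [::]) hX) Rintegral_setU //.
- rewrite [X in _ + X = _](_ : _ = 0) ?addr0 //.
  rewrite /Rintegral null_set_integral //; first exact: measurableC.
  by apply/measurable_realfun.measurable_EFinP.
- exact: measurableC.
- by apply: integrable_hX; apply: measurableU => //; exact: measurableC.
- by rewrite disj_set2E setICr.
Qed.
End Points.
End Representation.

(** * Cells of the sphere and uniformly continuous functions *)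

Section SphereCells.
Variables (R : realType) (n : nat).
Local Notation C := R[i].
Local Notation Cn := 'rV[R[i]]_n.
Local Notation Re := complex.Re.
Local Notation Im := complex.Im.
Local Notation S := (@unit_sphere R n).

Definition part (b : bool) (c : C) : R := if b then Re c else Im c.

(** A countable list of cuts: the real or imaginary part of a coordinate is compared with k/(p+1) -
    1, and these thresholds cover [-1, 1] for k <= 2(p+1). Numbers that code no cut give the empty
    set, which splits nothing. *)
Definition halfspace (m : nat) : set Cn :=
  if (unpickle m : option ('I_n * bool * (nat * nat))) is Some (i, b, (k, p))
  then [set z : Cn | (part b (z ord0 i) + 1) * p.+1%:R < k%:R] else set0.

Lemma cell_mem (A : nat -> set Cn) (s : seq bool) j (z w : Cn) : (j < size s)%N ->
  cell S A s z -> cell S A s w -> (A j z <-> A j w).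
Proof.
elim: s => //= b s IH; rewrite ltnS leq_eqVlt => /predU1P[->|/IH H] [cz hz] [cw hw].
  by case: b hz hw.
exact: H.
Qed.

Lemma sphere_coord (z : Cn) i : S z -> cabs (z ord0 i) <= 1.
Proof.
move=> /unit_sphereE H; rewrite -(@ler_pXn2r _ 2) ?nnegrE ?cabs_ge0 // expr1n -H.
by rewrite (bigD1 i) //= lerDl sumr_ge0 // => j _; rewrite sqr_ge0.
Qed.

Lemma part_le1 b (z : Cn) i : S z -> `|part b (z ord0 i)| <= 1.
Proof.
move=> /(sphere_coord i); apply: le_trans.
by case: b => /=; [exact: Re_le_cabs|exact: Im_le_cabs].
Qed.

(* If y - x > 1/(p+1), some threshold k/(p+1) - 1 separates x from y. *)
Lemma threshold_dist (x y : R) (p : nat) : -1 <= x -> y <= 1 ->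
  (forall k, (k <= 2 * p.+1)%N -> (x + 1) * p.+1%:R < k%:R -> (y + 1) * p.+1%:R < k%:R) ->
  y - x <= p.+1%:R^-1.
Proof.
move=> x1 y1 H; have p0 : 0 < p.+1%:R :> R by rewrite ltr0n.
rewrite leNgt; apply/negP => lt.
have {}lt : (x + 1) * p.+1%:R + 1 < (y + 1) * p.+1%:R.
  by move: lt; rewrite -[_^-1]mul1r ltr_pdivrMr //; lra.
have X0 : 0 <= (x + 1) * p.+1%:R by apply: mulr_ge0; [lra|exact: ltW].
have /andP[t1 t2] := Num.Theory.truncn_itv X0; set k := Num.trunc _ in t1 t2.
have ky : k.+1%:R < (y + 1) * p.+1%:R by rewrite -natr1; lra.
have := H k.+1; rewrite t2 => /(_ _ isT); rewrite ltNge (ltW ky) => h.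
suff /h : (k.+1 <= 2 * p.+1)%N by [].
by rewrite -(ler_nat R) natrM; apply: le_trans (ltW ky) _;
  apply: ler_wpM2r; [exact: ltW|lra].
Qed.

(** Finitely many cuts of mesh 1/(p+1) < e/2 suffice, all coded below some [m]; the two halves of
    [e] are for the real and the imaginary part. *)
Lemma halfspace_fine (e : R) : 0 < e -> exists m, forall s, size s = m ->
  osc_le S halfspace s e.
Proof.
move=> e0; have e20 : 0 < e / 2 by rewrite divr_gt0.
have [p Hp] : exists p : nat, p.+1%:R^-1 < e / 2.
  have [p _ Hp] := near_infty_natSinv_lt (PosNum e20).
  by exists p; exact: (Hp p (leqnn p)).
pose code (x : 'I_n * bool * 'I_(2 * p.+1).+1) := pickle (x.1, (x.2 : nat, p)).
exists (\max_x (code x).+1) => s sm z w cz cw i.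
have dist b : `|part b (z ord0 i) - part b (w ord0 i)| <= e / 2.
  have := part_le1 b i (cell_root cz); have := part_le1 b i (cell_root cw).
  rewrite !ler_norml => /andP[w1 w2] /andP[z1 z2].
  have key k : (k <= 2 * p.+1)%N ->
      ((part b (z ord0 i) + 1) * p.+1%:R < k%:R <-> (part b (w ord0 i) + 1) * p.+1%:R < k%:R).
    move=> kp; have lt : (pickle (i, b, (k, p)) < size s)%N.
      by rewrite sm (leq_bigmax (i, b, Ordinal (kp : (k < (2 * p.+1).+1)%N))).
    by have := cell_mem lt cz cw; rewrite /halfspace pickleK.
  have h1 := threshold_dist z1 w2 (fun k kp => (key k kp).1).
  have h2 := threshold_dist w1 z2 (fun k kp => (key k kp).2).
  by apply/andP; split; move: h1 h2 Hp; move: (p.+1%:R^-1) => q; lra.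
apply: le_trans (cabs_le_ReIm _) _; rewrite ReB ImB.
by have := dist true; have := dist false; rewrite /part; lra.
Qed.

Lemma continuous_sqr_norm : continuous (fun z : Cn => \sum_i cabs (z ord0 i) ^+ 2 : R^o).
Proof.
apply: (continuous_big (@add_continuous R^o)) => i _ z.
suff h : {for z, continuous (fun z : Cn => cabs (z ord0 i) : R^o)} by exact: (cvgM h h).
apply: (@continuous_comp _ _ _ (fun z : Cn => z ord0 i) (fun c : C => cabs c : R^o)).
  exact: coord_continuous.
exact: continuous_cabs.
Qed.

Lemma closed_sphere : closed S.
Proof.
have -> : S = (fun z : Cn => \sum_i cabs (z ord0 i) ^+ 2) @^-1` [set 1 : R].
  by apply/seteqP; split=> z /unit_sphereE.
apply: (@closed_comp Cn R^o _ [set 1 : R^o]) => [z _|]; last exact: closed_eq.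
exact: continuous_sqr_norm.
Qed.

Lemma measurable_sphere : measurable (S : set (@borel_Cn R n)).
Proof.
rewrite -[X in measurable X]setCK; apply: measurableC; apply: sub_sigma_algebra.
exact: closed_openC closed_sphere.
Qed.

Lemma continuous_measurable (h : Cn -> R) : continuous (h : Cn -> R^o) ->
  measurable_fun setT (h : @borel_Cn R n -> R).
Proof.
move=> /continuousP ch; apply: (measurability _ (measurable_realfun.RGenOpens.measurableE R)).
move=> _ [_ [a [b ->] <-]]; rewrite setTI; apply: sub_sigma_algebra.
exact/ch/interval_open.
Qed.

Lemma measurable_part b (i : 'I_n) :
  measurable_fun setT ((fun z : Cn => part b (z ord0 i)) : @borel_Cn R n -> R).
Proof.
apply: continuous_measurable => z.
apply/(@cvgrPdist_lt _ _ _ (nbhs z)) => e e0; apply/nbhs_coordP; exists e => // w /(_ i).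
apply: le_lt_trans; rewrite -opprB normrN -[part b (w _ _) - _](_ : part b (w ord0 i - z ord0 i) = _).
  by case: b => /=; [exact: Re_le_cabs|exact: Im_le_cabs].
by case: b => /=; rewrite ?ReB ?ImB.
Qed.

(** What [integral_point_measure] asks of a function, for both of its parts, in a form stable under
    sums, products and conjugation. *)
Definition tame (f : Cn -> C) : Prop :=
  [/\ exists K, forall u, S u -> cabs (f u) <= K,
      forall e : R, 0 < e -> exists2 d : R, 0 < d & forall z w : Cn, S z -> S w ->
        (forall i, cabs (z ord0 i - w ord0 i) <= d) -> cabs (f z - f w) <= e &
      forall b, measurable_fun setT ((fun z : Cn => part b (f z)) : @borel_Cn R n -> R)].

Lemma tame_cst (c : C) : tame (fun=> c).
Proof.
split; first by exists (cabs c).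
- by move=> e e0; exists 1 => // z w _ _ _; rewrite subrr cabs0 ltW.
- by move=> b; exact: measurable_cst.
Qed.

Lemma tame_coord (i : 'I_n) : tame (fun z => z ord0 i).
Proof.
split; first by exists 1 => u /sphere_coord.
- by move=> e e0; exists e.
- by move=> b; exact: measurable_part.
Qed.

Lemma tameD f g : tame f -> tame g -> tame (fun z => f z + g z).
Proof.
move=> [[K HK] uf mf] [[K' HK'] ug mg]; split.
- by exists (K + K') => u Su; apply: le_trans (cabsD _ _) _; rewrite lerD ?HK ?HK'.
- move=> e e0; have e2 : 0 < e / 2 by rewrite divr_gt0.
  have [d d0 Hd] := uf _ e2; have [d' d'0 Hd'] := ug _ e2.
  exists (Num.min d d'); first by rewrite lt_min d0.
  move=> z w Sz Sw zw; rewrite opprD addrACA; apply: le_trans (cabsD _ _) _.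
  rewrite [leRHS]splitr lerD ?Hd ?Hd' // => i; apply: le_trans (zw i) _.
    by rewrite ge_min lexx.
  by rewrite ge_min lexx orbT.
- move=> b; rewrite (_ : (fun _ => _) = fun z => part b (f z) + part b (g z)).
    by apply: measurable_realfun.measurable_funD; [exact: mf|exact: mg].
  by apply/funext => z; case: b; rewrite /= ?ReD ?ImD.
Qed.

Lemma tameM f g : tame f -> tame g -> tame (fun z => f z * g z).
Proof.
move=> [[K HK] uf mf] [[K' HK'] ug mg].
have M1 u : S u -> cabs (f u) <= `|K| by move/HK => h; apply: le_trans h (ler_norm _).
have M2 u : S u -> cabs (g u) <= `|K'| by move/HK' => h; apply: le_trans h (ler_norm _).
split.
- by exists (`|K| * `|K'|) => u Su; rewrite cabsM ler_pM ?cabs_ge0 ?M1 ?M2.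
- move=> e e0; pose k := `|K| + `|K'| + 1.
  have k0 : 0 < k by rewrite ltr_wpDl // addr_ge0.
  have e2 : 0 < e / k by rewrite divr_gt0.
  have [d d0 Hd] := uf _ e2; have [d' d'0 Hd'] := ug _ e2.
  exists (Num.min d d'); first by rewrite lt_min d0.
  move=> z w Sz Sw zw.
  have zf : cabs (f z - f w) <= e / k.
    by apply: Hd => // i; apply: le_trans (zw i) _; rewrite ge_min lexx.
  have zg : cabs (g z - g w) <= e / k.
    by apply: Hd' => // i; apply: le_trans (zw i) _; rewrite ge_min lexx orbT.
  rewrite (_ : _ - _ = f z * (g z - g w) + (f z - f w) * g w); last by ring.
  apply: le_trans (cabsD _ _) _; rewrite !cabsM.
  have h1 : cabs (f z) * cabs (g z - g w) <= `|K| * (e / k) by rewrite ler_pM ?cabs_ge0 ?M1.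
  have h2 : cabs (f z - f w) * cabs (g w) <= e / k * `|K'| by rewrite ler_pM ?cabs_ge0 ?M2.
  have h3 : e = e / k * k by rewrite divfK // gt_eqF.
  by rewrite [leRHS]h3 /k; move: h1 h2 e2; move: (e / k) => q; lra.
- move=> b; case: b.
    rewrite (_ : (fun _ => _) = fun z => part true (f z) * part true (g z) -
      part false (f z) * part false (g z)); last by apply/funext => z; rewrite /= ReM.
    by apply: measurable_realfun.measurable_funB; apply: measurable_realfun.measurable_funM;
      first [exact: mf|exact: mg].
  rewrite (_ : (fun _ => _) = fun z => part true (f z) * part false (g z) +
    part false (f z) * part true (g z)); last by apply/funext => z; rewrite /= ImM.
  by apply: measurable_realfun.measurable_funD; apply: measurable_realfun.measurable_funM;
    first [exact: mf|exact: mg].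
Qed.

Lemma tame_mono (a : multi_index n) : tame (fun z => mono z a).
Proof.
rewrite /mono; elim: (index_enum _) => [|i r IH].
  rewrite (_ : (fun _ => _) = fun=> 1); first exact: tame_cst.
  by apply/funext => z; rewrite big_nil.
rewrite (_ : (fun _ => _) = fun z : Cn => z ord0 i ^+ a i * \prod_(i <- r) z ord0 i ^+ a i).
  apply: tameM => //; elim: (a i) => [|k IHk]; first exact: tame_cst.
  rewrite (_ : (fun _ => _) = fun z : Cn => z ord0 i * z ord0 i ^+ k).
    by apply: tameM => //; exact: tame_coord.
  by apply/funext => z; rewrite exprS.
by apply/funext => z; rewrite big_cons.
Qed.

Lemma tame_sum (I : Type) (r : seq I) (F : I -> Cn -> C) :
  (forall i, tame (F i)) -> tame (fun z => \sum_(i <- r) F i z).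
Proof.
move=> H; elim: r => [|i r IH].
  rewrite (_ : (fun _ => _) = fun=> 0); first exact: tame_cst.
  by apply/funext => z; rewrite big_nil.
rewrite (_ : (fun _ => _) = fun z => F i z + \sum_(j <- r) F j z); first exact: tameD.
by apply/funext => z; rewrite big_cons.
Qed.

Lemma tameJ f : tame f -> tame (fun z => (f z)^*).
Proof.
move=> [[K HK] uf mf]; split.
- by exists K => u /HK; rewrite cabsJ.
- move=> e /uf [d d0 Hd]; exists d => // z w Sz Sw zw.
  by rewrite -rmorphB cabsJ; exact: Hd.
- case; first by rewrite (_ : (fun _ => _) = fun z => part true (f z)) //;
    apply/funext => z; rewrite /= ReJ.
  rewrite (_ : (fun _ => _) = fun z => - part false (f z)).
    by apply: measurableT_comp; [exact: measurable_realfun.oppr_measurable|exact: mf].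
  by apply/funext => z; rewrite /= ImJ.
Qed.

End SphereCells.

(** * The moment theorem on the sphere *)

Section Moments.
Variables (R : realType) (n : nat).
Local Notation C := R[i].
Local Notation Cn := 'rV[R[i]]_n.
Local Notation Re := complex.Re.
Local Notation Im := complex.Im.
Local Notation S := (@unit_sphere R n).
Hypothesis n_gt0 : (0 < n)%N.

Lemma sphere_nonempty : exists z : Cn, S z.
Proof.
case: n n_gt0 => // m _; exists (delta_mx ord0 ord0); apply/unit_sphereE.
rewrite big_ord_recl big1 => [|i _]; rewrite mxE /= ?cabs1 ?cabs0 ?expr0n ?expr1n ?addr0 //.
Qed.

Lemma sphere_limit (z : Cn) :
  (forall e : R, 0 < e -> exists2 w : Cn, S w & forall i, cabs (w ord0 i - z ord0 i) < e) -> S z.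
Proof.
move=> H; apply: (@closed_sphere R n) => B /nbhs_coordP [d d0 Bd].
by have [w Sw Hw] := H _ d0; exists w; split=> //; exact: Bd.
Qed.

Local Notation poly := (seq (C * multi_index n)).

(** A polynomial is a list of terms in which a multi-index may be repeated, so that addition is
    concatenation. *)
Definition peval (p : poly) (u : Cn) : C := \sum_(x <- p) x.1 * mono u x.2.

Lemma tame_peval p : tame (peval p).
Proof.
by apply: tame_sum => x; apply: tameM; [exact: tame_cst|exact: tame_mono].
Qed.

Lemma tame_bounded_on b f : tame f -> bounded_on S (fun u : Cn => part b (f u)).
Proof.
move=> [[K HK] _ _]; exists K => u /HK; apply: le_trans.
by case: b => /=; [exact: Re_le_cabs|exact: Im_le_cabs].
Qed.

Variable lam : multi_index n -> C.

Definition pmoment (p : poly) : C := \sum_(x <- p) x.1 * lam x.2.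

Hypothesis lam_ge0 : forall p, (forall u, S u -> 0 <= Re (peval p u)) -> 0 <= Re (pmoment p).

(** A graph, because several polynomials may have the same real part on the sphere; positivity
    forces their values to agree. *)
Let G0 : set ((Cn -> R) * R) := [set q | exists p : poly,
  q = (fun u => Re (peval p u), Re (pmoment p))].

Lemma peval_cat p q u : peval (p ++ q) u = peval p u + peval q u.
Proof. by rewrite /peval big_cat. Qed.

Lemma pevalZ (c : C) (p : poly) u :
  peval [seq (c * x.1, x.2) | x <- p] u = c * peval p u.
Proof. by rewrite /peval big_map mulr_sumr; apply: eq_bigr => x _; rewrite mulrA. Qed.

Lemma pmoment_cat p q : pmoment (p ++ q) = pmoment p + pmoment q.
Proof. by rewrite /pmoment big_cat. Qed.

Lemma pmomentZ (c : C) (p : poly) : pmoment [seq (c * x.1, x.2) | x <- p] = c * pmoment p.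
Proof. by rewrite /pmoment big_map mulr_sumr; apply: eq_bigr => x _; rewrite mulrA. Qed.

Lemma G0_positive : positive_graph S G0.
Proof.
split.
- move=> _ _ _ _ [p [-> ->]] [q [-> ->]]; exists (p ++ q).
  by rewrite pmoment_cat ReD; congr pair; apply/funext => u; rewrite peval_cat ReD.
- move=> k _ _ [p [-> ->]]; exists [seq (k%:C * x.1, x.2) | x <- p].
  by rewrite pmomentZ ReM /= mul0r subr0; congr pair; apply/funext => u;
    rewrite pevalZ ReM /= mul0r subr0.
- by move=> _ _ [p [-> ->]]; exact: lam_ge0.
Qed.

Lemma G0_one : G0 (fun=> 1, Re (lam [ffun=> 0%N])).
Proof.
exists [:: (1, [ffun=> 0%N])]; rewrite /pmoment big_seq1 mul1r; congr pair.
apply/funext => u; rewrite /peval big_seq1 mul1r /mono big1 // => i _.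
by rewrite ffunE expr0.
Qed.

(** Positivity involves only real parts of polynomials. The extended functional is represented by a
    measure, and since [lam] acts complex linearly on polynomials, the real parts determine the
    complex moments. *)
Theorem moment_measure : exists mu : {finite_measure set (@borel_Cn R n) -> \bar R},
  mu (~` S) = 0%E /\ forall a, cint mu S (fun u : Cn => mono u a) = lam a.
Proof.
have [G [pG G0G Gfull]] := positive_extension G0_positive G0_one.
have [L HL] : exists L : (Cn -> R) -> R, forall h, bounded_on S h -> G (h, L h).
  exists (fun h => xget 0 [set r | G (h, r)]) => h /Gfull [r Hr].
  exact: (@xgetPex _ 0 [set r | G (h, r)]) (ex_intro _ r Hr).
have [addG sclG posG] := pG.
have LD h k : bounded_on S h -> bounded_on S k -> L (fun x => h x + k x) = L h + L k.
  move=> bh bk; apply: (positive_graph_eq pG (h1 := fun x => h x + k x)).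
  - by apply: HL; exact: bounded_onD.
  - by apply: addG; exact: HL.
  - by [].
have LZ c h : bounded_on S h -> L (fun x => c * h x) = c * L h.
  move=> bh; apply: (positive_graph_eq pG (h1 := fun x => c * h x)).
  - by apply: HL; apply: bounded_onM => //; exact: bounded_on_cst.
  - by apply: sclG; exact: HL.
  - by [].
have L_ge0 h : bounded_on S h -> (forall x, S x -> 0 <= h x) -> 0 <= L h.
  by move=> bh; apply: posG; exact: HL.
have [z0 Sz0] := sphere_nonempty.
have [X HX] := choice (limit_point_exists Sz0 sphere_limit LD LZ (@halfspace_fine R n)).
have XS x : S (X x) by have [] := HX x.
have X_near x : dyadic (mass S (@halfspace R n) L) [::] x -> forall m e w,
    osc_le S (@halfspace R n) (address (mass S (@halfspace R n) L) x m) e ->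
    cell S (@halfspace R n) (address (mass S (@halfspace R n) L) x m) w ->
    forall i, cabs (w ord0 i - X x ord0 i) <= e.
  by move=> Dx; have [_ H _] := HX x; exact: H Dx.
have X_out x : ~ dyadic (mass S (@halfspace R n) L) [::] x -> X x = z0.
  by move=> Dx; have [_ _ H] := HX x; exact: H Dx.
pose fineA := @halfspace_fine R n.
exists (point_measure LD LZ L_ge0 fineA X_near X_out).
split; first exact: point_measure_out.
have Ire (p : poly) : \int[point_measure LD LZ L_ge0 fineA X_near X_out]_(u in S) Re (peval p u) =
    Re (pmoment p).
  have [bp up mp] := tame_peval p.
  have bh : bounded_on S (fun u => Re (peval p u)) by exact: (tame_bounded_on true (tame_peval p)).
  rewrite (integral_point_measure (@measurable_sphere R n) LD LZ L_ge0 fineA XS X_near X_out bh (mp true)).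
    apply: (positive_graph_eq pG (HL _ bh) _ (h2 := fun u => Re (peval p u))) => //.
    by apply: G0G; exists p.
  move=> e /up [d d0 Hd]; exists d => // z w Sz Sw zw.
  by rewrite -ReB; apply: le_trans (Re_le_cabs _) _; exact: Hd.
move=> a; apply: complex_ext => /=.
  have := Ire [:: (1, a)]; rewrite /pmoment big_seq1 mul1r => <-.
  by congr Rintegral; apply/funext => u; rewrite /peval big_seq1 mul1r.
(* Multiplication by -i turns the imaginary part of the moment into a real part. *)
have ReNi (c : C) : Re ((0 +i* (-1)) * c) = Im c by rewrite ReM /=; ring.
have := Ire [:: (0 +i* (-1), a)]; rewrite /pmoment big_seq1 ReNi => <-.
by congr Rintegral; apply/funext => u; rewrite /peval big_seq1 ReNi.
Qed.

End Moments.

(** * The maximum principle and representing measures for points *)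

Section MaximumPrinciple.
Variables (R : realType) (n : nat).
Local Notation C := R[i].
Local Notation Cn := 'rV[R[i]]_n.
Local Notation Re := complex.Re.
Local Notation Im := complex.Im.
Local Notation S := (@unit_sphere R n).
Hypothesis n_gt0 : (0 < n)%N.

Lemma mono_scale (c : C) (u : Cn) (a : multi_index n) :
  mono (c *: u) a = c ^+ mi_abs a * mono u a.
Proof.
rewrite /mono /mi_abs -prodrXr -big_split /=; apply: eq_bigr => i _.
by rewrite mxE exprMn.
Qed.

Lemma cdiffX (f : C -> C) z k : cdiff f z -> cdiff (fun w => f w ^+ k) z.
Proof.
move=> df; elim: k => [|k IH]; first exact: cdiff_cst.
by rewrite (_ : (fun _ => _) = fun w => f w * f w ^+ k); [exact: cdiffM|
  apply/funext => w; rewrite exprS].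
Qed.

Lemma cdiff_peval (p : seq (C * multi_index n)) (u : Cn) z :
  cdiff (fun c : C => peval p (c *: u)) z.
Proof.
elim: p => [|x p IH].
  rewrite (_ : (fun _ => _) = fun=> 0); first exact: cdiff_cst.
  by apply/funext => c; rewrite /peval big_nil.
rewrite (_ : (fun _ => _) = fun c : C => (x.1 * mono u x.2) * c ^+ mi_abs x.2 + peval p (c *: u)).
  apply: cdiffD => //; apply: cdiffM; first exact: cdiff_cst.
  by apply: (cdiffX (f := id)); exact: cdiff_id.
by apply/funext => c; rewrite /peval big_cons mono_scale mulrCA mulrC.
Qed.

(* Cauchy's estimate loses a constant; applying it to powers removes it. *)
Lemma disc_max (f : C -> C) (A : R) (z : C) : (forall w, cdiff f w) ->
  (forall w, cabs w = 1 -> cabs (f w) <= A) -> cabs z < 1 -> cabs (f z) <= A.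
Proof.
move=> df fA z1; have A0 : 0 <= A.
  by apply: le_trans (fA 1 (cabs1 _)); exact: cabs_ge0.
have H m : cabs (f z) ^+ m <= A ^+ m * (2 * (1 - cabs z)^-1).
  have [a [_ Ha]] := @cauchy_coef R (fun w => f w ^+ m) 2 1 (A ^+ m)
    (fun w _ => cdiffX m (df w)) ltr01 (ltr1n _ 2)
    (fun w w1 => ltac:(rewrite cabsX; apply: lerXn2r; rewrite ?nnegrE ?cabs_ge0 ?fA //)).
  have := Ha z z1 0%N; rewrite big_ord0 subr0 cabsX expr0 mulr1 mul1r => h.
  by apply: le_trans h _; rewrite le_eqVlt; apply/orP; left; apply/eqP; ring.
rewrite leNgt; apply/negP => lt; have q0 : 0 < cabs (f z) by apply: le_lt_trans lt.
have q1 : A / cabs (f z) < 1 by rewrite ltr_pdivrMr // mul1r.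
have [k0 Hk] := geo_small (2 * (1 - cabs z)^-1) (divr_ge0 A0 (ltW q0)) q1 ltr01.
have := Hk k0 (leqnn _); rewrite expr_div_n mulrA ltr_pdivrMr ?exprn_gt0 // mul1r mulrC.
by rewrite ltNge H.
Qed.

Lemma ball_polar (w : Cn) : unit_ball w ->
  exists u : Cn, exists r : R, [/\ S u, 0 <= r, r < 1 & w = r%:C *: u].
Proof.
move=> /unit_ballE; set q := \sum_i _ => q1.
have q0 : 0 <= q by apply: sumr_ge0 => i _; rewrite sqr_ge0.
have [z|qn] := eqVneq q 0.
  have [u Su] := sphere_nonempty R n_gt0; exists u, 0; split => //.
  rewrite scale0r; apply/rowP => i; rewrite mxE; apply/eqP; rewrite -cabs_eq0 -sqrf_eq0.
  move/eqP: z; rewrite psumr_eq0 => [/allP/(_ i)|j _]; last by rewrite sqr_ge0.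
  by rewrite mem_index_enum; apply.
have qp : 0 < Num.sqrt q by rewrite sqrtr_gt0 lt_neqAle eq_sym qn.
exists ((Num.sqrt q)^-1%:C *: w), (Num.sqrt q); split.
- apply/unit_sphereE; rewrite (eq_bigr (fun i => q^-1 * cabs (w ord0 i) ^+ 2)).
    by rewrite -mulr_sumr -/q mulVf.
  by move=> i _; rewrite mxE cabsM exprMn cabs_ge0R ?invr_ge0 ?ltW // exprVn sqr_sqrtr.
- exact: ltW.
- by rewrite -(@ltr_pXn2r _ 2) ?nnegrE ?ltW // sqr_sqrtr // expr1n.
- by rewrite scalerA -rmorphM mulfV ?gt_eqF // scale1r.
Qed.

(** On the circle spanned by a point of the sphere, Re f >= 0 and |f| <= K give |t - f|^2 <= t^2 +
    K^2. The maximum principle carries this inside the disc, where it yields -2 t Re f <= K^2; as t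
    grows, Re f cannot be negative. *)
Lemma re_ge0_of_sphere (p : seq (C * multi_index n)) (w : Cn) :
  (forall u, S u -> 0 <= Re (peval p u)) -> unit_ball w -> 0 <= Re (peval p w).
Proof.
move=> p0 bw.
have [u [r [Su r0 r1 ->]]] := ball_polar bw.
pose f (c : C) := peval p (c *: u).
have circle c : cabs c = 1 -> S (c *: u).
  move=> c1; apply/unit_sphereE; move/unit_sphereE: Su => <-.
  by apply: eq_bigr => i _; rewrite mxE cabsM c1 mul1r.
have [[K HK] _ _] := tame_peval p.
have key (t : R) : 0 < t -> - Re (f r%:C) * (2 * t) <= K ^+ 2.
  move=> t0.
  have : cabs (t%:C - f r%:C) <= Num.sqrt (t ^+ 2 + K ^+ 2).
    apply: (@disc_max (fun c => t%:C - f c)).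
    - by move=> c; apply: cdiffB; [exact: cdiff_cst|exact: cdiff_peval].
    - move=> c c1; have Sc := circle c c1; have := HK _ Sc; have := p0 _ Sc.
      rewrite -/(f c) => a1 a2.
      rewrite -(@ler_pXn2r _ 2) ?nnegrE ?cabs_ge0 ?sqrtr_ge0 //.
      rewrite sqr_sqrtr ?addr_ge0 ?sqr_ge0 // sqr_cabs ReB ImB /=.
      have : cabs (f c) ^+ 2 <= K ^+ 2.
        by rewrite lerXn2r // nnegrE ?cabs_ge0 // (le_trans _ a2) ?cabs_ge0.
      by rewrite sqr_cabs; have : 0 <= t * Re (f c); [rewrite mulr_ge0 // ltW|nra].

    - by rewrite cabs_ge0R.
  rewrite -(@ler_pXn2r _ 2) ?nnegrE ?cabs_ge0 ?sqrtr_ge0 //.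
  rewrite sqr_sqrtr ?addr_ge0 ?sqr_ge0 // sqr_cabs ReB ImB /=.
  by have := sqr_ge0 (Re (f r%:C)); have := sqr_ge0 (0 - Im (f r%:C)); nra.
rewrite leNgt; apply/negP => neg.
have n0 : 0 < - Re (f r%:C) by rewrite oppr_gt0.
(* With this t, the left side of [key] is 2 K^2 plus a positive number. *)
have t0 : 0 < K ^+ 2 / - Re (f r%:C) + 1 by rewrite ltr_wpDl // divr_ge0 ?sqr_ge0 // ltW.
have := key _ t0; have : K ^+ 2 / - Re (f r%:C) * - Re (f r%:C) = K ^+ 2.
  by rewrite divfK // gt_eqF.
have := sqr_ge0 K; move: (K ^+ 2) => k; move: (k / _) => q; move: n0; move: (- Re _) => x.
by nra.
Qed.

(** Evaluation at [w] is a positive functional on polynomials, so the moment theorem applies to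
    it. *)
Lemma poisson_measure (w : Cn) : unit_ball w ->
  exists mu : {finite_measure set (@borel_Cn R n) -> \bar R},
  mu (~` S) = 0%E /\ forall a, cint mu S (fun u : Cn => mono u a) = mono w a.
Proof.
by move=> bw; apply: (@moment_measure R n n_gt0 (mono w)) => p p0; exact: (re_ge0_of_sphere p0 bw).
Qed.

End MaximumPrinciple.

(** * Functions of class M^+ *)

Section Tails.
Variables (R : realType) (n : nat).
Local Notation C := R[i].

Lemma sum_notin_box (v : multi_index n -> C) (s M : R) N (X : seq (multi_index n)) : 1 <= s -> uniq X ->
  \sum_(a <- X) cabs (v a) * s ^+ mi_abs a <= M ->
  (\sum_(a <- X | a \notin box N) cabs (v a)) * s ^+ N <= M.
Proof.
move=> s1 uX; apply: le_trans; rewrite mulr_suml big_mkcond; apply: ler_sum => a _.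
have s0 : 0 <= s by apply: le_trans s1; exact: ler01.
case: ifP => [|_]; last by rewrite mulr_ge0 ?cabs_ge0 ?exprn_ge0.
rewrite mem_box => /forallPn[j]; rewrite -leqNgt => Nj.
apply: ler_wpM2l; first exact: cabs_ge0.
by apply: ler_weXn2l => //; apply: leq_trans Nj _; rewrite /mi_abs (bigD1 j) //= leq_addr.
Qed.

(** An index outside [box N] has an entry at least N, hence total degree at least N. A bound with
    weights [s ^+ mi_abs a] thus gives a tail of order s^-N, uniform in any parameter of [v] that
    leaves [M] fixed. *)
Lemma has_sum_tail (v : multi_index n -> C) V (s M : R) : 1 <= s ->
  (forall N, \sum_(a <- box N) cabs (v a) * s ^+ mi_abs a <= M) -> has_sum v V ->
  forall N, cabs (\sum_(a <- box N) v a - V) * s ^+ N <= M.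
Proof.
move=> s1 HM [_ Hv] N; have s0 : 0 < s by apply: lt_le_trans s1; exact: ltr01.
have sN : 0 < s ^+ N by rewrite exprn_gt0.
rewrite -ler_pdivlMr //; apply/ler_addgt0Pr => e e0.
have [N0 HN0] := Hv e e0; pose N1 := maxn N N0.
have := HN0 N1 (leq_maxr _ _).
rewrite (sum_sub_seq _ (box_uniq N) (box_uniq N1) (box_sub (leq_maxl _ _))).
set A := \sum_(a <- box N) v a; set B := \sum_(a <- _ | _) _ => h.
have hB : cabs B <= M / s ^+ N.
  rewrite ler_pdivlMr //; apply: (le_trans _ (sum_notin_box N s1 (box_uniq N1) (HM N1))).
  by apply: ler_wpM2r; [exact: ltW|exact: cabs_sum].
rewrite (_ : A - V = (A + B - V) - B); last by ring.
by apply: le_trans (cabsB _ _) _; rewrite addrC lerD // ltW.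
Qed.

Lemma cabs_mulX (s : R) k (x y : C) : 0 <= s ->
  cabs (x * (s%:C ^+ k * y)) = cabs (x * y) * s ^+ k.
Proof. by move=> s0; rewrite mulrCA (cabsM (s%:C ^+ k)) cabsX cabs_ge0R // mulrC. Qed.

Lemma rmono_scale (s : R) (x : 'I_n -> R) (a : multi_index n) :
  rmono (fun i => s * x i) a = s ^+ mi_abs a * rmono x a.
Proof.
rewrite /rmono /mi_abs -prodrXr -big_split /=; apply: eq_bigr => i _.
by rewrite exprMn.
Qed.

End Tails.

(** * Integrating the kernel expansion over the sphere *)

Section SphereIntegral.
Variables (R : realType) (n : nat).
Local Notation C := R[i].
Local Notation Cn := 'rV[R[i]]_n.
Local Notation Re := complex.Re.
Local Notation Im := complex.Im.
Local Notation S := (@unit_sphere R n).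
Local Notation B := (@unit_ball R n).
Hypothesis n_gt0 : (0 < n)%N.

Lemma sphere_cball (u : Cn) : S u -> cball u.
Proof. by move=> /unit_sphereE h; rewrite /cball /= h. Qed.

Lemma ball_dilate (z : Cn) : B z -> exists2 s : R, 1 < s & B (s%:C *: z).
Proof.
(* The dilation factor is [2 - r], because (2 - r) r = 1 - (1 - r)^2 < 1. *)
move=> /(ball_polar n_gt0) [u [r [Su r0 r1 ->]]]; exists (2 - r); first lra.
apply/unit_ballE; rewrite (eq_bigr (fun i => ((2 - r) * r) ^+ 2 * cabs (u ord0 i) ^+ 2)).
  move/unit_sphereE: Su => Su; rewrite -mulr_sumr Su mulr1 expr_lt1 //; last nra.
  by nra.
move=> i _; rewrite !mxE !cabsM !cabs_ge0R //; last lra.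
by rewrite mulrA exprMn.
Qed.

Variable mu : {finite_measure set (@borel_Cn R n) -> \bar R}.

Lemma sphere_fin : (mu S < +oo)%E.
Proof. by rewrite ltey_eq fin_num_measure //; exact: measurable_sphere. Qed.

(** Measurability passes to the pointwise limit, and integrability follows from the bound and the
    finiteness of the measure. *)
Lemma tame_limit_integrable (f : nat -> Cn -> C) (g : Cn -> C) (K : R) :
  (forall N, tame (f N)) -> (forall u, S u -> cabs (g u) <= K) ->
  (forall u, S u -> forall e : R, 0 < e -> exists N0, forall N, (N0 <= N)%N ->
     cabs (f N u - g u) < e) -> cintegrable mu S g.
Proof.
move=> tf gK cf.
have H b : mu.-integrable S (EFin \o (fun u : Cn => part b (g u))).
  apply: measurable_bounded_integrable; first exact: measurable_sphere.
  - exact: sphere_fin.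
  - apply: (@measurable_realfun.measurable_fun_cvg _ (@borel_Cn R n) R S
      (fun N (u : @borel_Cn R n) => part b (f N u)) (fun u : @borel_Cn R n => part b (g u))).
      by move=> N; apply: measurable_funTS; have [_ _] := tf N; apply.
    move=> u Su; apply/cvgrPdist_lt => e e0; have [N0 HN] := cf u Su e e0.
    exists N0 => // N /HN; apply: le_lt_trans; rewrite -normrN opprB.
    by case: b => /=; rewrite -?ReB -?ImB; [exact: Re_le_cabs|exact: Im_le_cabs].
  - exists K; split; rewrite ?num_real // => x Kx u Su; apply: le_trans (ltW Kx).
    apply: le_trans (gK u Su).
    by case: b => /=; [exact: Re_le_cabs|exact: Im_le_cabs].
by split; [exact: (H true)|exact: (H false)].
Qed.

Lemma tame_integrable f : tame f -> cintegrable mu S f.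
Proof.
move=> tf; have [[K HK] _ _] := tf.
by apply: (@tame_limit_integrable (fun=> f) f K) => // u Su e e0; exists 0%N => N _; rewrite subrr cabs0.
Qed.

Lemma tame_kcoef a : tame (fun u : Cn => kcoef u a).
Proof. by apply: tameM; [exact: tame_cst|apply: tameJ; exact: (tame_mono R)]. Qed.

Definition kmoment (a : multi_index n) : C := cint mu S (fun u : Cn => kcoef u a).

Lemma kmomentE a : kmoment a = (mi_abs a)`!%:R / (mi_fact a)%:R * (cint mu S (fun u : Cn => mono u a))^*.
Proof.
have ti := tame_integrable (tame_mono R a).
rewrite /kmoment /kcoef cintZ ?cintJ //; try exact: measurable_sphere.
by apply: cintegrableJ => //; exact: measurable_sphere.
Qed.

Section Point.
Variable z : Cn.
Hypothesis Bz : B z.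

(** A slight dilation of [z] stays in the ball. It gains a factor [s ^+ mi_abs a] on each term,
    uniformly over the sphere, which allows the sum and the integral to be exchanged. *)
Let knl_tail : exists s M : R, [/\ 1 < s, 0 <= M &
  forall u, S u -> forall N, \sum_(a <- box N) cabs (kcoef u a * mono z a) * s ^+ mi_abs a <= M].
Proof.
have [s s1 Bs] := ball_dilate Bz.
exists s, (2 / (1 - \sum_i cabs ((s%:C *: z) ord0 i) ^+ 2)); split => //.
  by rewrite divr_ge0 // subr_ge0 ltW //; apply/unit_ballE.
move=> u Su N; apply: le_trans (knl_box_bound Bs (sphere_cball Su) N).
rewrite le_eqVlt; apply/orP; left; apply/eqP; apply: eq_bigr => a _.
by rewrite mono_scale cabs_mulX // ltW //; apply: lt_trans s1; exact: ltr01.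
Qed.

Lemma knl_integrable : cintegrable mu S (fun u : Cn => knl u z).
Proof.
have [s [M [s1 M0 HM]]] := knl_tail.
have H u : S u -> has_sum (fun a => kcoef u a * mono z a) (knl u z).
  by move=> Su; apply: (PS_knl (sphere_cball Su)).
apply: (@tame_limit_integrable (fun N (u : Cn) => \sum_(a <- box N) kcoef u a * mono z a) _ M).
- by move=> N; apply: tame_sum => a; apply: tameM; [exact: tame_kcoef|exact: tame_cst].
- move=> u Su; apply: (has_sum_bound (H u Su)) => N; apply: le_trans (HM u Su N).
  apply: le_trans (cabs_sum _ _ _) _; apply: ler_sum => a _.
  by rewrite ler_peMr ?cabs_ge0 // exprn_ege1 // ltW.
- by move=> u /H [_ +] e e0 => /(_ e e0).
Qed.

(** Integrating the uniform tail estimate gives convergence of the partial sums. Absolute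
    convergence holds because each term is at most [2 * M * m * s ^- mi_abs a]. *)
Lemma has_sum_kmoment : has_sum (fun a => kmoment a * mono z a) (cint mu S (fun u : Cn => knl u z)).
Proof.
have [s [M [s1 M0 HM]]] := knl_tail.
have s0 : 0 < s by apply: lt_trans s1; exact: ltr01.
have mS := @measurable_sphere R n.
have fS := sphere_fin; set m := fine (mu S).
have m0 : 0 <= m by rewrite fine_ge0.
have ta a : tame (fun u : Cn => kcoef u a * mono z a).
  by apply: tameM; [exact: tame_kcoef|exact: tame_cst].
have E a : kmoment a * mono z a = cint mu S (fun u : Cn => kcoef u a * mono z a).
  rewrite mulrC -cintZ //; last by apply: tame_integrable; exact: tame_kcoef.
  by congr (cint mu S _); apply/funext => u; rewrite mulrC.
split.
  exists (2 * M * m * \prod_(i < n) (1 - s^-1)^-1) => N.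
  have r01 (i : 'I_n) : 0 <= s^-1 < 1 by rewrite invr_ge0 ltW //= invf_lt1.
  apply: le_trans (ler_wpM2l _ (sum_box_geo N r01)); last by rewrite !mulr_ge0.
  rewrite mulr_sumr; apply: ler_sum => a _.
  have -> : rmono (fun _ : 'I_n => s^-1) a = s ^- mi_abs a.
    have := rmono_scale s^-1 (fun=> 1) a; rewrite mulr1 => ->.
    by rewrite exprVn /rmono big1 ?mulr1 // => i _; rewrite expr1n.
  rewrite ler_pdivlMr ?exprn_gt0 // E -[s ^+ _]cabs_ge0R ?exprn_ge0 ?(ltW s0) //.
  rewrite mulrC -cabsM -cintZ //; last exact: tame_integrable.
  apply: cint_bound => //.
    by apply: cintegrableZ => //; exact: tame_integrable.
  move=> u Su; rewrite cabsM cabs_ge0R ?exprn_ge0 ?(ltW s0) // mulrC.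
  have [N1 HN1] := seq_in_box [:: a]; apply: le_trans (HM u Su N1).
  have := @sum_sub_le R n [:: a] (box N1) (fun a => cabs (kcoef u a * mono z a) * s ^+ mi_abs a).
  rewrite big_seq1; apply=> //; last exact: box_uniq.
  by move=> b; rewrite mulr_ge0 ?cabs_ge0 ?exprn_ge0 ?(ltW s0).
have i0 : 0 <= s^-1 by rewrite invr_ge0 ltW.
have i1 : s^-1 < 1 by rewrite invf_lt1.
move=> e e0; have [N0 HN0] := geo_small (2 * M * m) i0 i1 e0.
exists N0 => N /HN0; apply: le_lt_trans.
under eq_bigr do rewrite E.
rewrite -cint_sum //; last by move=> a; exact: tame_integrable.
rewrite -cintB //; last exact: knl_integrable.
  rewrite exprVn mulrAC -[2 * M / _]mulrA; apply: cint_bound => //.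
    apply: cintegrableD => //; last by apply: cintegrableN => //; exact: knl_integrable.
    by apply: cintegrable_sum => // a; exact: tame_integrable.
  move=> u Su; rewrite ler_pdivlMr ?exprn_gt0 //; apply: has_sum_tail (HM u Su) _ _.
    exact: ltW.
  exact: PS_knl (sphere_cball Su) _ Bz.
by apply: cintegrable_sum => // a; exact: tame_integrable.
Qed.

End Point.

(** The [- 1] in the integrand and the imaginary constant touch only the constant term, which
    becomes mu(S) + it. *)
Lemma M_plus_PS (f : Cn -> C) (t : R) : (forall z, B z ->
    f z = cintegral mu S (fun u => 2 / (1 - hdot z u) - 1) + 'i * t%:C) ->
  PS B f (fun a => 2 * kmoment a + (a == [ffun=> 0%N])%:R * ('i * t%:C - (fine (mu S))%:C)).
Proof.
move=> Hf z Bz; have mS := @measurable_sphere R n.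
rewrite Hf // -[cintegral _ _ _]/(cint mu S (fun u : Cn => 2 * knl u z - 1)).
have ki := knl_integrable Bz.
rewrite cintB //; [|exact: cintegrableZ|exact: (cintegrable_cst mS sphere_fin)].
rewrite cintZ // (@cint_cst _ _ _ mu S mS) mul1r -addrA [- _ + _]addrC.
rewrite (_ : (fun _ => _) = fun a => 2 * (kmoment a * mono z a) +
  (a == [ffun=> 0%N])%:R * ('i * t%:C - (fine (mu S))%:C) * mono z a); last first.
  by apply/funext => a; ring.
apply: has_sumD; first by apply: has_sumZ; exact: has_sum_kmoment.
have := @has_sum_single R n (fun a => (a == [ffun=> 0%N])%:R *
  ('i * t%:C - (fine (mu S))%:C) * mono z a) [ffun=> 0%N].
have m1 : mono z [ffun=> 0%N] = 1 by rewrite /mono big1 // => i _; rewrite ffunE expr0.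
rewrite eqxx mul1r m1 mulr1.
by apply => a /negbTE ->; rewrite !mul0r.
Qed.

End SphereIntegral.

(** * Uniform Taylor approximation on smaller spheres *)

Section UniformBound.
Variables (R : realType) (n : nat).
Local Notation C := R[i].
Local Notation Cn := 'rV[R[i]]_n.
Local Notation Re := complex.Re.
Local Notation S := (@unit_sphere R n).
Local Notation B := (@unit_ball R n).
Implicit Types (g : Cn -> C) (c : multi_index n -> C).

(* Rounding the moduli |u_i| up to multiples of 1/K leaves finitely many
   polydiscs, all inside the ball. *)
Lemma sphere_box_bound g c (r : R) : PS B g c -> 0 <= r -> r < 1 ->
  exists M, forall u : Cn, S u -> forall N,
    \sum_(a <- box N) cabs (c a) * rmono (fun i => r * cabs (u ord0 i)) a <= M.
Proof.
move=> Hg r0 r1.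
(* Rounding |u_i| <= 1 up by at most 1/(K+1) raises the sum of squares by at most 3n/(K+1). The
   choice of [K] keeps the rounded point, scaled by [r], inside the ball. *)
have [K HK] : exists K : nat, r ^+ 2 * (1 + 3 * n%:R * K.+1%:R^-1) < 1.
  have d0 : 0 < (1 - r ^+ 2) / (3 * n%:R + 1).
    by rewrite divr_gt0 ?subr_gt0 ?expr_lt1 // ltr_wpDl ?mulr_ge0 ?ler0n.
  have [K _ HK] := near_infty_natSinv_lt (PosNum d0); exists K.
  have := HK K (leqnn K); rewrite /= ltr_pdivlMr; last by rewrite ltr_wpDl ?mulr_ge0 ?ler0n.
  have : 0 < K.+1%:R^-1 :> R by rewrite invr_gt0 ltr0n.
  have : 0 <= n%:R :> R by rewrite ler0n.
  have : r ^+ 2 <= 1 by rewrite expr_le1 // ltW.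
  have := sqr_ge0 r.
  move: (K.+1%:R^-1) (n%:R) (r ^+ 2) => x y z z0 z1 y0 x0 h.
  have : 0 <= (1 - z) * (3 * y * x) by rewrite !mulr_ge0 ?subr_ge0 // ltW.
  by nra.
pose K' : R := K.+1%:R; have K0 : 0 < K' by rewrite ltr0n.
(* The rounded numerator is a truncation of at most K+1, plus one, hence at most K+2. *)
pose pt (k : {ffun 'I_n -> 'I_(K.+3)}) : Cn := \row_i (r * ((k i)%:R / K'))%:C.
have exM k : exists m : R, B (pt k) -> forall N,
    \sum_(a <- box N) cabs (c a * mono (pt k) a) <= m.
  have [Bk|nB] := pselect (B (pt k)); last by exists 0.
  by have [[m Hm] _] := Hg _ Bk; exists m.
have [M HM] := choice exM.
exists (\sum_k `|M k|) => u Su N.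
pose kk i := (Num.trunc (cabs (u ord0 i) * K')).+1.
have cK i : 0 <= cabs (u ord0 i) * K' by rewrite mulr_ge0 ?cabs_ge0 ?ltW.
have t1 i : (Num.trunc (cabs (u ord0 i) * K'))%:R <= cabs (u ord0 i) * K'.
  by have /andP[] := Num.Theory.truncn_itv (cK i).
have t2 i : cabs (u ord0 i) * K' < (kk i)%:R.
  by have /andP[] := Num.Theory.truncn_itv (cK i).
have kb i : (kk i < K.+3)%N.
  rewrite /kk !ltnS -(ler_nat R); apply: le_trans (t1 i) _.
  by rewrite -/K' ler_piMl ?(ltW K0) ?(sphere_coord i Su).
pose k := [ffun i => Ordinal (kb i)].
have ki i : ((k i : nat)%:R : R) = (Num.trunc (cabs (u ord0 i) * K'))%:R + 1.
  by rewrite ffunE /= /kk -natr1.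
have s1 i : cabs (u ord0 i) <= (k i)%:R / K' by rewrite ler_pdivlMr // ki natr1 ltW.
have s2 i : (k i)%:R / K' <= cabs (u ord0 i) + K'^-1.
  by rewrite ki mulrDl mul1r lerD2r ler_pdivrMr.
have Bk : B (pt k).
  apply/unit_ballE; apply: le_lt_trans HK; have Su' := Su; move/unit_sphereE: Su => Su.
  apply: (@le_trans _ _ (\sum_i r ^+ 2 * (cabs (u ord0 i) ^+ 2 + 3 * K'^-1))).
    apply: ler_sum => i _; rewrite mxE cabs_ge0R; last by rewrite mulr_ge0 ?divr_ge0 // ltW.
    rewrite exprMn; apply: ler_wpM2l; first exact: sqr_ge0.
    have h0 := cabs_ge0 (u ord0 i); have h1 := sphere_coord i Su'; have h2 := s2 i.
    have h3 : 0 <= (k i)%:R / K' by rewrite divr_ge0 // ltW.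
    have h4 : 0 < K'^-1 by rewrite invr_gt0.
    have h5 : K'^-1 <= 1 by rewrite invf_le1 // ler1n.
    move: h0 h1 h2 h3 h4 h5; move: (cabs (u ord0 i)) (K'^-1) ((k i)%:R / K') => x w y h0 h1 h2 h3 h4 h5.
    apply: (@le_trans _ _ ((x + w) ^+ 2)); first by rewrite lerXn2r // nnegrE; lra.
    have : 0 <= (1 - x) * w by rewrite mulr_ge0 ?subr_ge0 // ltW.
    have : 0 <= (1 - w) * w by rewrite mulr_ge0 ?subr_ge0 // ltW.
    by rewrite !expr2; lra.
  rewrite -mulr_sumr big_split /= Su sumr_const card_ord -[_ *+ n]mulr_natr.
  by rewrite [3 / _ * _]mulrAC lexx.
apply: (@le_trans _ _ (M k)); last first.
  rewrite (bigD1 k) //=; apply: le_trans (ler_norm _) _.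
  by rewrite lerDl sumr_ge0.
apply: le_trans (HM _ Bk N); apply: ler_sum => a _; rewrite cabsM cabs_mono.
apply: ler_wpM2l; first exact: cabs_ge0.
apply: ler_rmono => i; rewrite mulr_ge0 ?cabs_ge0 //= mxE cabs_ge0R.
  by apply: ler_wpM2l.
by rewrite mulr_ge0 ?divr_ge0 // ltW.
Qed.

(** The series is bounded on the larger radius r' = (1 + r)/2 uniformly over the sphere, so on
    radius [r] its tails decay like (r/r')^N. *)
Lemma re_sphere_sum g c (r e : R) : PS B g c -> (forall z, B z -> 0 <= Re (g z)) ->
  0 < r -> r < 1 -> 0 < e -> exists N0, forall N, (N0 <= N)%N -> forall u : Cn, S u ->
    - e <= Re (\sum_(a <- box N) c a * r%:C ^+ mi_abs a * mono u a).
Proof.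
move=> Hg g0 r0 r1 e0; pose r' := (1 + r) / 2.
have r'1 : r' < 1 by rewrite /r'; lra.
have r'r : r < r' by rewrite /r'; lra.
have [M HM] := sphere_box_bound Hg (ltW (lt_trans r0 r'r)) r'1.
pose s := r' / r; have s1 : 1 < s by rewrite ltr_pdivlMr // mul1r.
have s0 : 0 < s by lra.
have i0 : 0 <= s^-1 by rewrite invr_ge0 ltW.
have i1 : s^-1 < 1 by rewrite invf_lt1.
have [N0 HN0] := geo_small M i0 i1 e0; exists N0 => N NN u Su.
have Bu : B (r%:C *: u).
  apply/unit_ballE; rewrite (eq_bigr (fun i => r ^+ 2 * cabs (u ord0 i) ^+ 2)).
    by move/unit_sphereE: Su => Su; rewrite -mulr_sumr Su mulr1 expr_lt1 // ltW.
  by move=> i _; rewrite mxE cabsM exprMn cabs_ge0R ?ltW.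
have tail := @has_sum_tail R n (fun a => c a * mono (r%:C *: u) a) _ s M (ltW s1) _ (Hg _ Bu) N.
have E : \sum_(a <- box N) c a * r%:C ^+ mi_abs a * mono u a =
    \sum_(a <- box N) c a * mono (r%:C *: u) a.
  by apply: eq_bigr => a _; rewrite mono_scale mulrA.
rewrite E; have {}tail : cabs (\sum_(a <- box N) c a * mono (r%:C *: u) a - g (r%:C *: u)) < e.
  apply: le_lt_trans (HN0 N NN); rewrite exprVn ler_pdivlMr ?exprn_gt0 //; apply: tail => N'.
  apply: le_trans (HM u Su N'); rewrite le_eqVlt; apply/orP; left; apply/eqP.
  apply: eq_bigr => a _; rewrite mono_scale !cabsM cabsX cabs_ge0R ?ltW //.
  rewrite rmono_scale cabs_mono /s expr_div_n.
  by field; rewrite ?expf_neq0 ?gt_eqF.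
have := g0 _ Bu; have := Re_ge_cabs (\sum_(a <- box N) c a * mono (r%:C *: u) a - g (r%:C *: u)).
by rewrite ReB; lra.
Qed.

End UniformBound.

(** * The pairing Q and the first two dualities *)

Section Pairing.
Variables (R : realType) (n : nat).
Local Notation C := R[i].
Local Notation Cn := 'rV[R[i]]_n.
Local Notation Re := complex.Re.
Local Notation Im := complex.Im.
Local Notation S := (@unit_sphere R n).
Local Notation B := (@unit_ball R n).
Implicit Types (f g : Cn -> C).
Local Notation mi0 := ([ffun=> 0%N] : multi_index n).

Lemma drury_weight_gt0 (a : multi_index n) : 0 < drury_weight R a.
Proof.
by rewrite /drury_weight divr_gt0 // ltr0n ?fact_gt0 // /mi_fact prodn_gt0 // => i; exact: fact_gt0.
Qed.

(** For two elements of the Drury space, xy <= x^2 + y^2 applied termwise bounds the box sums. *)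
Lemma Q_defined_bounded f g : Q_defined f g -> box_bounded (Q_term f g).
Proof.
case=> [[[_ Hf] [_ Hg]]|/summable_box //].
have bb (h : Cn -> C) : summable setT (fun a => (cabs (taylor_coef h a) ^+ 2 * drury_weight R a)%:E) ->
    exists M, forall N, \sum_(a <- box N) cabs (taylor_coef h a) ^+ 2 * drury_weight R a <= M.
  have E a : cabs ((cabs (taylor_coef h a) ^+ 2 * drury_weight R a)%:C) =
      cabs (taylor_coef h a) ^+ 2 * drury_weight R a.
    by rewrite cabs_ge0R //; apply: mulr_ge0; [exact: sqr_ge0|exact: ltW (drury_weight_gt0 a)].
  move=> H; have /summable_box [M HM] : summable setT (fun a =>
      (cabs ((cabs (taylor_coef h a) ^+ 2 * drury_weight R a)%:C))%:E).
    by rewrite (_ : (fun _ => _) = fun a => (cabs (taylor_coef h a) ^+ 2 * drury_weight R a)%:E) //;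
      apply/funext => a; rewrite E.
  by exists M => N; apply: le_trans (HM N); apply: ler_sum => a _; rewrite E.
have [M HM] := bb f Hf; have [M' HM'] := bb g Hg; exists (M + M') => N.
apply: le_trans (lerD (HM N) (HM' N)); rewrite -big_split; apply: ler_sum => a _ /=.
rewrite /Q_term cabsM (cabsM (taylor_coef f a)) cabsJ (cabs_ge0R (ltW (drury_weight_gt0 a))) -mulrDl.
apply: ler_wpM2r; first exact: ltW (drury_weight_gt0 a).
have := sqr_ge0 (cabs (taylor_coef f a) - cabs (taylor_coef g a)).
have := mulr_ge0 (cabs_ge0 (taylor_coef f a)) (cabs_ge0 (taylor_coef g a)).
move: (cabs (taylor_coef f a)) (cabs (taylor_coef g a)) => x y; rewrite !expr2; nra.
Qed.

Lemma Q_termC f g a : Q_term g f a = (Q_term f g a)^*.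
Proof.
rewrite /Q_term; move: (taylor_coef f a) (taylor_coef g a) (drury_weight R a) => x y w.
by apply: complex_ext; rewrite !(ReM, ImM, ReJ, ImJ) /=; ring.
Qed.

Lemma Q_definedC f g : Q_defined f g -> Q_defined g f.
Proof.
case=> [[df dg]|H]; [by left|right].
by rewrite (_ : (fun _ => _) = fun a => (cabs (Q_term f g a))%:E) //;
  apply/funext => a; rewrite Q_termC cabsJ.
Qed.

Lemma Q_has_sum f g X : has_sum (Q_term f g) X -> Q f g = X + (f 0)^* * (g 0)^*.
Proof. by move=> H; rewrite /Q (csum_has_sum H). Qed.

(** This symmetry turns the pairing of M^+ with O^+ around, so one positivity statement serves both
    dualities. *)
Lemma Re_QC f g : Q_defined f g -> Re (Q g f) = Re (Q f g).
Proof.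
move=> /Q_defined_bounded /has_sum_csum H; rewrite (Q_has_sum H).
have H' : has_sum (Q_term g f) (csum (Q_term f g))^*.
  by apply: (eq_has_sum _ (has_sumJ H)) => a; rewrite -Q_termC.
by rewrite (Q_has_sum H') !ReD ReJ mulrC.
Qed.

Hypothesis n_gt0 : (0 < n)%N.

Section MeasurePairing.
Variables (mu : {finite_measure set (@borel_Cn R n) -> \bar R}) (t : R) (f g : Cn -> C).
Hypothesis Hf : forall z, B z ->
  f z = cintegral mu S (fun u => 2 / (1 - hdot z u) - 1) + 'i * t%:C.
Hypothesis Og : O_ball R n g.

Local Notation mom a := (cint mu S (fun u : Cn => mono u a)).

Lemma mom0 : mom mi0 = (fine (mu S))%:C.
Proof.
rewrite (_ : (fun _ => _) = fun=> 1).
  by rewrite (@cint_cst _ _ _ mu S) ?mul1r //; exact: measurable_sphere.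
by apply/funext => u; rewrite /mono big1 // => i _; rewrite ffunE expr0.
Qed.

(** The weight of the Drury inner product cancels the multinomial coefficient of the kernel
    expansion. *)
Lemma kmoment_weight a : kmoment mu a * (drury_weight R a)%:C = (mom a)^*.
Proof.
rewrite kmomentE // mulrAC; have F k : (k`!)%:R != 0 :> C by rewrite pnatr_eq0 -lt0n fact_gt0.
rewrite /drury_weight rmorphM (fmorphV (real_complex R)) !rmorph_nat.
have := mi_fact_neq0 R a => G.
by rewrite mulrA divfK // mulfV // mul1r.
Qed.

Lemma kmoment0 : kmoment mu mi0 = (fine (mu S))%:C.
Proof.
have := kmoment_weight mi0; rewrite mom0.
have -> : drury_weight R mi0 = 1.
  rewrite /drury_weight /mi_fact /mi_abs !big1 //= ?fact0 ?divr1 // => i _; rewrite ffunE //.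
rewrite mulr1 => ->; apply: complex_ext; rewrite ?ReJ ?ImJ //= oppr0 //.
Qed.

Lemma M_plus_coef a : taylor_coef f a =
  2 * kmoment mu a + (a == mi0)%:R * ('i * t%:C - (fine (mu S))%:C).
Proof. exact: PS_ball_coef (M_plus_PS n_gt0 Hf). Qed.

Lemma M_plus_O_ball : O_ball R n f.
Proof. exact: PS_O_ball (M_plus_PS n_gt0 Hf). Qed.

Lemma M_plus_Q_term a : Q_term f g a =
  2 * (mom a * taylor_coef g a)^* + (a == mi0)%:R * (('i * t%:C - (fine (mu S))%:C) * (g 0)^*).
Proof.
have E : (mom a * taylor_coef g a)^* = kmoment mu a * (drury_weight R a)%:C * (taylor_coef g a)^*.
  by rewrite kmoment_weight; move: (taylor_coef g a) => x; rewrite rmorphM.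
rewrite /Q_term M_plus_coef mulrDl mulrDl; congr (_ + _).
  transitivity (2 * (kmoment mu a * (drury_weight R a)%:C * (taylor_coef g a)^*)); first by ring.
  by congr (2 * _); rewrite -E.
have [->|_] := eqVneq a mi0; last by rewrite !mul0r.
rewrite (PS_at0 (unit_ball0 _ _) (O_ball_PS Og)) !mul1r.
have -> : drury_weight R mi0 = 1.
  rewrite /drury_weight /mi_fact /mi_abs !big1 //= ?fact0 ?divr1 // => i _; rewrite ffunE //.
by rewrite mulr1.
Qed.

(** Here the correction term of Q pays off: the constant term of [f] leaves (it - mu(S)) conj g(0)
    in the series, and conj f(0) conj g(0) = (mu(S) - it) conj g(0) cancels it. *)
Lemma M_plus_Q X : has_sum (fun a => mom a * taylor_coef g a) X ->
  has_sum (Q_term f g) (2 * X^* + ('i * t%:C - (fine (mu S))%:C) * (g 0)^*) /\ Q f g = 2 * X^*.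
Proof.
move=> H; have H1 : has_sum (Q_term f g) (2 * X^* + ('i * t%:C - (fine (mu S))%:C) * (g 0)^*).
  rewrite (_ : Q_term f g = fun a => 2 * (mom a * taylor_coef g a)^* +
    (a == mi0)%:R * (('i * t%:C - (fine (mu S))%:C) * (g 0)^*)); last first.
    by apply/funext => a; exact: M_plus_Q_term.
  apply: has_sumD; first by apply: has_sumZ; exact: has_sumJ.
  have := @has_sum_single R n (fun a => (a == mi0)%:R *
    (('i * t%:C - (fine (mu S))%:C) * (g 0)^*)) mi0; rewrite eqxx mul1r.
  by apply => a /negbTE ->; rewrite mul0r.
split=> //; rewrite (Q_has_sum H1) (PS_at0 (unit_ball0 _ _) (O_ball_PS M_plus_O_ball)).
rewrite M_plus_coef eqxx mul1r kmoment0.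
have -> : ((2 * (fine (mu S))%:C + ('i * t%:C - (fine (mu S))%:C))^*)%R =
  (fine (mu S))%:C - 'i * t%:C.
  by apply: complex_ext; rewrite ?ReJ ?ImJ /=; ring.
by ring.
Qed.

Lemma M_plus_Q_bounded : Q_defined f g -> box_bounded (fun a => mom a * taylor_coef g a).
Proof.
move=> /Q_defined_bounded [M HM].
pose K : C := ('i * t%:C - (fine (mu S))%:C) * (g 0)^*.
exists (M + cabs K) => N.
have E a : mom a * taylor_coef g a = (2^-1 * (Q_term f g a - (a == mi0)%:R * K))^*.
  by rewrite M_plus_Q_term addrK mulKf ?conjcK // pnatr_eq0.
have le1 a : cabs (mom a * taylor_coef g a) <= cabs (Q_term f g a) + (a == mi0)%:R * cabs K.
  rewrite E cabsJ cabsM cabsV cabs_nat.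
  have := cabsB (Q_term f g a) ((a == mi0)%:R * K); rewrite cabsM cabs_nat => h.
  have := cabs_ge0 (Q_term f g a - (a == mi0)%:R * K); lra.
apply: le_trans (ler_sum _ (fun a _ => le1 a)) _; rewrite big_split; apply: lerD => //=.
rewrite -mulr_suml ler_piMl ?cabs_ge0 //.
have [in0|out] := boolP (mi0 \in box N); last first.
  rewrite big1_seq // => a /andP[_ aN]; case: eqP => // e; by rewrite -e aN in out.
rewrite (bigD1_seq mi0) ?box_uniq //= eqxx big1 ?addr0 // => a /negbTE -> //.
Qed.

End MeasurePairing.
End Pairing.

(** * The dual of M^+ *)

Section Dualities.
Variables (R : realType) (n : nat).
Local Notation C := R[i].
Local Notation Cn := 'rV[R[i]]_n.
Local Notation Re := complex.Re.
Local Notation Im := complex.Im.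
Local Notation S := (@unit_sphere R n).
Local Notation B := (@unit_ball R n).
Implicit Types (f g : Cn -> C).
Local Notation mi0 := ([ffun=> 0%N] : multi_index n).

Lemma Re2J (x : C) : Re (2 * x^*) = 2 * Re x.
Proof. by rewrite mulr_natl mulr2n ReD ReJ; ring. Qed.

Lemma one_subX_le (r : R) k : 0 <= r -> r <= 1 -> 1 - r ^+ k <= k%:R * (1 - r).
Proof.
move=> r0 r1; elim: k => [|k IH]; first by rewrite expr0 subrr mul0r.
have h : r ^+ k * (1 - r) <= 1 - r by rewrite ler_piMl ?subr_ge0 // exprn_ile1.
by rewrite exprS -natr1; lra.
Qed.

(** As [v] is absolutely summable, the factors [r%:C ^+ mi_abs a] change the box sums little,
    uniformly in the box, once r is close to 1. *)
Lemma abel_re_ge0 (v : multi_index n -> C) X : has_sum v X ->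
  (forall r e : R, 0 < r -> r < 1 -> 0 < e -> exists N0, forall N, (N0 <= N)%N ->
     - e <= Re (\sum_(a <- box N) v a * r%:C ^+ mi_abs a)) -> 0 <= Re X.
Proof.
move=> [[V HV] Hv] Hr.
have vC a : cabs ((cabs (v a))%:C) = cabs (v a) by rewrite cabs_ge0R ?cabs_ge0.
have [_ Hw] : has_sum (fun a => (cabs (v a))%:C) (csum (fun a => (cabs (v a))%:C)).
  by apply: has_sum_csum; exists V => N; under eq_bigr do rewrite vC.
set W := csum _ in Hw.
(* The five parts: three for [key], one for the distance of the box sum to [X], one for the
   hypothesis at radius [r]. *)
apply/ler_addgt0Pr => e' e'0; pose e := e' / 5.
have e0 : 0 < e by rewrite divr_gt0.
have [N1 H1] := Hw e e0; have [N2 H2] := Hv e e0; pose N0 := maxn N1 N2.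
(* Inside [box N0] the degree is at most n * N0, so 1 - r^|a| <= n N0 (1 - r), and these terms
   contribute at most (1 - r) D. The maximum with 1/2 in [r] below keeps it positive. *)
pose D : R := (n * N0)%:R * V + 1.
have V0 : 0 <= V by apply: le_trans (HV 0%N); apply: sumr_ge0 => a _; exact: cabs_ge0.
have D0 : 0 < D by rewrite ltr_wpDl // mulr_ge0.
pose r := Num.max (1 / 2) (1 - e / D).
have r1 : r < 1 by rewrite gt_max; apply/andP; split; [lra|rewrite ltrBlDr ltrDl divr_gt0].
have r0 : 0 < r by rewrite lt_max; apply/orP; left; lra.
have rD : (1 - r) * D <= e.
  by rewrite -ler_pdivlMr // lerBlDr -lerBlDl le_max lexx orbT.
have [N3 H3] := Hr r e r0 r1 e0; pose N := maxn N0 N3.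
have N0N : (N0 <= N)%N by exact: leq_maxl.
have hX := H2 N (leq_trans (leq_maxr _ _) N0N).
have hr := H3 N (leq_maxr _ _).
have key : cabs (\sum_(a <- box N) v a - \sum_(a <- box N) v a * r%:C ^+ mi_abs a) <= e + 2 * e.
  rewrite -sumrB; apply: le_trans (cabs_sum _ _ _) _.
  have E a : cabs (v a - v a * r%:C ^+ mi_abs a) = cabs (v a) * (1 - r ^+ mi_abs a).
    rewrite -{1}[v a]mulr1 -mulrBr cabsM; congr (_ * _).
    by rewrite -rmorphXn -(rmorphB (real_complex R)) cabs_ge0R // subr_ge0 exprn_ile1 ?ltW.
  under eq_bigr do rewrite E.
  rewrite (sum_sub_seq _ (box_uniq N0) (box_uniq N) (box_sub N0N)); apply: lerD.
    apply: le_trans rD; apply: (@le_trans _ _ (\sum_(a <- box N0) cabs (v a) * ((n * N0)%:R * (1 - r)))).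
      rewrite !big_seq; apply: ler_sum => a aN; apply: ler_wpM2l; first exact: cabs_ge0.
      apply: le_trans (one_subX_le _ (ltW r0) (ltW r1)) _.
      apply: ler_wpM2r; first by rewrite subr_ge0 ltW.
      rewrite ler_nat /mi_abs -[X in (_ <= X * _)%N]card_ord -sum_nat_const.
      by apply: leq_sum => i _; move: aN; rewrite mem_box => /forallP/(_ i)/ltnW.
    rewrite -mulr_suml mulrC /D; have := HV N0; have : 0 <= (1 - r) by rewrite subr_ge0 ltW.
    have : 0 <= (n * N0)%:R :> R by [].
    move: ((n * N0)%:R) (\sum_(a <- _) _) (1 - r) => x y z x0 z0 yV.
    have : 0 <= z * x * (V - y) by rewrite !mulr_ge0 // subr_ge0.
    by nra.
  apply: (@le_trans _ _ (\sum_(a <- box N | a \notin box N0) cabs (v a))).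
    apply: ler_sum => a _; rewrite ler_piMr ?cabs_ge0 // lerBlDr lerDl exprn_ge0 ?ltW //.
  have h1 := H1 N0 (leq_maxl _ _).
  have h2 := H1 N (leq_trans (leq_maxl _ _) N0N).
  have : cabs (\sum_(a <- box N) (cabs (v a))%:C - \sum_(a <- box N0) (cabs (v a))%:C) <= 2 * e.
    rewrite (_ : _ - _ = (\sum_(a <- box N) (cabs (v a))%:C - W) -
      (\sum_(a <- box N0) (cabs (v a))%:C - W)); last by ring.
    by apply: le_trans (cabsB _ _) _; lra.
  apply: le_trans.
  rewrite (sum_sub_seq _ (box_uniq N0) (box_uniq N) (box_sub N0N)) addrC addKr.
  rewrite -(rmorph_sum (real_complex R)) cabs_ge0R //.
  by apply: sumr_ge0 => a _; exact: cabs_ge0.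
have k1 := Re_ge_cabs (\sum_(a <- box N) v a - \sum_(a <- box N) v a * r%:C ^+ mi_abs a).
have k2 := Re_le_cabs (\sum_(a <- box N) v a - X).
move: k1 k2; rewrite !ReB ler_norml => k1 /andP[_ k2].
have e5 : e' = 5 * e by rewrite /e mulrC divfK.
by rewrite e5; lra.
Qed.

Hypothesis n_gt0 : (0 < n)%N.

Lemma M_plus_O_plus_ge0 f g : M_plus R n f -> O_plus R n g -> Q_defined f g -> 0 <= Re (Q f g).
Proof.
move=> [mu [t [mu0 Hf]]] [Og Rg] Qd.
have H := has_sum_csum (M_plus_Q_bounded n_gt0 Hf Og Qd); set X := csum _ in H.
have [_ ->] := M_plus_Q n_gt0 Hf Og H.
suff : 0 <= Re X by rewrite Re2J => h; rewrite mulr_ge0.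
apply: (abel_re_ge0 H) => r e r0 r1 e0.
have mS := @measurable_sphere R n; pose m := fine (mu S).
have m0 : 0 <= m by rewrite fine_ge0.
(* The Taylor polynomial has real part at least minus this number on the sphere; integrating over
   mass [m] loses at most [e]. *)
have d0 : 0 < e / (m + 1) by rewrite divr_gt0 // ltr_wpDl.
have [N0 HN0] := re_sphere_sum (O_ball_PS Og) Rg r0 r1 d0; exists N0 => N NN.
pose G (u : Cn) := \sum_(a <- box N) taylor_coef g a * r%:C ^+ mi_abs a * mono u a.
have tG : tame G by apply: tame_sum => a; apply: tameM; [exact: tame_cst|exact: tame_mono].
have [iG _] := tame_integrable mu tG.
have -> : \sum_(a <- box N) cint mu S (fun u : Cn => mono u a) * taylor_coef g a * r%:C ^+ mi_abs a =
    cint mu S G.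
  rewrite cint_sum //; last first.
    by move=> a; apply: tame_integrable; apply: tameM; [exact: tame_cst|exact: tame_mono].
  apply: eq_bigr => a _; rewrite cintZ //; last by apply: tame_integrable; exact: tame_mono.
  by rewrite -mulrA mulrC.
rewrite /= (@le_trans _ _ (\int[mu]_(u in S) (- (e / (m + 1))))) //.
  rewrite Rintegral_cst // mulNr lerN2 mulrAC ler_pdivrMr; last by rewrite ltr_wpDl.
  by apply: ler_wpM2l; [exact: ltW|rewrite -/m; lra].
apply: le_Rintegral => //; first exact: (integrable_cstR mS (sphere_fin mu)).
by move=> u Su; apply: HN0.
Qed.

Lemma dagger_M_plus : dagger (M_plus R n) = O_plus R n.
Proof.
apply/seteqP; split=> g; last first.
  by move=> Pg; split=> [|f Mf]; [case: Pg|exact: M_plus_O_plus_ge0].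
move=> [Og Hg]; split=> // w Bw.
have [mu [mu0 Hmu]] := poisson_measure n_gt0 Bw.
pose f (z : Cn) : C := cintegral mu S (fun u => 2 / (1 - hdot z u) - 1) + 'i * (0 : R)%:C.
have Mf : M_plus R n f by exists mu, 0.
have H : has_sum (fun a => cint mu S (fun u : Cn => mono u a) * taylor_coef g a) (g w).
  by apply: (eq_has_sum _ (O_ball_PS Og Bw)) => a; rewrite Hmu mulrC.
have [Hs HQ] := M_plus_Q n_gt0 (f := f) (fun z _ => erefl) Og H.
have Qd : Q_defined f g by right; apply/summable_box; case: Hs.
by have := Hg f Mf Qd; rewrite HQ Re2J pmulr_rge0.
Qed.

End Dualities.

(** * The dual of O^+ *)

Section SecondDuality.
Variables (R : realType) (n : nat).
Local Notation C := R[i].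
Local Notation Cn := 'rV[R[i]]_n.
Local Notation Re := complex.Re.
Local Notation Im := complex.Im.
Local Notation S := (@unit_sphere R n).
Local Notation B := (@unit_ball R n).
Implicit Types (f g : Cn -> C) (p : seq (C * multi_index n)).
Local Notation mi0 := ([ffun=> 0%N] : multi_index n).
Hypothesis n_gt0 : (0 < n)%N.

Definition pcoef p (a : multi_index n) : C := \sum_(x <- p) x.1 * (a == x.2)%:R.

Lemma has_sum_pcoef p (u : multi_index n -> C) :
  has_sum (fun a => pcoef p a * u a) (\sum_(x <- p) x.1 * u x.2).
Proof.
elim: p => [|x p IH].
  rewrite big_nil (_ : (fun _ => _) = fun=> 0); last first.
    by apply/funext => a; rewrite /pcoef big_nil mul0r.
  exact: (@has_sum_single R n (fun=> 0) mi0).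
rewrite big_cons (_ : (fun _ => _) = fun a => x.1 * (a == x.2)%:R * u a + pcoef p a * u a).
  apply: has_sumD => //.
  have := @has_sum_single R n (fun a => x.1 * (a == x.2)%:R * u a) x.2.
  by rewrite eqxx mulr1; apply => a /negbTE ->; rewrite mulr0 mul0r.
by apply/funext => a; rewrite /pcoef big_cons mulrDl.
Qed.

Lemma PS_peval p : PS B (peval p) (pcoef p).
Proof. by move=> z _; exact: has_sum_pcoef. Qed.

Lemma drury_weight0 : drury_weight R mi0 = 1.
Proof.
rewrite /drury_weight /mi_fact /mi_abs !big1 ?fact0 ?divr1 // => i _; rewrite ffunE //.
Qed.

Lemma O_plus_dagger_M_plus g : dagger (O_plus R n) g -> M_plus R n g.
Proof.
move=> [Og Hg].
have g0E : g 0 = taylor_coef g mi0 := PS_at0 (unit_ball0 _ _) (O_ball_PS Og).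
pose tau a : C := (taylor_coef g a)^* * (drury_weight R a)%:C.
(* The half compensates the 2 in the coefficients of M^+, and the term in degree 0 accounts for the
   correction in Q: Re of [pmoment lam p] is half of Re Q(p, g). *)
pose lam a : C := 2^-1 * (tau a + (a == mi0)%:R * g 0).
have lam_ge0 p : (forall u, S u -> 0 <= Re (peval p u)) -> 0 <= Re (pmoment lam p).
  move=> p0; have PSp := PS_peval p.
  have Op : O_plus R n (peval p).
    by split; [exact: PS_O_ball PSp|move=> z; exact: re_ge0_of_sphere].
  have H : has_sum (Q_term (peval p) g) (\sum_(x <- p) x.1 * tau x.2).
    by apply: (eq_has_sum _ (has_sum_pcoef p tau)) => a; rewrite /Q_term (PS_ball_coef a PSp) mulrA.
  have Qd : Q_defined (peval p) g by right; apply/summable_box; case: H.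
  have := Hg _ Op Qd; rewrite (Q_has_sum H).
  have -> : pmoment lam p = 2^-1 * (\sum_(x <- p) x.1 * tau x.2 + peval p 0 * g 0).
    rewrite /pmoment /peval mulr_suml -big_split mulr_sumr; apply: eq_bigr => x _ /=.
    by rewrite mono0 /lam; ring.
  (* The correction of Q is conjugate-linear in p; replacing p(0) g(0) by its conjugate makes the
     functional linear and keeps the real part. *)
  have -> (x y z : C) : Re (2^-1 * (x + y * z)) = 2^-1 * Re (x + y^* * z^*).
    have -> : 2^-1 = (2^-1 : R)%:C :> C by rewrite (fmorphV (real_complex R)) rmorph_nat.
    by rewrite !(ReM, ReD, ReJ, ImJ) /=; ring.
  by move=> h; rewrite mulr_ge0 // invr_ge0.
have [mu [mu0 Hmu]] := moment_measure n_gt0 lam_ge0.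
(* The total mass is the moment of degree 0, namely (conj g(0) + g(0))/2 = Re g(0); the imaginary
   constant has to supply the rest of g(0). *)
pose t := Im (g 0); exists mu, t; split=> //.
pose f (z : Cn) : C := cintegral mu S (fun u => 2 / (1 - hdot z u) - 1) + 'i * t%:C.
have Hf := M_plus_PS n_gt0 (f := f) (fun z _ => erefl).
suff E a : 2 * kmoment mu a + (a == mi0)%:R * ('i * t%:C - (fine (mu S))%:C) = taylor_coef g a.
  move=> z Bz; apply: (has_sum_unique (O_ball_PS Og Bz)).
  by apply: (eq_has_sum _ (Hf z Bz)) => a; rewrite E.
have m0 : (fine (mu S))%:C = (Re (g 0))%:C :> C.
  rewrite -mom0 Hmu /lam eqxx mul1r /tau drury_weight0 -g0E mulr1.
  have -> : 2^-1 = (2^-1 : R)%:C :> C by rewrite (fmorphV (real_complex R)) rmorph_nat.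
  by apply: complex_ext; rewrite !(ReM, ImM, ReD, ImD, ReJ, ImJ) /=; field.
have wn : (drury_weight R a)%:C != 0 :> C by rewrite -cabs_gt0 cabs_ge0R ?drury_weight_gt0 // ltW //
  drury_weight_gt0.
have kE : kmoment mu a = 2^-1 * (taylor_coef g a + (a == mi0)%:R * (g 0)^*).
  apply: (mulIf wn); rewrite kmoment_weight // Hmu /lam /tau.
  have [->|_] := eqVneq a mi0.
    rewrite drury_weight0 !mulr1 !mul1r -g0E.
    have -> : 2^-1 = (2^-1 : R)%:C :> C by rewrite (fmorphV (real_complex R)) rmorph_nat.
    by apply: complex_ext; rewrite !(ReM, ImM, ReD, ImD, ReJ, ImJ) /=; ring.
  rewrite !mul0r !addr0.
  have -> : 2^-1 = (2^-1 : R)%:C :> C by rewrite (fmorphV (real_complex R)) rmorph_nat.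
  move: (taylor_coef g a) (drury_weight R a) => x w.
  by apply: complex_ext; rewrite !(ReM, ImM, ReD, ImD, ReJ, ImJ) /=; ring.
rewrite kE m0 mulrA mulfV ?pnatr_eq0 // mul1r -addrA -mulrDr.
rewrite (_ : (g 0)^* + _ = 0) ?mulr0 ?addr0 //.
by apply: complex_ext; rewrite !(ReM, ImM, ReD, ImD, ReN, ImN, ReJ, ImJ) /=; ring.
Qed.

Lemma dagger_O_plus : dagger (O_plus R n) = M_plus R n.
Proof.
apply/seteqP; split=> g; first exact: O_plus_dagger_M_plus.
move=> Mg; split; first by have [mu [t [_ Hg]]] := Mg; exact: (M_plus_O_ball n_gt0 Hg).
move=> f Of Qd; rewrite (Re_QC (Q_definedC Qd)).
by apply: M_plus_O_plus_ge0 => //; exact: Q_definedC.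
Qed.

End SecondDuality.

(** * The class S^+ *)

Section GeometricSums.
Variable R : realType.
Local Notation C := R[i].
Implicit Types (u v : nat -> C) (L : C).

(** Convergence of a series with geometric error at a fixed rate, a notion stable under the linear
    recursions satisfied by the Gram kernels. *)
Definition geosum (r : R) u L : Prop :=
  exists2 K, 0 <= K & forall M, cabs (\sum_(m < M) u m - L) <= K * r ^+ M.

Lemma geosumD r u v L L' : geosum r u L -> geosum r v L' -> geosum r (fun m => u m + v m) (L + L').
Proof.
move=> [K K0 HK] [K' K'0 HK']; exists (K + K'); first exact: addr_ge0.
move=> M; rewrite big_split /= opprD addrACA mulrDl.
by apply: le_trans (cabsD _ _) _; apply: lerD; [exact: HK|exact: HK'].
Qed.

Lemma geosumZ r u L (c : C) : geosum r u L -> geosum r (fun m => c * u m) (c * L).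
Proof.
move=> [K K0 HK]; exists (cabs c * K); first by rewrite mulr_ge0 ?cabs_ge0.
move=> M; rewrite -mulr_sumr -mulrBr cabsM -mulrA.
by apply: ler_wpM2l; [exact: cabs_ge0|exact: HK].
Qed.

Lemma geosum0 r : geosum r (fun=> 0) 0.
Proof. by exists 0 => // M; rewrite big1 // subr0 cabs0 mul0r. Qed.

(** Summing the recursion gives L = u_0 + q L + V. *)
Lemma geosum_rec (r : R) (q : C) u v V : cabs q < r -> r < 1 ->
  (forall m, u m.+1 = q * u m + v m) -> geosum r v V -> geosum r u ((u 0%N + V) / (1 - q)).
Proof.
move=> qr r1 rec [K K0 HK]; set L := _ / _.
have r0 : 0 < r by apply: le_lt_trans qr; exact: cabs_ge0.
have nq : 1 - q != 0.
  rewrite subr_eq0; apply: contraTneq (lt_trans qr r1) => <-.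
  by rewrite cabs1 ltxx.
have LE : u 0%N + V = (1 - q) * L by rewrite /L mulrC divfK.
have rq : 0 < r - cabs q by rewrite subr_gt0.
(* This constant c satisfies |q| c + K <= r c, which is the induction step, and it is at least |L|,
   which starts it. *)
exists (cabs L + K / (r - cabs q)); first by rewrite addr_ge0 ?cabs_ge0 // divr_ge0 // ltW.
elim=> [|M IH].
  rewrite big_ord0 sub0r cabsN expr0 mulr1 lerDl divr_ge0 // ltW //.
rewrite big_ord_recl (eq_bigr (fun m : 'I_M => q * u m + v m)); last by move=> m _; rewrite -rec.
rewrite big_split /= -mulr_sumr.
rewrite (_ : _ - L = q * (\sum_(m < M) u m - L) + (\sum_(m < M) v m - V)); last first.
  have -> : u 0%N = (1 - q) * L - V by rewrite -LE addrK.
  by ring.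
apply: le_trans (cabsD _ _) _; rewrite cabsM.
apply: (@le_trans _ _ (cabs q * ((cabs L + K / (r - cabs q)) * r ^+ M) + K * r ^+ M)).
  by apply: lerD; [apply: ler_wpM2l; [exact: cabs_ge0|exact: IH]|exact: HK].
rewrite exprS mulrA -mulrDl [X in _ <= X]mulrA; apply: ler_wpM2r; first by rewrite exprn_ge0 // ltW.
have e : K = K / (r - cabs q) * (r - cabs q) by rewrite divfK // gt_eqF.
rewrite {2}e; move: (K / _) => k.
by have := mulr_ge0 (cabs_ge0 L) (ltW rq); nra.
Qed.

End GeometricSums.

(** * Positivity of the kernel on pairs of points *)

Section PairKernel.
Variables (R : realType) (n : nat).
Local Notation C := R[i].
Local Notation Cn := 'rV[R[i]]_n.
Local Notation B := (@unit_ball R n).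

(** Words of length m index the coordinates of the m-th tensor power, so that [gram] is its inner
    product. *)
Fixpoint words (m : nat) : seq (seq 'I_n) :=
  if m is m'.+1 then [seq i :: J | i <- enum 'I_n, J <- words m'] else [:: [::]].

Lemma big_words (F : seq 'I_n -> C) m :
  \sum_(J <- words m.+1) F J = \sum_i \sum_(J <- words m) F (i :: J).
Proof. by rewrite /= big_allpairs_dep big_enum. Qed.

Fixpoint wmono (y : Cn) (J : seq 'I_n) : C :=
  if J is i :: J' then y ord0 i * wmono y J' else 1.

(* The coordinates of sum_(s <= m) z^(tensor s) (x) y^(tensor (m - s)). *)
Fixpoint wmix (z y : Cn) (J : seq 'I_n) : C :=
  if J is i :: J' then z ord0 i * wmix z y J' + y ord0 i * wmono y J' else 1.

Definition gram m (U U' : seq 'I_n -> C) : C := \sum_(J <- words m) U J * (U' J)^*.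

Lemma gram0 U U' : gram 0 U U' = U [::] * (U' [::])^*.
Proof. by rewrite /gram big_seq1. Qed.

Lemma gram_hdot m U U' (p q : Cn) :
  \sum_i \sum_(J <- words m) (p ord0 i * U J) * (q ord0 i * U' J)^* = hdot p q * gram m U U'.
Proof.
rewrite /hdot mulr_suml; apply: eq_bigr => i _; rewrite /gram mulr_sumr.
by apply: eq_bigr => J _; rewrite rmorphM /=; ring.
Qed.

Lemma gram_monoS m (y x : Cn) :
  gram m.+1 (wmono y) (wmono x) = hdot y x * gram m (wmono y) (wmono x).
Proof. by rewrite -gram_hdot {1}/gram big_words. Qed.

Lemma gram_mixlS m (z y x : Cn) : gram m.+1 (wmix z y) (wmono x) =
  hdot z x * gram m (wmix z y) (wmono x) + hdot y x * gram m (wmono y) (wmono x).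
Proof.
rewrite -!gram_hdot {1}/gram big_words -big_split; apply: eq_bigr => i _.
by rewrite -big_split; apply: eq_bigr => J _; rewrite /= mulrDl.
Qed.

Lemma gram_mixrS m (y w x : Cn) : gram m.+1 (wmono y) (wmix w x) =
  hdot y w * gram m (wmono y) (wmix w x) + hdot y x * gram m (wmono y) (wmono x).
Proof.
rewrite -!gram_hdot {1}/gram big_words -big_split; apply: eq_bigr => i _.
by rewrite -big_split; apply: eq_bigr => J _; rewrite /= rmorphD mulrDr.
Qed.

(** Splitting off the first letter gives a triangular system for the four Gram kernels of [wmono]
    and [wmix]; [geosum_rec] sums them one after the other. *)
Lemma gram_mixS m (z y w x : Cn) : gram m.+1 (wmix z y) (wmix w x) =
  hdot z w * gram m (wmix z y) (wmix w x) + (hdot z x * gram m (wmix z y) (wmono x) +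
  (hdot y w * gram m (wmono y) (wmix w x) + hdot y x * gram m (wmono y) (wmono x))).
Proof.
rewrite -!gram_hdot {1}/gram big_words -!big_split; apply: eq_bigr => i _.
rewrite /= -!big_split; apply: eq_bigr => J _; rewrite /= rmorphD mulrDl !mulrDr.
by rewrite -!addrA.
Qed.

Definition pair_kernel (z y w x : Cn) : C :=
  knl w z * knl x y * (knl x z + knl w y - 1).

Lemma pair_kernel_sum (z y w x : Cn) : B z -> B y -> B w -> B x ->
  forall e : R, 0 < e -> exists M0, forall M, (M0 <= M)%N ->
    cabs (\sum_(m < M) gram m (wmix z y) (wmix w x) - pair_kernel z y w x) < e.
Proof.
move=> Bz By Bw Bx.
have lt1 p q : B p -> B q -> cabs (hdot p q) < 1 by move=> Bp /ball_cball; exact: cabs_hdot_lt.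
have nz p q : B p -> B q -> 1 - hdot p q != 0 by move=> Bp /ball_cball; exact: one_sub_hdot_neq0.
pose r0 := Num.max (Num.max (cabs (hdot z w)) (cabs (hdot z x)))
                   (Num.max (cabs (hdot y w)) (cabs (hdot y x))).
have r01 : r0 < 1 by rewrite !gt_max !lt1.
(* One rate strictly between the four inner products and 1 serves all four recursions. *)
pose r := (1 + r0) / 2; have r1 : r < 1 by rewrite /r; lra.
have r0r : r0 < r by rewrite /r; lra.
have [c1 c2 c3 c4] : [/\ cabs (hdot z w) < r, cabs (hdot z x) < r, cabs (hdot y w) < r & cabs (hdot y x) < r].
  by split; apply: le_lt_trans r0r; rewrite !le_max lexx ?orbT.
have D := geosum_rec c4 r1 (fun m => etrans (gram_monoS m y x) (esym (addr0 _))) (geosum0 r).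
have P := geosum_rec c2 r1 (fun m => gram_mixlS m z y x) (geosumZ (hdot y x) D).
have P' := geosum_rec c3 r1 (fun m => gram_mixrS m y w x) (geosumZ (hdot y x) D).
have := geosum_rec c1 r1 (fun m => gram_mixS m z y w x)
  (geosumD (geosumZ (hdot z x) P) (geosumD (geosumZ (hdot y w) P') (geosumZ (hdot y x) D))).
rewrite !gram0 /= !rmorph1 mulr1 !addr0 => -[K K0 HK].
have -> : pair_kernel z y w x = (1 + (hdot z x * ((1 + hdot y x * (1 / (1 - hdot y x))) / (1 - hdot z x)) +
  (hdot y w * ((1 + hdot y x * (1 / (1 - hdot y x))) / (1 - hdot y w)) +
   hdot y x * (1 / (1 - hdot y x))))) / (1 - hdot z w).
  rewrite /pair_kernel /knl.
  have := nz _ _ Bz Bw; have := nz _ _ Bz Bx; have := nz _ _ By Bw; have := nz _ _ By Bx.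
  move: (hdot z w) (hdot z x) (hdot y w) (hdot y x) => a b c d n1 n2 n3 n4.
  by field; rewrite n1 n2 n3 n4.
move=> e e0; have r_ge0 : 0 <= r by apply: le_trans (ltW c1); exact: cabs_ge0.
have [M0 HM0] := geo_small K r_ge0 r1 e0; exists M0 => M /HM0; apply: le_lt_trans; exact: HK.
Qed.

(** The form is a limit of sums of squares. Since [0 <=] in [R[i]] also asserts reality, the
    imaginary part is followed to the limit separately. *)
Lemma pair_kernel_psd (I : finType) (z y : I -> Cn) (b : I -> C) :
  (forall i, B (z i)) -> (forall i, B (y i)) ->
  0 <= \sum_i \sum_j b i * (b j)^* * pair_kernel (z i) (y i) (z j) (y j).
Proof.
move=> Bz By; set L := \sum_i _.
pose G m := \sum_i \sum_j b i * (b j)^* * gram m (wmix (z i) (y i)) (wmix (z j) (y j)).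
have G0 m : G m = (\sum_(J <- words m) cabs (\sum_i b i * wmix (z i) (y i) J) ^+ 2)%:C.
  rewrite (rmorph_sum (real_complex R)) /=.
  rewrite [RHS](eq_bigr (fun J => \sum_i \sum_j b i * (b j)^* *
    (wmix (z i) (y i) J * (wmix (z j) (y j) J)^*))); last first.
    move=> J _; rewrite -mulcJ rmorph_sum mulr_suml; apply: eq_bigr => i _.
    rewrite mulr_sumr; apply: eq_bigr => j _ /=.
    by move: (wmix _ _ _) (wmix _ _ _) => p q; rewrite rmorphM /=; ring.
  rewrite [RHS]exchange_big; apply: eq_bigr => i _ /=.
  rewrite [RHS]exchange_big; apply: eq_bigr => j _ /=.
  by rewrite /gram mulr_sumr.
have conv e : 0 < e -> exists M, cabs (\sum_(m < M) G m - L) < e.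
  move=> e0; pose w := \sum_i \sum_j cabs (b i) * cabs (b j).
  have w0 : 0 <= w by do 2 apply: sumr_ge0 => ? _; rewrite mulr_ge0 ?cabs_ge0.
  have d0 : 0 < e / (w + 1) by rewrite divr_gt0 // ltr_wpDl.
  have [M0 HM0] := choice (fun p : I * I =>
    pair_kernel_sum (Bz p.1) (By p.1) (Bz p.2) (By p.2) d0).
  exists (\max_p M0 p)%N; set M := (\max_p M0 p)%N.
  have -> : \sum_(m < M) G m - L = \sum_i \sum_j b i * (b j)^* *
      (\sum_(m < M) gram m (wmix (z i) (y i)) (wmix (z j) (y j)) - pair_kernel (z i) (y i) (z j) (y j)).
    rewrite /G /L exchange_big -sumrB; apply: eq_bigr => i _ /=.
    rewrite exchange_big -sumrB; apply: eq_bigr => j _ /=.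
    by rewrite mulrBr mulr_sumr.
  apply: (@le_lt_trans _ _ (w * (e / (w + 1)))); last first.
    by rewrite mulrA ltr_pdivrMr; [nra|rewrite ltr_wpDl].
  rewrite /w mulr_suml; apply: le_trans (cabs_sum _ _ _) _; apply: ler_sum => i _.
  rewrite mulr_suml; apply: le_trans (cabs_sum _ _ _) _; apply: ler_sum => j _.
  rewrite cabsM cabsM cabsJ; apply: ler_wpM2l; first by rewrite mulr_ge0 ?cabs_ge0.
  by apply: ltW; apply: (HM0 (i, j)); exact: (leq_bigmax (i, j)).
have Re0 M : 0 <= complex.Re (\sum_(m < M) G m).
  by rewrite Re_sum; apply: sumr_ge0 => m _; rewrite G0 /=; apply: sumr_ge0 => J _; exact: sqr_ge0.
have Im0 M : complex.Im (\sum_(m < M) G m) = 0.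
  by rewrite Im_sum big1 // => m _; rewrite G0.
have L_im : complex.Im L = 0.
  apply/eqP; rewrite -normr_le0; apply/ler_addgt0Pr => e e0; rewrite add0r.
  have [M HM] := conv e e0; apply: le_trans (ltW HM).
  by apply: le_trans _ (Im_le_cabs _); rewrite ImB Im0 sub0r normrN.
have L_re : 0 <= complex.Re L.
  apply/ler_addgt0Pr => e e0; have [M HM] := conv e e0.
  have := le_trans (Re_le_cabs _) (ltW HM); rewrite ReB ler_norml => /andP[_ h].
  by have := Re0 M; lra.
by rewrite (_ : L = (complex.Re L)%:C) ?ler0c //; apply: complex_ext.
Qed.

End PairKernel.

(** * The dual of S^+ *)

Section ThirdDuality.
Variables (R : realType) (n : nat).
Local Notation C := R[i].
Local Notation Cn := 'rV[R[i]]_n.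
Local Notation Re := complex.Re.
Local Notation Im := complex.Im.
Local Notation B := (@unit_ball R n).
Local Notation mi0 := ([ffun=> 0%N] : multi_index n).

Lemma knlJ (w z : Cn) : ((knl w z)^*)%R = knl z w.
Proof. by rewrite /knl fmorphV rmorphB rmorph1; congr (_ - _)^-1; exact: hdotJ. Qed.

Lemma kcoef_weight (w : Cn) a : kcoef w a * (drury_weight R a)%:C = ((mono w a)^*)%R.
Proof.
rewrite /kcoef mulrAC /drury_weight rmorphM (fmorphV (real_complex R)) !rmorph_nat.
have F k : (k`!)%:R != 0 :> C by rewrite pnatr_eq0 -lt0n fact_gt0.
by rewrite mulrA divfK ?mi_fact_neq0 // mulfV // mul1r.
Qed.

Lemma kcoef0 (w : Cn) : kcoef w mi0 = 1.
Proof.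
have := kcoef_weight w mi0; rewrite drury_weight0 mulr1 => ->.
by rewrite /mono big1 ?rmorph1 // => i _; rewrite ffunE expr0.
Qed.

Section Combination.
Variables (m : nat) (z : 'I_m -> Cn) (c : 'I_m -> C).
Hypothesis Bz : forall s, B (z s).

(* d_s = conj (c_s H(z_s)) with H = sum_t conj(c_t) k_(z_t). *)
Let d s : C := \sum_t (c s)^* * c t * knl (z s) (z t).

Let D : C := \sum_s d s.

(** As k_w(0) = 1, the sum takes the value [D] at 0, so half of it is removed. The function then has
    value D/2 at 0, which is real, and the correction term of Q restores exactly what was removed: Q
    reproduces the values of [g] at the points. *)
Definition knl_comb (x : Cn) : C := \sum_s d s * knl (z s) x - 2^-1 * D.

Lemma D_conj : (D^*)%R = D.
Proof.
rewrite /D /d rmorph_sum /= [RHS]exchange_big; apply: eq_bigr => s _.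
rewrite rmorph_sum; apply: eq_bigr => t _ /=.
by rewrite !rmorphM /= conjCK knlJ; ring.
Qed.

Lemma PS_knl_comb : PS B knl_comb
  (fun a => \sum_s d s * kcoef (z s) a - (a == mi0)%:R * (2^-1 * D)).
Proof.
move=> x Bx.
rewrite (_ : (fun _ => _) = fun a => \sum_s d s * (kcoef (z s) a * mono x a) +
  - ((a == mi0)%:R * (2^-1 * D)) * mono x a); last first.
  by apply/funext => a; rewrite mulrBl mulr_suml mulNr; congr (_ - _);
    apply: eq_bigr => s _; rewrite mulrA.
apply: has_sumD.
  apply: has_sum_seq => s; apply: has_sumZ; exact: PS_knl (ball_cball (Bz s)) _ Bx.
have := @has_sum_single R n (fun a => - ((a == mi0)%:R * (2^-1 * D)) * mono x a) mi0.
have m1 : mono x mi0 = 1 by rewrite /mono big1 // => i _; rewrite ffunE expr0.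
rewrite eqxx mul1r m1 mulr1; apply => a /negbTE ->; by rewrite mul0r oppr0 mul0r.
Qed.

(** The two halves of the real number [D] add up to [D], whose own double sum supplies the [- 1];
    the result is the shape of [pair_kernel]. *)
Lemma knl_comb_pair (x y : Cn) : knl_comb x + (knl_comb y)^* =
  \sum_t \sum_s c t * (c s)^* * knl (z s) (z t) * (knl (z s) x + knl y (z t) - 1).
Proof.
rewrite /knl_comb rmorphB /= rmorphM /= D_conj rmorph_sum /=.
rewrite [LHS](_ : _ = \sum_s d s * knl (z s) x + \sum_s (d s * knl (z s) y)^* - D); last first.
  rewrite fmorphV /= rmorph_nat.
  have : D = 2^-1 * D + 2^-1 * D by rewrite -mulrDl -[2^-1]mul1r -mulrDl -[1 + 1]/2 mulfV ?mul1r // pnatr_eq0.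
  move=> {3}->; ring.
have -> : \sum_s d s * knl (z s) x = \sum_t \sum_s c t * (c s)^* * knl (z s) (z t) * knl (z s) x.
  rewrite exchange_big; apply: eq_bigr => s _; rewrite /d mulr_suml; apply: eq_bigr => t _ /=.
  by ring.
have -> : \sum_s (d s * knl (z s) y)^* = \sum_t \sum_s c t * (c s)^* * knl (z s) (z t) * knl y (z t).
  apply: eq_bigr => t _; rewrite rmorphM rmorph_sum mulr_suml; apply: eq_bigr => s _ /=.
  by rewrite !rmorphM /= conjCK !knlJ; ring.
have -> : D = \sum_t \sum_s c t * (c s)^* * knl (z s) (z t).
  rewrite exchange_big; apply: eq_bigr => s _; apply: eq_bigr => t _ /=; by ring.
rewrite -big_split -sumrB; apply: eq_bigr => t _ /=.
rewrite -big_split -sumrB; apply: eq_bigr => s _ /=; by ring.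
Qed.

Lemma knl_comb_S_plus : S_plus R n knl_comb.
Proof.
split; first exact: PS_O_ball PS_knl_comb.
move=> M w b Bw.
(* The kernel of [knl_comb] at the test points [w] becomes the pair kernel at the pairs (w_i, z_t),
   with weights b_i c_t. *)
have := @pair_kernel_psd R n ('I_M * 'I_m)%type (fun p => w p.1) (fun p => z p.2)
  (fun p => b p.1 * c p.2) (fun p => Bw p.1) (fun p => Bz p.2).
move=> H; apply: (le_trans H); rewrite le_eqVlt; apply/orP; left; apply/eqP.
rewrite -(pair_bigA _ (fun i t => \sum_q (b i * c t) * (b q.1 * c q.2)^* *
  pair_kernel (w i) (z t) (w q.1) (z q.2))) /=.
apply: eq_bigr => i _; rewrite (eq_bigr (fun t => \sum_j \sum_s (b i * c t) * (b j * c s)^* *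
  pair_kernel (w i) (z t) (w j) (z s))); last by move=> t _; rewrite pair_bigA.
rewrite exchange_big; apply: eq_bigr => j _ /=.
rewrite knl_comb_pair -[(1 - _)^-1]/(knl (w j) (w i)) mulr_suml mulr_sumr.
apply: eq_bigr => t _; rewrite mulr_suml mulr_sumr; apply: eq_bigr => s _.
by rewrite rmorphM /pair_kernel /=; ring.
Qed.

(** The reproducing property, term by term: the Drury weight turns the coefficients of k_w into
    conjugate monomials at [w], and the expansion of [g] converges absolutely at each point. *)
Lemma Q_knl_comb g : O_ball R n g ->
  Q_defined knl_comb g /\ Q knl_comb g = \sum_s d s * (g (z s))^*.
Proof.
move=> Og; have g0E : g 0 = taylor_coef g mi0 := PS_at0 (unit_ball0 _ _) (O_ball_PS Og).
have H : has_sum (Q_term knl_comb g) (\sum_s d s * (g (z s))^* - 2^-1 * D * (g 0)^*).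
  rewrite (_ : Q_term _ _ = fun a => \sum_s d s * (taylor_coef g a * mono (z s) a)^* +
    - ((a == mi0)%:R * (2^-1 * D * (g 0)^*))); last first.
    apply/funext => a; rewrite /Q_term (PS_ball_coef a PS_knl_comb).
    rewrite mulrBl mulrBl; congr (_ - _).
      rewrite !mulr_suml; apply: eq_bigr => s _.
      transitivity (d s * (kcoef (z s) a * (drury_weight R a)%:C) * (taylor_coef g a)^*).
        by move: (kcoef _ _) => k; ring.
      rewrite kcoef_weight; move: (taylor_coef g a) (mono (z s) a) => p q.
      by rewrite rmorphM /=; ring.
    have [->|_] := eqVneq a mi0; last by rewrite !mul0r.
    by rewrite !mul1r drury_weight0 mulr1 -g0E.
  apply: has_sumD.
    apply: has_sum_seq => s; apply: has_sumZ; apply: has_sumJ; exact: O_ball_PS Og _ (Bz s).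
  have := @has_sum_single R n (fun a => - ((a == mi0)%:R * (2^-1 * D * (g 0)^*))) mi0.
  rewrite eqxx mul1r; apply => a /negbTE ->; by rewrite mul0r oppr0.
split; first by right; apply/summable_box; case: H.
rewrite (Q_has_sum H).
have -> : knl_comb 0 = 2^-1 * D.
  rewrite (PS_at0 (unit_ball0 _ _) PS_knl_comb) eqxx mul1r.
  rewrite (eq_bigr d) => [|s _]; first by rewrite -/D; field.
  by rewrite kcoef0 mulr1.
have -> : ((2^-1 * D)^*)%R = 2^-1 * D.
  by rewrite rmorphM /= D_conj fmorphV rmorph_nat.
by ring.
Qed.

End Combination.

Lemma dagger_S_plus : dagger (S_plus R n) `<=` S_plus R n.
Proof.
move=> g [Og Hg]; split=> // m z c Bz.
have [Qd HQ] := Q_knl_comb c Bz Og.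
have := Hg _ (knl_comb_S_plus c Bz) Qd; rewrite HQ.
set X := (X in 0 <= Re X -> _) => X0.
(* Interchanging the two indices matches the terms with g(z_i) to those with conj g(z_j), so the
   quadratic form is twice the real part of Q. *)
rewrite [leRHS](_ : _ = X^* + X).
  have -> : X^* + X = (2 * Re X)%:C.
    by apply: complex_ext; rewrite ?ReD ?ImD ?ReJ ?ImJ /=; ring.
  by rewrite ler0c mulr_ge0.
have XE : X = \sum_i \sum_j c i * (c j)^* * knl (z j) (z i) * (g (z j))^*.
  rewrite exchange_big; apply: eq_bigr => s _; rewrite mulr_suml; apply: eq_bigr => t _ /=.
  by ring.
have XJ : (X^*)%R = \sum_i \sum_j c i * (c j)^* * knl (z j) (z i) * g (z i).
  rewrite /X rmorph_sum; apply: eq_bigr => s _; rewrite rmorphM rmorph_sum mulr_suml /= conjCK.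
  by apply: eq_bigr => t _; rewrite !rmorphM /= conjCK knlJ; ring.
rewrite XJ XE -big_split; apply: eq_bigr => i _; rewrite -big_split; apply: eq_bigr => j _ /=.
by rewrite -[(1 - _)^-1]/(knl (z j) (z i)); ring.
Qed.

End ThirdDuality.

(** For n = 0 the sphere is empty, M^+ consists of imaginary constants and its dual is everything,
    so the first equality fails; [n_gt0] excludes this case. *)
Theorem theorem8p2 (R : realType) (n : nat) (n_gt0 : (0 < n)%N) :
  [/\ dagger (M_plus R n) = O_plus R n,
      dagger (O_plus R n) = M_plus R n
    & dagger (S_plus R n) `<=` S_plus R n].
Proof.
by split; [exact: dagger_M_plus|exact: dagger_O_plus|exact: dagger_S_plus].
Qed.
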